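(* Let $1<p<n$, $p^*=\frac{np}{n-p}$, $p\le q\le p^*$, $\alpha=n-\frac qp(n-p)$, and $\varepsilon>0$. Let $\Theta(t)=t[\log(\mathrm{e}+t)]^{\frac q{p'}+\varepsilon}$. Then there is a constant $C=C(n,p,q,\varepsilon)$ such that for any weight $w$ on $\mathbb{R}^n$ the Sobolev inequality $$\|u\|_{L^q(w)}\le C\,\|\nabla u\|_{L^p\left((\mathrm{M}_{\alpha,\Theta}w)^{p/q}\right)}$$ holds for all $u\in\mathrm{Lip}_c(\mathbb{R}^n)$. Moreover, the inequality fails when $\varepsilon=0$: with $\Theta(t)=t[\log(\mathrm{e}+t)]^{q/p'}$ there is no constant $C$ for which it holds for all weights $w$ and all $u\in\mathrm{Lip}_c(\mathbb{R}^n)$.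
   Context: $p'=p/(p-1)$. A weight is a nonnegative locally integrable function on $\mathbb{R}^n$; $\|g\|_{L^p(v)}=(\int|g|^pv\,dx)^{1/p}$ (with $0\cdot\infty=0$). $\mathcal{L}$ is Lebesgue measure, $\ell(Q)$ the side length of a cube $Q$. $\mathrm{Lip}_c(\mathbb{R}^n)$ is the space of compactly supported Lipschitz functions. For a Young function $\Theta$ (continuous, increasing on $[0,\infty)$, $\Theta(0)=0$; here the explicit function in the claim) the normalized Orlicz average is $\|f\|_{L^\Theta(Q)}=\inf\{\lambda>0:\frac1{\mathcal{L}(Q)}\int_Q\Theta(|f(x)|/\lambda)\,dx\le1\}$, and for $0\le\alpha<n$ the Orlicz fractional maximal function is $$\mathrm{M}_{\alpha,\Theta}f(x)=\sup_{Q\ni x}\ell(Q)^\alpha\|f\|_{L^\Theta(Q)},$$ the supremum being over all cubes $Q$ containing $x$. *)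

(* Defs.v *)
From HB Require Import structures.
From mathcomp Require Import all_boot all_order all_algebra.
From mathcomp Require Import all_classical all_reals all_analysis.
Set Implicit Arguments.
Unset Strict Implicit.
Unset Printing Implicit Defensive.
Import Order.TTheory GRing.Theory Num.Theory.
Import numFieldNormedType.Exports.
Local Open Scope classical_set_scope.
Local Open Scope ring_scope.

(* The library has no measurable structure on row vectors: 'rV[R]_n gets the
   sigma-algebra generated by the coordinate maps into the Borel real line,
   as the library does for n.-tuple. *)
Definition rV_display : Type -> measure_display.
Proof. exact. Qed.

Section measurable_rV.
Context {R : realType} (n : nat).

Let coor : 'I_n -> 'rV[R]_n -> measurableTypeR R := fun i x => x ord0 i.

Let rV_set0 : g_sigma_preimage coor set0.
Proof. exact: sigma_algebra0. Qed.

Let rV_setC A : g_sigma_preimage coor A -> g_sigma_preimage coor (~` A).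
Proof. exact: sigma_algebraC. Qed.

Let rV_bigcup (F : (set 'rV[R]_n)^nat) :
  (forall i, g_sigma_preimage coor (F i)) ->
  g_sigma_preimage coor (\bigcup_i (F i)).
Proof. exact: sigma_algebra_bigcup. Qed.

HB.instance Definition _ := @isMeasurable.Build (rV_display R) 'rV[R]_n
  (g_sigma_preimage coor) rV_set0 rV_setC rV_bigcup.

Lemma measurable_coor (i : 'I_n) : measurable_fun [set: 'rV[R]_n] (coor i).
Proof.
move=> _ Y mY; rewrite setTI; apply: sub_sigma_algebra => /=.
rewrite -bigcup_seq/=; exists i => /=; first by rewrite mem_index_enum.
by exists Y => //; rewrite setTI.
Qed.

Lemma measurable_fun_coorP d (T : measurableType d) (f : T -> 'rV[R]_n) :
  measurable_fun [set: T] f <->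
  forall i, measurable_fun [set: T] (coor i \o f).
Proof.
split=> [mf i|mf]; first exact: measurableT_comp (measurable_coor i) mf.
move=> _ A mA; rewrite setTI.
have : g_sigma_preimage (fun i => coor i \o f) `<=` measurable.
  apply: smallest_sub; first exact: sigma_algebra_measurable.
  by rewrite -bigcup_seq/=; apply: bigcup_sub => i _ _ [B mB <-]; exact: mf.
rewrite g_sigma_preimage_comp; apply.
by exists A => //; rewrite setTI.
Qed.

End measurable_rV.

(* Lebesgue measure on R^n, by iterated products with the library's Lebesgue
   measure on the line, starting from the Dirac mass on the point 'rV[R]_0. *)
Section lebesgue_measure_step.
Context {R : realType} (n : nat).
Variable m : {sigma_finite_measure set 'rV[R]_n -> \bar R}.

Definition cons_rV (z : measurableTypeR R * 'rV[R]_n) : 'rV[R]_(1 + n) :=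
  row_mx (const_mx z.1 : 'rV[R]_1) z.2.

Lemma cons_rV0 z : cons_rV z ord0 ord0 = z.1.
Proof.
rewrite /cons_rV (_ : ord0 = lshift n (ord0 : 'I_1)) ?row_mxEl ?mxE//.
exact: val_inj.
Qed.

Lemma cons_rVS z (i : 'I_n) : cons_rV z ord0 (lift ord0 i) = z.2 ord0 i.
Proof.
rewrite /cons_rV (_ : lift ord0 i = rshift 1 i) ?row_mxEr//.
exact: val_inj.
Qed.

Lemma measurable_cons_rV : measurable_fun setT cons_rV.
Proof.
apply/measurable_fun_coorP => i; case: (unliftP ord0 i) => [j ->|->].
  rewrite (_ : _ \o _ = (fun x : 'rV[R]_n => x ord0 j) \o snd).
    exact: measurableT_comp (measurable_coor j) measurable_snd.
  by apply/funext => z /=; rewrite cons_rVS.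
by rewrite (_ : _ \o _ = fst)//; apply/funext => z /=; rewrite cons_rV0.
Qed.

Definition lebesgue_cons : set 'rV[R]_(1 + n) -> \bar R :=
  pushforward (lebesgue_measure \x m)%E cons_rV.

HB.instance Definition _ := Measure.copy lebesgue_cons
  (measure_function_pushforward__canonical__measure_function_Measure
     (lebesgue_measure \x m)%E measurable_cons_rV).

Let uncons (v : 'rV[R]_(1 + n)) : measurableTypeR R * 'rV[R]_n :=
  (v ord0 (lshift n ord0), rsubmx v).

Let measurable_uncons : measurable_fun setT uncons.
Proof.
apply/measurable_fun_pairP; split; first exact: measurable_coor.
apply/measurable_fun_coorP => i /=.
rewrite (_ : _ \o _ = (fun x : 'rV[R]_(1 + n) => x ord0 (rshift 1 i))).
  exact: measurable_coor.
by apply/funext => v /=; rewrite mxE.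
Qed.

Let cons_rVK : cancel cons_rV uncons.
Proof.
by case=> a v; rewrite /uncons /cons_rV row_mxKr row_mxEl mxE.
Qed.

Let lebesgue_cons_sigma_finite : sigma_finite setT lebesgue_cons.
Proof.
have /sigma_finiteP[F [FT ndF Foo]] := sigma_finiteT (@lebesgue_measure R).
have /sigma_finiteP[G [GT ndG Goo]] := sigma_finiteT m.
exists (fun k => uncons @^-1` (F k `*` G k)).
  rewrite -preimage_bigcup (_ : \bigcup_k _ = setT) ?preimage_setT//.
  rewrite -setXTT FT GT predeqE => -[x y].
  split=> [[k _ []]|]; first by split; exists k.
  move=> [/= [i _ Fx] [k _ Gy]]; exists (maxn i k) => //; split.
    by move: x Fx; exact/subsetPset/ndF/leq_maxl.
  by move: y Gy; exact/subsetPset/ndG/leq_maxr.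
move=> k; have [mF Fk] := Foo k; have [mG Gk] := Goo k; split.
  rewrite -[X in measurable X]setTI; apply: measurable_uncons => //.
  exact: measurableX.
rewrite /lebesgue_cons /pushforward -comp_preimage.
rewrite (_ : uncons \o cons_rV = id); last exact/funext/cons_rVK.
by rewrite preimage_id product_measure1E// lte_mul_pinfty// ge0_fin_numE.
Qed.

HB.instance Definition _ := Measure_isSigmaFinite.Build _ _ _ lebesgue_cons
  lebesgue_cons_sigma_finite.

End lebesgue_measure_step.

Fixpoint lebesgue_rV {R : realType} (n : nat) :
    {sigma_finite_measure set 'rV[R]_n -> \bar R} :=
  if n is n'.+1 then lebesgue_cons (lebesgue_rV n') else \d_(0 : 'rV[R]_0).

Lemma lebesgue_rV_prod {R : realType} (n : nat)
    (A : 'I_n -> set (measurableTypeR R)) :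
  (forall i, measurable (A i)) ->
  (lebesgue_rV n [set x : 'rV[R]_n | forall i, A i (x ord0 i)] =
   \prod_(i < n) lebesgue_measure (A i))%E.
Proof.
elim: n => [|n IHn] in A *; move=> mA.
  by rewrite big_ord0 /= diracE mem_set//= => -[].
rewrite big_ord_recl -IHn; last by move=> i; exact: mA.
rewrite /= /lebesgue_cons /pushforward -product_measure1E//; last first.
  rewrite (_ : [set _ | _] = \bigcap_(i in [set: 'I_n])
      ((fun x : 'rV[R]_n => x ord0 i) @^-1` A (lift ord0 i))).
    apply: fin_bigcap_measurable => // i _.
    by rewrite -[X in measurable X]setTI; exact: measurable_coor.
  by rewrite predeqE => x; split=> [Ax i _|Ax i]; exact: Ax.
congr (_ \x _)%E; apply/seteqP; split => z /=.
  by move=> Az; rewrite -[z.1]cons_rV0; split=> [|i]; rewrite -?cons_rVS; exact: Az.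
move=> [Az1 Az2] i; case: (unliftP ord0 i) => [j ->|->].
  by rewrite cons_rVS; exact: Az2.
by rewrite cons_rV0.
Qed.

Section sobolev_defs.
Context {R : realType} (n : nat).
Implicit Types (f g u w : 'rV[R]_n -> R) (v : 'rV[R]_n -> \bar R)
  (p q alpha C : R) (Theta : R -> R).

(* The sigma-algebra on 'rV[R]_n being the Borel one, a function is Lebesgue
   measurable iff it agrees almost everywhere with a measurable one. The
   library's integral of a nonnegative function is the supremum of the
   integrals of the (Borel) simple functions below it, so that it is the
   Lebesgue integral for all Lebesgue measurable nonnegative functions. *)
Definition lebesgue_measurable_fun f :=
  exists2 g, measurable_fun [set: 'rV[R]_n] g &
             ae_eq (lebesgue_rV n) setT f g.

Definition weight w :=
  [/\ forall x, 0 <= w x, lebesgue_measurable_fun w &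
      forall K : set 'rV[R]_n, compact K ->
        (\int[lebesgue_rV n]_(x in K) (w x)%:E < +oo)%E].

(* [v] may take the value +oo; the product of \bar R satisfies 0 * +oo = 0. *)
Definition weighted_Lnorm p v g : \bar R :=
  ((\int[lebesgue_rV n]_x ((`|g x| `^ p)%:E * v x)) `^ p^-1)%E.

(* Partial derivatives of a Lipschitz function exist almost everywhere; on the
   remaining null set the values of 'D_v are irrelevant. *)
Definition gradient u (x : 'rV[R]_n) : 'rV[R]_n :=
  \row_(i < n) 'D_(delta_mx ord0 i) (u : 'rV[R]_n -> R^o) x.

(* The norm of the library on 'rV[R]_n is the sup norm. *)
Definition euclidean_norm (x : 'rV[R]_n) : R :=
  Num.sqrt (\sum_(i < n) x ord0 i ^+ 2).

Definition Lip_c u :=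
  [lipschitz (u x : R^o) | x in [set: 'rV[R]_n]] /\
  compact (closure [set x | u x != 0]).

Definition cube (a : 'rV[R]_n) (l : R) : set 'rV[R]_n :=
  [set x | forall i, a ord0 i <= x ord0 i <= a ord0 i + l].

Lemma lebesgue_rV_cube a l : 0 < l -> lebesgue_rV n (cube a l) = (l ^+ n)%:E.
Proof.
move=> l0; pose A i : set (measurableTypeR R) := `[a ord0 i, a ord0 i + l]%classic.
rewrite (_ : cube a l = [set x | forall i, A i (x ord0 i)]); last first.
  by apply/seteqP; split=> x + i => /(_ i); rewrite /A /= in_itv.
rewrite (lebesgue_rV_prod (A := A)) => [|i]; last exact: measurable_itv.
rewrite (eq_bigr (fun=> l%:E)) => [|i _]; last first.
  by rewrite /A lebesgue_measure_itv/= lte_fin ltrDl l0 -EFinB addrAC subrr add0r.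
by rewrite prodEFin prodr_const card_ord.
Qed.

Definition orlicz_average Theta f (Q : set 'rV[R]_n) : \bar R :=
  ereal_inf [set lambda%:E | lambda in [set lambda : R | 0 < lambda /\
    (((fine (lebesgue_rV n Q))^-1)%:E *
     \int[lebesgue_rV n]_(x in Q) (Theta (`|f x| / lambda))%:E <= 1)%E]].

Definition orlicz_maximal alpha Theta f (x : 'rV[R]_n) : \bar R :=
  ereal_sup [set y | exists a l, [/\ 0 < l, cube a l x &
    y = ((l `^ alpha)%:E * orlicz_average Theta f (cube a l))%E]].

Definition sobolev_inequality p q alpha Theta C w u :=
  (weighted_Lnorm q (EFin \o w) u <=
   C%:E * weighted_Lnorm p
            (fun x => orlicz_maximal alpha Theta w x `^ (p / q))
            (fun x => euclidean_norm (gradient u x)))%E.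

End sobolev_defs.

Definition LlogL {R : realType} (s t : R) : R := t * ln (expR 1 + t) `^ s.

Definition conjugate_exponent {R : realType} (p : R) : R := p / (p - 1).

Definition sobolev_exponent {R : realType} (n : nat) (p : R) : R :=
  n%:R * p / (n%:R - p).

(* Main.v *)
Require Import Defs.
From HB Require Import structures.
From mathcomp Require Import all_boot all_order all_algebra.
From mathcomp Require Import all_classical all_reals all_analysis.
From mathcomp Require Import ring lra zify measurable_realfun.
Set Implicit Arguments.
Unset Strict Implicit.
Unset Printing Implicit Defensive.
Import Order.TTheory GRing.Theory Num.Theory.
Import numFieldNormedType.Exports.
Local Open Scope classical_set_scope.
Local Open Scope ring_scope.

(* For eps > 0, Poincare inequalities on consecutive dyadic cubes bound a
   nonnegative Lipschitz u by the sum over the scales 2^-i of 2^-i times the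
   dyadic means of |grad u|, up to its mean over a huge cube. Integrating
   against mu = w 1_(u >= t) and moving the means from |grad u| to mu, the weak
   type bound reduces to an estimate of the integral of |grad u| times the sum
   of the 2^-i A_i mu. The scales are grouped by the stopping cubes on which
   A_i mu first exceeds a level T = 2^k; there Young's inequality separates
   |grad u|^p (M w)^(p/q) from a power of A_i mu, which the Orlicz average of w
   bounds by the mean of the part of mu above T/2 damped by the factor
   ln(e + mu/T)^-(1 + eps'). The damped parts sum over k to a multiple of mu,
   because eps' > 0. Truncation of |u| at dyadic heights turns the weak type
   bound into the strong one.

   For eps = 0 let w be the indicator of the unit cube, for which M w(x) decays
   like |x|^(alpha - n) (log |x|)^(q/p'), and let u be the sum over j <= N of
   1/j times a cutoff at radius 2^j. The left-hand side is the harmonic sum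
   H_N, while the energy of u is O(H_N), so that H_N = O(H_N^(1/p)). *)

(** * Dyadic cubes and means *)

(** The obstacle is the number of levels. Young's inequality with a fixed constant would charge
    [|grad u|^p (M w)^(p/q)] once for every level passed at a point, and that number is unbounded.
    It is therefore used with a weight that is at least [2^((j-k)/2)] at level [k] when level [j] is
    also passed: the power [1-p] of this weight is summable over the levels, while its growth is
    beaten by the factor [2^-(j-k)] in the bound for the part of a level-[k] stopping cube where
    level [j] is passed. The value of alpha makes the side lengths cancel in Young's inequality.
    With [p' = p/(p-1)], the exponent [q/p' + eps] of the logarithm times [p'/q] equals [1 + eps']
    with [eps' = eps p'/q]. At [eps = 0] the damped parts would add up like a harmonic series, and
    the counterexample realizes this series, one term per annulus. The maximal function need not be
    Borel measurable, so the argument runs with a dyadic minorant of it and with bounded Borel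
    truncations of [w]; comparison of lower integrals and monotone convergence lead back to the
    given data. *)

Section dyadic.
Context {R : realType} (n : nat).
Local Notation T := 'rV[R]_n.
Local Notation leb := (lebesgue_rV n).
Variable ell : R.
Hypothesis ell_gt0 : 0 < ell.
Implicit Types (x y z : T).

(* The grid is anchored at -ell/2, so that a large ell puts any bounded set
   inside the generation-0 cube of the origin. *)
Definition dindex i (c : 'I_n) (x : T) : int :=
  Num.floor (2 ^+ i * (x ord0 c / ell + 2^-1)).

Definition dcube i (x : T) : set T := [set y | forall c, dindex i c y = dindex i c x].

Definition dside i : R := ell / 2 ^+ i.

Lemma dside_gt0 i : 0 < dside i.
Proof. by rewrite divr_gt0// exprn_gt0. Qed.

Lemma dcube_refl i x : dcube i x x. Proof. by []. Qed.

Lemma dcube_sym i x y : dcube i x y -> dcube i y x.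
Proof. by move=> h c; rewrite h. Qed.

Lemma dcube_trans i x y z : dcube i x y -> dcube i y z -> dcube i x z.
Proof. by move=> h1 h2 c; rewrite h2 h1. Qed.

Lemma dcube_eq i x y : dcube i x y -> dcube i x = dcube i y.
Proof.
move=> h; apply/seteqP; split=> z; first exact: dcube_trans (dcube_sym h).
exact: dcube_trans h.
Qed.

Definition dcorner i x : T :=
  \row_c (ell * ((dindex i c x)%:~R / 2 ^+ i - 2^-1)).

Lemma dindexP i c x y : (dindex i c y == dindex i c x) =
  (dcorner i x ord0 c <= y ord0 c < dcorner i x ord0 c + dside i).
Proof.
have p2 : 0 < 2 ^+ i :> R by rewrite exprn_gt0.
rewrite /dcorner mxE [dindex i c y]/dindex floor_eq; move: (dindex i c x) => k.
have -> : ell * (k%:~R / 2 ^+ i - 2^-1) + dside i =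
   ell * ((k + 1)%:~R / 2 ^+ i - 2^-1).
  rewrite /dside intrD; field; lra.
have E (a : R) : (a / 2 ^+ i - 2^-1) * ell = ell * (a / 2 ^+ i - 2^-1) by rewrite mulrC.
congr (_ && _).
  by rewrite -E -ler_pdivlMr// lerBlDr ler_pdivrMr// mulrC.
by rewrite -E -ltr_pdivrMr// ltrBrDr ltr_pdivlMr// mulrC.
Qed.

Lemma dcube_itv i x : dcube i x =
  [set y : T | forall c, `[dcorner i x ord0 c, dcorner i x ord0 c + dside i[%classic (y ord0 c)].
Proof.
apply/seteqP; split=> y /= h c; have := h c; rewrite /= in_itv/=.
  by move/eqP; rewrite dindexP.
by rewrite -dindexP => /eqP.
Qed.

Lemma measurable_coordinatewise (A : 'I_n -> set (measurableTypeR R)) :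
  (forall c, measurable (A c)) ->
  measurable [set x : T | forall c, A c (x ord0 c)].
Proof.
move=> mA; rewrite (_ : [set _ | _] = \bigcap_(i in [set: 'I_n])
      ((fun x : T => x ord0 i) @^-1` A i)).
  apply: fin_bigcap_measurable => // i _.
  by rewrite -[X in measurable X]setTI; exact: measurable_coor.
by rewrite predeqE => x; split=> [Ax i _|Ax i]; exact: Ax.
Qed.

Lemma measurable_dcube i x : measurable (dcube i x).
Proof.
rewrite dcube_itv.
apply: (measurable_coordinatewise (A := fun c => `[dcorner i x ord0 c, dcorner i x ord0 c + dside i[%classic)).
by move=> c; exact: measurable_itv.
Qed.

Lemma lebesgue_dcube i x : leb (dcube i x) = (dside i ^+ n)%:E.
Proof.
rewrite dcube_itv.
rewrite (@lebesgue_rV_prod R n (fun c => `[dcorner i x ord0 c, dcorner i x ord0 c + dside i[%classic)) => [|c]; last exact: measurable_itv.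
rewrite (eq_bigr (fun=> (dside i)%:E)) => [|c _]; last first.
  by rewrite lebesgue_measure_itv/= lte_fin ltrDl dside_gt0 -EFinB addrAC subrr add0r.
by rewrite prodEFin prodr_const card_ord.
Qed.

Lemma dcube_subset_cube i x : dcube i x `<=` cube (dcorner i x) (dside i).
Proof.
move=> y; rewrite dcube_itv => h c; have := h c; rewrite /= in_itv/= => /andP[-> /ltW ->].
by [].
Qed.

Lemma dcube_le i j x y : (i <= j)%N -> dcube j x y -> dcube i x y.
Proof.
move=> ij h c; have /eqP := h c; rewrite dindexP.
have p2 k : 0 < 2 ^+ k :> R by rewrite exprn_gt0.
rewrite /dindex; set a := y ord0 c / ell + 2^-1; set b := x ord0 c / ell + 2^-1.
have hab : Num.floor (2 ^+ j * a) = Num.floor (2 ^+ j * b) by exact: h.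
move=> _; rewrite -(subnKC ij) exprD in hab; move: hab.
set m := (2 ^ (j - i))%N.
have m0 : (0 < m)%N by rewrite expn_gt0.
have -> : 2 ^+ (j - i) = m%:R :> R by rewrite natrX.
(* The coarse index is the Euclidean quotient of the fine index by [2 ^ (j - i)], so equal fine
   indices force equal coarse ones. *)
have key (t : R) : Num.floor t = (Num.floor (t * m%:R) %/ m%:Z)%Z.
  apply/eqP; rewrite floor_eq.
  set f := Num.floor (t * m%:R).
  have mR : 0 < m%:R :> R by rewrite ltr0n.
  have := floor_itv (t * m%:R); rewrite -/f => /andP[f1 f2].
  have fe := divz_eq f m%:Z; set qq := (f %/ m%:Z)%Z in fe *.
  have r0 : (0 <= (f %% m%:Z)%Z) by rewrite modz_ge0// -lt0n.
  have r1 : ((f %% m%:Z)%Z < m%:Z) by rewrite ltz_pmod.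
  apply/andP; split.
    rewrite -(ler_pM2r mR); apply: le_trans f1.
    by rewrite fe intrD intrM lerDl ler0z.
  rewrite -(ltr_pM2r mR); apply: lt_le_trans f2 _.
  have : f + 1 <= (qq + 1) * m%:Z by rewrite fe mulrDl mul1r -addrA lerD2l lezD1.
  by move=> ?; rewrite -[m%:R]/(m%:Z%:~R) -intrM ler_int.
by move=> hab; rewrite key [RHS]key -mulrA -mulrA [a * _]mulrC [b * _]mulrC !mulrA hab.
Qed.

Definition dgraph i : set (T * T) := [set z | dcube i z.1 z.2].

(** In each coordinate the relation is a countable union of squares of the slabs [S c z]; [unpickle]
    enumerates the integers [z], and codes of no integer contribute [set0]. *)
Lemma measurable_dgraph i : measurable (dgraph i).
Proof.
pose S c (k : int) : set T := [set x | dindex i c x = k].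
have mS c k : measurable (S c k).
  have [[x0 h0]|h] := pselect (exists x0, S c k x0); last first.
    by rewrite (_ : S c k = set0)//; apply/seteqP; split=> x//= hx; apply: h; exists x.
  rewrite (_ : S c k = (fun x : T => x ord0 c) @^-1`
     `[dcorner i x0 ord0 c, dcorner i x0 ord0 c + dside i[%classic).
    by rewrite -[X in measurable X]setTI; apply: (measurable_coor c) => //; exact: measurable_itv.
  by rewrite -h0; apply/seteqP; split=> x /=; rewrite in_itv/= -dindexP => /eqP.
rewrite (_ : dgraph i = \bigcap_(c in [set: 'I_n]) \bigcup_k
   oapp (fun z0 : int => S c z0 `*` S c z0) set0 (unpickle k)).
  apply: fin_bigcap_measurable => // c _; apply: bigcup_measurable => k _.
  by case: (unpickle k) => [z|] //=; exact: measurableX.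
apply/seteqP; split=> -[x y] /=.
  move=> h c _; exists (pickle (dindex i c x)); first by [].
  by rewrite pickleK; split; [rewrite /S/= | rewrite /S/=; exact: h].
move=> h c; have [k _] := h c I; case: (unpickle k) => [z|]//= [-> ->]. by [].
Qed.

(* There are only countably many cubes of each generation. *)
Lemma measurable_dconst d (U : measurableType d) i (f : T -> U) :
  (forall x y, dcube i x y -> f x = f y) -> measurable_fun setT f.
Proof.
move=> fc _ Y mY; rewrite setTI.
pose cls x : {ffun 'I_n -> int} := [ffun c => dindex i c x].
rewrite (_ : _ @^-1` _ = \bigcup_k [set x | f x \in Y /\ pickle (cls x) = k]).
  apply: bigcup_measurable => k _.
  have [[x0 [h0 h1]]|h] := pselect (exists x, f x \in Y /\ pickle (cls x) = k); last first.
    by rewrite (_ : [set _ | _] = set0)//; apply/seteqP; split=> x//= hx; apply: h; exists x.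
  rewrite (_ : [set _ | _] = dcube i x0); first exact: measurable_dcube.
  apply/seteqP; split=> x /=.
    move=> [_ hk] c; have /(pcan_inj pickleK)/ffunP/(_ c) : pickle (cls x) = pickle (cls x0) by rewrite hk.
    by rewrite !ffunE.
  move=> hx; rewrite -(fc _ _ hx) h0 -h1; split=> //; congr pickle.
  by apply/ffunP => c; rewrite !ffunE.
apply/seteqP; split=> x /=.
  by move=> h; exists (pickle (cls x)) => //; split=> //; rewrite inE.
by move=> [k _ [+ _]]; rewrite inE.
Qed.

End dyadic.

Section dmean.
Context {R : realType} (n : nat).
Local Notation T := 'rV[R]_n.
Local Notation leb := (lebesgue_rV n).
Variable ell : R.
Hypothesis ell_gt0 : 0 < ell.
Implicit Types (x y z : T) (f g psi : T -> \bar R).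
Local Notation dcube := (dcube ell).
Local Notation dside := (dside ell).
Local Open Scope ereal_scope.

Definition dmean i f x : \bar R :=
  ((dside i ^+ n)^-1)%:E * \int[leb]_(y in dcube i x) f y.

Let vol_gt0 i : (0 < (dside i ^+ n)^-1)%R.
Proof. by rewrite invr_gt0 exprn_gt0// dside_gt0. Qed.

Let mcube i x : measurable (dcube i x).
Proof. exact: measurable_dcube. Qed.
Hint Resolve mcube : core.

Lemma dmean_ge0 i f x : (forall y, 0 <= f y) -> 0 <= dmean i f x.
Proof. by move=> f0; rewrite mule_ge0 ?lee_fin ?(ltW (vol_gt0 i))// integral_ge0. Qed.

Lemma dmean_dconst i f x y : dcube i x y -> dmean i f x = dmean i f y.
Proof. by move=> h; rewrite /dmean (dcube_eq h). Qed.

Lemma measurable_dmean i f : measurable_fun setT (dmean i f).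
Proof. by apply: (measurable_dconst ell_gt0 (i := i)) => x y; exact: dmean_dconst. Qed.
Hint Resolve measurable_dmean : core.

Lemma dmean_cst i (c : R) x : dmean i (fun=> c%:E) x = c%:E.
Proof.
rewrite /dmean integral_cst//= lebesgue_dcube// -!EFinM mulrCA mulVf ?mulr1//.
by rewrite gt_eqF// exprn_gt0// dside_gt0.
Qed.

Lemma le_dmean i f g x : (forall y, 0 <= f y) -> measurable_fun setT f ->
  measurable_fun setT g -> (forall y, dcube i x y -> f y <= g y) -> dmean i f x <= dmean i g x.
Proof.
move=> f0 mf mg fg; apply: lee_wpmul2l; first by rewrite lee_fin ltW.
by apply: ge0_le_integral => //; exact: measurable_funTS.
Qed.

Lemma dmeanD i f g x : (forall y, 0 <= f y) -> measurable_fun setT f ->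
  (forall y, 0 <= g y) -> measurable_fun setT g ->
  dmean i (f \+ g) x = dmean i f x + dmean i g x.
Proof.
move=> f0 mf g0 mg; rewrite /dmean ge0_integralD//; try exact: measurable_funTS.
by rewrite ge0_muleDr ?integral_ge0.
Qed.

Lemma dmeanZl i psi f x : (forall y, 0 <= f y) -> measurable_fun setT f ->
  (forall y, 0 <= psi y) -> (forall y, dcube i x y -> psi x = psi y) ->
  dmean i (psi \* f) x = psi x * dmean i f x.
Proof.
move=> f0 mf p0 pc; rewrite /dmean (eq_integral (fun y => psi x * f y)); last first.
  by move=> y; rewrite inE => /pc ->.
by rewrite ge0_integralZl//; [rewrite muleCA | exact: measurable_funTS].
Qed.

(* Tonelli on the relation "in the same cube", which is symmetric. *)
Lemma dmean_adjoint i f g : (forall y, 0 <= f y) -> measurable_fun setT f ->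
  (forall y, 0 <= g y) -> measurable_fun setT g ->
  \int[leb]_x (f x * dmean i g x) = \int[leb]_x (dmean i f x * g x).
Proof.
move=> f0 mf g0 mg.
pose c : \bar R := ((dside i ^+ n)^-1)%:E.
pose I (z : T * T) : \bar R := (\1_(dgraph ell i) z)%:E.
have mI : measurable_fun setT I.
  apply/measurable_EFinP; apply: measurable_indic.
  exact: measurable_dgraph.
have I0 (z : T * T) : 0 <= I z by rewrite lee_fin.
pose F (z : T * T) := c * (f z.1 * (I z * g z.2)).
have mF : measurable_fun setT F.
  apply: emeasurable_funM => //; apply: emeasurable_funM.
    exact: (measurableT_comp mf measurable_fst).
  apply: emeasurable_funM => //; exact: (measurableT_comp mg measurable_snd).
have c0 : 0 <= c by rewrite lee_fin ltW.
have F0 (z : T * T) : 0 <= F z by rewrite !mule_ge0.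
have := @fubini_tonelli _ _ _ _ _ leb leb F mF F0.
have mIx x : measurable_fun setT (fun y => I (x, y)).
  by apply: (measurableT_comp mI); exact: measurable_pair1.
have mIy y : measurable_fun setT (fun x => I (x, y)).
  by apply: (measurableT_comp mI); exact: measurable_pair2.
have IE (x y : T) : I (x, y) = (\1_(dcube i x) y)%:E.
  by rewrite /I !indicE; congr (_%:R%:E); apply/idP/idP; rewrite !inE.
have IE' (x y : T) : I (x, y) = (\1_(dcube i y) x)%:E.
  rewrite IE !indicE; congr ((nat_of_bool _)%:R%:E).
  by apply/idP/idP; rewrite !inE => h; exact: dcube_sym.
have -> : (fun x => \int[leb]_y F (x, y)) = (fun x => f x * dmean i g x).
  apply/funext => x; rewrite /F/= /dmean -/c.
  under eq_integral do rewrite muleA.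
  rewrite ge0_integralZl//; last 3 first.
  - by apply: emeasurable_funM.
  - by move=> y _; rewrite mule_ge0.
  - by rewrite mule_ge0.
  rewrite [c * f x]muleC -muleA; congr (_ * (_ * _)).
  rewrite [RHS]integral_mkcond; apply: eq_integral => y _.
  by rewrite IE patchE indicE; case: (_ \in _); rewrite ?mul1e ?mul0e.
have -> : (fun y => \int[leb]_x F (x, y)) = (fun y => dmean i f y * g y).
  apply/funext => y; rewrite /F/= /dmean -/c.
  rewrite (eq_integral (fun x => (c * g y) * (f x * I (x, y)))); last first.
    by move=> x _; rewrite -[RHS]muleA [g y * _]muleCA [g y * _]muleC.
  rewrite ge0_integralZl//; last 3 first.
  - by apply: emeasurable_funM.
  - by move=> x _; rewrite mule_ge0.
  - by rewrite mule_ge0.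
  rewrite -muleA [g y * _]muleC muleA; congr (_ * _ * _).
  rewrite [RHS]integral_mkcond; apply: eq_integral => x _.
  by rewrite IE' patchE indicE; case: (_ \in _); rewrite ?mule1 ?mule0.
by [].
Qed.

(** The mean of generation [i] acts as a conditional expectation: by self-adjointness it falls on
    [psi], which it fixes. *)
Lemma integral_dmean i psi f : (forall y, 0 <= f y) -> measurable_fun setT f ->
  (forall y, 0 <= psi y) -> (forall x y, dcube i x y -> psi x = psi y) ->
  \int[leb]_x (psi x * dmean i f x) = \int[leb]_x (psi x * f x).
Proof.
move=> f0 mf p0 pc.
have mp : measurable_fun setT psi by exact: (measurable_dconst ell_gt0 (i := i)).
rewrite dmean_adjoint//; apply: eq_integral => x _; congr (_ * _).
have -> : psi = psi \* cst 1 by apply/funext => y; rewrite /= mule1.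
rewrite dmeanZl//; last by move=> y; exact: pc.
by rewrite dmean_cst.
Qed.

Lemma dmean_succ i f x : (forall y, 0 <= f y) -> measurable_fun setT f ->
  dmean i.+1 f x <= (2 ^+ n)%:E * dmean i f x.
Proof.
move=> f0 mf; rewrite /dmean muleA -EFinM.
have -> : (2 ^+ n / (dside i ^+ n) = (dside i.+1 ^+ n)^-1)%R.
  rewrite -!exprVn -exprMn; congr (_ ^+ _)%R.
  by rewrite /dside exprS !invf_div; field; rewrite gt_eqF.
apply: lee_wpmul2l; first by rewrite lee_fin ltW.
by apply: ge0_subset_integral => //; [exact: measurable_funTS|move=> y; exact: (dcube_le ell_gt0 (leqnSn i))].
Qed.

Lemma dmean_le_integral i f x : (forall y, 0 <= f y) -> measurable_fun setT f ->
  dmean i f x <= ((dside i ^+ n)^-1)%:E * \int[leb]_y f y.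
Proof.
move=> f0 mf; apply: lee_wpmul2l; first by rewrite lee_fin ltW.
by apply: ge0_subset_integral => //; exact: measurable_funTS.
Qed.

End dmean.

(** * Powers, logarithms and a scaled Young inequality *)

Section log_estimates.
Context {R : realType}.
Implicit Types (t T e s a b : R).

Lemma ler_eq (a b : R) : a = b -> a <= b.
Proof. by move=> ->. Qed.

Lemma sum_powR_le N e : 0 < e ->
  \sum_(m < N) m.+1%:R `^ (- (1 + e)) <= 1 + e^-1 :> R.
Proof.
move=> e0.
have step m : (m.+2%:R : R) `^ (- (1 + e)) <= e^-1 * (m.+1%:R `^ (- e) - m.+2%:R `^ (- e)).
  set y : R := m.+2%:R.
  have y0 : 0 < y by rewrite ltr0n.
  have y1 : 0 < 1 - y^-1 by rewrite subr_gt0 invf_lt1// ltr1n.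
  have -> : m.+1%:R = y * (1 - y^-1) :> R.
    by rewrite mulrBr mulr1 divff ?gt_eqF// /y -[m.+2%:R]natr1 addrK.
  rewrite powRM ?(ltW y0) ?(ltW y1)//.
  have h : 1 + e / y <= (1 - y^-1) `^ (- e).
    rewrite /powR gt_eqF//; apply: le_trans (expR_ge1Dx _) _.
    rewrite ler_expR mulNr -mulrN ler_wpM2l ?(ltW e0)// lerNr.
    by have := @le_ln1Dx R (- y^-1); rewrite ltrN2; apply; rewrite invf_lt1// ltr1n.
  have -> : y `^ (- (1 + e)) = y `^ (- e) / y.
    rewrite opprD powRD; last by apply/implyP => _; rewrite (gt_eqF y0).
    by rewrite powR_inv1 ?(ltW y0)// mulrC.
  rewrite [e^-1 * _]mulrC ler_pdivlMr// -[X in _ <= _ - X]mulr1 -mulrBr -mulrA.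
  by rewrite ler_wpM2l ?powR_ge0// lerBrDl mulrC.
case: N => [|N]; first by rewrite big_ord0 addr_ge0// invr_ge0 ltW.
suff : \sum_(m < N.+1) m.+1%:R `^ (- (1 + e)) <= 1 + e^-1 * (1 - N.+1%:R `^ (- e)) :> R.
  by move=> h; apply: le_trans h _; rewrite lerD2l ler_piMr ?invr_ge0 ?(ltW e0).
elim: N => [|N IH]; first by rewrite big_ord1 !powR1 subrr mulr0 addr0.
rewrite big_ord_recr/=; apply: le_trans (lerD IH (step N)) _.
rewrite -addrA -mulrDr; apply: ler_eq; congr (_ + _ * _); ring.
Qed.

Lemma sum_rev_le K kap (f : nat -> R) : (kap < K)%N ->
  \sum_(k < K) (if (k <= kap)%N then f (kap - k)%N else 0) = \sum_(m < kap.+1) f m.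
Proof.
move=> kK; rewrite [RHS](reindex_inj rev_ord_inj)/=.
under [RHS]eq_bigr => m _ do rewrite subSS.
rewrite (big_ord_widen K (fun k => f (kap - k)%N) kK) [RHS]big_mkcond/=.
by apply: eq_bigr => k _; rewrite ltnS.
Qed.

Lemma ln_e_ge1 t : 0 <= t -> 1 <= ln (expR 1 + t).
Proof.
move=> t0; rewrite -[leLHS](expRK 1) ler_ln ?posrE ?expR_gt0//.
  by rewrite lerDl.
by rewrite ltr_wpDr// expR_gt0.
Qed.

(** Since [(e + t)^2 >= 2 t >= 2^m], twice the logarithm is at least [m * ln 2]; the logarithm is
    also at least [1 >= ln 2]. The quarter leaves room for both bounds, hence for [m + 1]. *)
Lemma ln_e_pow_ge m t : 2 ^+ m / 2 <= t -> ln 2 / 4 * m.+1%:R <= ln (expR 1 + t).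
Proof.
move=> ht; have t0 : 0 <= t by apply: le_trans ht; rewrite divr_ge0// exprn_ge0.
have h1 := ln_e_ge1 t0.
have e0 : 0 < expR 1 + t by rewrite ltr_wpDr// expR_gt0.
have ln2 : 0 <= ln (2 : R) <= 1.
  rewrite ln_ge0 ?ler1n//=; have := @le_ln1Dx R 1; rewrite -(natrD _ 1 1); apply.
  by rewrite (@lt_trans _ _ 0)// ltrN10.
have h2 : m%:R * ln 2 <= 2 * ln (expR 1 + t).
  have -> : m%:R * ln 2 = ln (2 ^+ m) :> R by rewrite lnXn// mulr_natl.
  have -> : 2 * ln (expR 1 + t) = ln ((expR 1 + t) ^+ 2).
    by rewrite lnXn// mulr_natl.
  rewrite ler_ln ?posrE ?exprn_gt0//.
  have e1 : 1 <= expR 1 :> R by rewrite -[leLHS]expR0 ler_expR.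
  apply: le_trans (_ : 2 * t <= _); first by rewrite -ler_pdivrMl// mulrC.
  have h3 : t <= expR 1 * t by rewrite ler_peMl.
  rewrite sqrrD; have := sqr_ge0 (expR 1 : R); have := sqr_ge0 t; lra.
have -> : m.+1%:R = m%:R + 1 :> R by rewrite natr1.
case/andP: ln2 => l0 l1; lra.
Qed.

(** Counted downwards from the largest level below [t], the logarithms grow at least linearly, so
    the sum is dominated by the convergent series of [m^-(1+e)], uniformly in [t] and [K]. This is
    where the positive excess [e] of the exponent pays. *)
Lemma sum_log_levels K e t T : 0 < e -> 0 < T -> 0 <= t ->
  \sum_(k < K) (if T * 2 ^+ k / 2 < t then
     ln (expR 1 + t / (T * 2 ^+ k)) `^ (- (1 + e)) else 0) <=
  (ln 2 / 4) `^ (- (1 + e)) * (1 + e^-1).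
Proof.
move=> e0 T0 t0.
have [hn|hk] := pselect (forall k : 'I_K, ~ (T * 2 ^+ k / 2 < t)).
  rewrite big1 => [|k _]; last by case: ifP => // /hn.
  by rewrite mulr_ge0 ?powR_ge0// addr_ge0// invr_ge0 ltW.
pose P k := (k < K)%N && (T * 2 ^+ k / 2 < t).
have exP : exists k, P k.
  apply: contrapT => h; apply: hk => k hk; apply: h; exists k.
  by rewrite /P ltn_ord.
have ubP k : P k -> (k <= K)%N by case/andP => /ltnW.
case: (ex_maxnP exP ubP) => kap /andP[kapK hkap] kapmax.
have c0 : 0 < ln 2 / 4 :> R by rewrite divr_gt0// ln_gt0// ltr1n.
apply: le_trans (_ : \sum_(k < K) (if (k <= kap)%N then
   (ln 2 / 4) `^ (- (1 + e)) * (kap - k).+1%:R `^ (- (1 + e)) else 0) <= _).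
  apply: ler_sum => k _; case: ifP => hk1; last first.
    by case: ifP => // _; rewrite mulr_ge0// powR_ge0.
  have kk : (k <= kap)%N by apply: kapmax; rewrite /P ltn_ord hk1.
  rewrite kk -powRM ?ler0n ?(ltW c0)//.
  have Tk : 0 < T * 2 ^+ k by rewrite mulr_gt0// exprn_gt0.
  have hm : 2 ^+ (kap - k) / 2 <= t / (T * 2 ^+ k).
    rewrite ler_pdivlMr//; apply: le_trans (ltW hkap).
    by rewrite -[X in _ <= T * 2 ^+ X / _](subnKC kk) exprD; apply: ler_eq; ring.
  rewrite !powRN lef_pV2 ?posrE ?powR_gt0//; last 2 first.
  - by rewrite (@lt_le_trans _ _ 1)// ln_e_ge1// divr_ge0// ltW.
  - by rewrite mulr_gt0// ltr0n.
  apply: ge0_ler_powR; rewrite ?nnegrE.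
  - by rewrite addr_ge0// ltW.
  - by rewrite mulr_ge0 ?ler0n// ltW.
  - by rewrite (@le_trans _ _ 1)// ln_e_ge1// divr_ge0// ltW.
  - exact: ln_e_pow_ge.
rewrite (sum_rev_le (fun m => (ln 2 / 4) `^ (- (1 + e)) * m.+1%:R `^ (- (1 + e))) kapK).
by rewrite -mulr_sumr ler_wpM2l ?powR_ge0// sum_powR_le.
Qed.

Lemma powRD_le a b s : 0 <= a -> 0 <= b -> 0 <= s ->
  (a + b) `^ s <= 2 `^ s * (a `^ s + b `^ s).
Proof.
move=> a0 b0 s0; wlog ab : a b a0 b0 / a <= b => [h|].
  have [ab|/ltW ba] := leP a b; first exact: h.
  by rewrite addrC [X in _ * X]addrC; exact: h.
apply: (@le_trans _ _ ((2 * b) `^ s)).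
  apply: ge0_ler_powR; rewrite ?nnegrE ?addr_ge0 ?mulr_ge0//; lra.
by rewrite powRM// ler_wpM2l ?powR_ge0// lerDr powR_ge0.
Qed.

Lemma ln_powR_le t s : 0 < s -> 1 <= t -> ln t `^ s <= s `^ s * t.
Proof.
move=> s0 t1; have t0 : 0 < t by exact: lt_le_trans t1.
have h : ln t <= s * t `^ s^-1.
  have -> : ln t = s * ln (t `^ s^-1) by rewrite ln_powR mulrA divff ?gt_eqF// mul1r.
  rewrite ler_wpM2l ?(ltW s0)//.
  have p0 : 0 < t `^ s^-1 by rewrite powR_gt0.
  have := @le_ln1Dx R (t `^ s^-1 - 1); rewrite addrCA subrr addr0 => h.
  by apply: le_trans (h _) _; [rewrite ltrBrDr addNr|rewrite gerBl].
apply: (@le_trans _ _ ((s * t `^ s^-1) `^ s)).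
  apply: ge0_ler_powR; rewrite ?nnegrE ?(ltW s0) ?ln_ge0 ?mulr_ge0 ?powR_ge0 ?(ltW s0)//.
rewrite powRM ?powR_ge0 ?(ltW s0)// -powRrM mulVf ?gt_eqF// powRr1 ?(ltW t0)//.
Qed.

(** The Orlicz average lives at the scale [lam], the stopping levels at the smaller scale [T]. The
    logarithm of the product [(e + t/lam) (lam/T)] splits, and the power of [ln (lam/T)] is given
    away as a multiple of [lam/T], which the stopping condition can absorb later. *)
Lemma log_change_scale (gam t T lam : R) : 0 < gam -> 0 <= t -> 0 < T -> T <= lam ->
  ln (expR 1 + t / T) `^ gam <=
  2 `^ gam * (ln (expR 1 + t / lam) `^ gam + gam `^ gam * (lam / T)).
Proof.
move=> g0 t0 T0 Tl; have l0 : 0 < lam by exact: lt_le_trans Tl.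
have r1 : 1 <= lam / T by rewrite ler_pdivlMr// mul1r.
have x1 : 1 <= ln (expR 1 + t / lam) by rewrite ln_e_ge1// divr_ge0// ltW.
have y1 : 1 <= ln (expR 1 + t / T) by rewrite ln_e_ge1// divr_ge0// ltW.
have p1 : 0 < expR 1 + t / lam by rewrite ltr_wpDr ?expR_gt0// divr_ge0// ltW.
have p2 : 0 < expR 1 + t / T by rewrite ltr_wpDr ?expR_gt0// divr_ge0// ltW.
have ly0 : 0 <= ln (lam / T) by rewrite ln_ge0.
have h : ln (expR 1 + t / T) <= ln (expR 1 + t / lam) + ln (lam / T).
  rewrite -lnM ?posrE ?(divr_gt0 l0 T0)// ler_ln ?posrE ?mulr_gt0 ?(divr_gt0 l0 T0) ?invr_gt0//.
  rewrite mulrDl lerD ?ler_peMr ?expR_ge0//.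
  by rewrite mulrA divfK ?gt_eqF.
apply: (@le_trans _ _ ((ln (expR 1 + t / lam) + ln (lam / T)) `^ gam)).
  apply: ge0_ler_powR; rewrite ?nnegrE ?(ltW g0) ?addr_ge0// (le_trans ler01)//.
apply: le_trans (powRD_le _ _ _) _; rewrite ?(ltW g0)// ?(le_trans ler01)//.
by rewrite ler_wpM2l ?powR_ge0// lerD2l ln_powR_le.
Qed.

(** A dichotomy standing in for Hölder's inequality: if [A <= L^gam] the second summand is at least
    1, otherwise the first one is. The free [A] decides how much is damped and how much is left to
    the Orlicz average. *)
Lemma power_split (gam bet L A : R) : 0 < gam -> 0 < bet -> 1 <= L -> 0 < A ->
  1 <= A `^ bet * L `^ (- (gam * bet)) + A^-1 * L `^ gam.
Proof.
move=> g0 b0 L1 A0; have L0 : 0 < L by exact: lt_le_trans L1.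
have [h|/ltW h] := leP A (L `^ gam).
  apply: (@le_trans _ _ (A^-1 * L `^ gam)).
    by rewrite mulrC ler_pdivlMr// mul1r.
  by rewrite lerDr mulr_ge0 ?powR_ge0.
apply: (@le_trans _ _ (A `^ bet * L `^ (- (gam * bet)))).
  rewrite powRN powRrM ler_pdivlMr ?powR_gt0// mul1r.
  by apply: ge0_ler_powR; rewrite ?nnegrE ?powR_ge0 ?(ltW b0) ?(ltW A0).
by rewrite lerDl mulr_ge0 ?powR_ge0// invr_ge0 ltW.
Qed.

(* Young's inequality for the product of [g v^(1/p) om^(-1/s)] and
   [l T v^(-1/p) om^(1/s)], s = p/(p-1); the powers of l cancel because of
   the value of alpha. *)
Lemma young_scaled (p q N g l T a M v om H C : R) :
  let s := p / (p - 1) in let bet := s / q in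
  let alpha := N - q / p * (N - p) in
  1 < p -> p <= q -> 0 <= g -> 0 < l -> 0 < T -> T < a ->
  a <= M / l `^ N -> 0 < v -> 0 < om -> 0 <= H -> 0 <= C ->
  a `^ (1 + bet) <= C * (2 * (v `^ (q / p) * l `^ (- alpha))) `^ bet * H ->
  g * (l * T) <= g `^ p * v * om `^ (1 - p) +
    C * 2 `^ bet * M `^ (s - 1 - bet) * om * H.
Proof.
move=> s bet alpha p1 pq g0 l0 T0 Ta aM v0 om0 H0 C0 hH.
have p0 : 0 < p by exact: lt_trans p1.
have q0 : 0 < q by exact: lt_le_trans pq.
have a0 : 0 < a by exact: lt_trans Ta.
have p10 : p - 1 != 0 by rewrite subr_eq0 gt_eqF.
have s0 : 0 < s by rewrite divr_gt0// subr_gt0.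
have b0 : 0 < bet by rewrite divr_gt0.
have sp : s / p = s - 1 by rewrite /s; field; rewrite p10 gt_eqF.
have ps : p / s = p - 1 by rewrite /s; field; rewrite p10 gt_eqF.
have s1b : 0 <= s - 1 - bet.
  by rewrite subr_ge0 -sp /bet ler_wpM2l ?(ltW s0)// lef_pV2// posrE.
have lN0 : 0 < l `^ N by rewrite powR_gt0.
have M0 : 0 < M by have := lt_le_trans a0 aM; rewrite pmulr_lgt0// invr_gt0.
pose x := g * (v `^ p^-1 * om `^ (- s^-1)).
pose y := l * T * (v `^ (- p^-1) * om `^ s^-1).
have xy : g * (l * T) = x * y.
  have E1 : v `^ p^-1 * v `^ (- p^-1) = 1.
    by rewrite -powRD ?subrr ?powRr0// (gt_eqF v0) implybT.
  have E2 : om `^ (- s^-1) * om `^ s^-1 = 1.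
    by rewrite -powRD ?addNr ?powRr0// (gt_eqF om0) implybT.
  have -> : x * y = g * (l * T) * ((v `^ p^-1 * v `^ (- p^-1)) * (om `^ (- s^-1) * om `^ s^-1)).
    by rewrite /x /y; ring.
  by rewrite E1 E2 !mulr1.
have x0 : 0 <= x by rewrite !mulr_ge0 ?powR_ge0.
have y0 : 0 <= y by rewrite !mulr_ge0 ?powR_ge0// ltW.
have psum : p^-1 + s^-1 = 1 by rewrite /s; field; rewrite p10 gt_eqF.
have le1 : p^-1 <= 1 /\ s^-1 <= 1.
  by split; rewrite -psum ?lerDl ?lerDr invr_ge0 ltW.
rewrite xy; apply: le_trans (conjugate_powR x0 y0 p0 s0 psum) _.
apply: lerD.
  apply: (@le_trans _ _ (x `^ p)).
    by rewrite ler_piMr ?powR_ge0//; case: le1.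
  rewrite /x powRM ?mulr_ge0 ?powR_ge0// powRM ?powR_ge0// -!powRrM mulVf ?gt_eqF//.
  by rewrite powRr1 ?(ltW v0)// mulNr [s^-1 * p]mulrC ps opprB mulrA.
apply: (@le_trans _ _ (y `^ s)).
  by rewrite ler_piMr ?powR_ge0//; case: le1.
rewrite /y powRM ?mulr_ge0 ?powR_ge0 ?(ltW l0) ?(ltW T0)//.
rewrite [(_ * om `^ _) `^ s]powRM ?powR_ge0// -!powRrM mulVf ?gt_eqF// powRr1 ?(ltW om0)//.
rewrite mulNr [p^-1 * s]mulrC sp [_ * om]mulrC [leRHS]mulrAC -[leRHS]mulrA [om * _]mulrC.
rewrite [leRHS](_ : _ = C * 2 `^ bet * M `^ (s - 1 - bet) * H * om); last by ring.
rewrite mulrA ler_wpM2r ?(ltW om0)//.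
have vs : 0 < v `^ (s - 1) by rewrite powR_gt0.
rewrite powRN ler_pdivrMr//.
have hH' : a `^ (1 + bet) <= C * 2 `^ bet * (v `^ (s - 1) * l `^ (- alpha * bet)) * H.
  move: hH; rewrite powRM ?mulr_ge0 ?powR_ge0// powRM ?powR_ge0// -!powRrM.
  have -> : q / p * bet = s - 1.
    by rewrite -sp /bet; field; rewrite !gt_eqF.
  by rewrite !mulrA.
apply: (@le_trans _ _ (l `^ s * a `^ s)).
  rewrite powRM ?(ltW l0) ?(ltW T0)// ler_wpM2l ?powR_ge0//.
  by apply: ge0_ler_powR; rewrite ?nnegrE ?(ltW s0) ?(ltW T0) ?(ltW a0) ?(ltW Ta).
(* The hypothesis controls only [a^(1+bet)]. The remaining exponent [s - 1 - bet = s/p - s/q] is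
   nonnegative because [p <= q], so that factor is bounded through the total mass, by
   [a <= M / l^N]. *)
have -> : a `^ s = a `^ (s - 1 - bet) * a `^ (1 + bet).
  by rewrite -powRD ?(gt_eqF a0) ?implybT//; congr (_ `^ _); ring.
have ha : a `^ (s - 1 - bet) <= M `^ (s - 1 - bet) * l `^ (- N * (s - 1 - bet)).
  have -> : l `^ (- N * (s - 1 - bet)) = (l `^ N)^-1 `^ (s - 1 - bet).
    by rewrite powRrM powRN.
  rewrite -powRM ?invr_ge0 ?powR_ge0 ?(ltW M0)//.
  apply: ge0_ler_powR; rewrite ?nnegrE ?(ltW a0)//.
  by rewrite divr_ge0 ?powR_ge0 ?ltW.
apply: (@le_trans _ _ (l `^ s * ((M `^ (s - 1 - bet) * l `^ (- N * (s - 1 - bet))) *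
   (C * 2 `^ bet * (v `^ (s - 1) * l `^ (- alpha * bet)) * H)))).
  by rewrite ler_wpM2l ?powR_ge0// ler_pM ?powR_ge0.
have -> : l `^ s * (M `^ (s - 1 - bet) * l `^ (- N * (s - 1 - bet)) *
   (C * 2 `^ bet * (v `^ (s - 1) * l `^ (- alpha * bet)) * H)) =
   C * 2 `^ bet * M `^ (s - 1 - bet) * H * v `^ (s - 1) *
   (l `^ s * l `^ (- N * (s - 1 - bet)) * l `^ (- alpha * bet)) by ring.
rewrite -!powRD ?(gt_eqF l0) ?implybT//.
have -> : s + - N * (s - 1 - bet) + - alpha * bet = 0.
  by rewrite /alpha /bet /s; field; rewrite p10 !gt_eqF.
by rewrite powRr0 mulr1.
Qed.

End log_estimates.

(** * Stopping cubes *)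

Section stopping.
Context {R : realType} (n : nat).
Local Notation T := 'rV[R]_n.
Local Notation leb := (lebesgue_rV n).
Variables (ell : R) (mu : T -> R) (B M : R).
Hypothesis ell_gt0 : 0 < ell.
Hypothesis mu_ge0 : forall x, 0 <= mu x.
Hypothesis mu_le : forall x, mu x <= B.
Hypothesis mmu : measurable_fun setT mu.
Hypothesis mu_root : forall x, ~ dcube ell 0 0 x -> mu x = 0.
Hypothesis mu_int : (\int[leb]_x (mu x)%:E = M%:E)%E.
Hypothesis M_gt0 : 0 < M.
Hypothesis n_gt0 : (0 < n)%N.
Implicit Types (x y : T).
Local Notation dcube := (dcube ell).
Local Notation dside := (dside ell).

Definition mavg i x : R := fine (dmean ell i (EFin \o mu) x).

Let emu_ge0 x : (0 <= (EFin \o mu) x)%E. Proof. by rewrite lee_fin. Qed.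
Let memu : measurable_fun setT (EFin \o mu). Proof. exact/measurable_EFinP. Qed.

Lemma mavgE i x : dmean ell i (EFin \o mu) x = (mavg i x)%:E.
Proof.
rewrite /mavg fineK// ge0_fin_numE ?dmean_ge0//.
apply: (@le_lt_trans _ _ B%:E); last by rewrite ltry.
rewrite -(dmean_cst ell_gt0 i B x); apply: le_dmean => // y _.
by rewrite lee_fin.
Qed.

Lemma mavg_ge0 i x : 0 <= mavg i x.
Proof. by rewrite -lee_fin -mavgE dmean_ge0. Qed.

Lemma mavg_le i x : mavg i x <= B.
Proof.
rewrite -lee_fin -mavgE -(dmean_cst ell_gt0 i B x); apply: le_dmean => // y _.
by rewrite lee_fin.
Qed.

Lemma mavg_dconst i x y : dcube i x y -> mavg i x = mavg i y.
Proof. by move=> h; rewrite /mavg (dmean_dconst _ h). Qed.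

Lemma mavg_coarse i j x y : (i <= j)%N -> dcube j x y -> mavg i x = mavg i y.
Proof. by move=> ij h; apply: mavg_dconst; exact: dcube_le ij h. Qed.

Lemma mavg_succ i x : mavg i.+1 x <= 2 ^+ n * mavg i x.
Proof. by rewrite -lee_fin EFinM -!mavgE; exact: dmean_succ. Qed.

Lemma mavg_le_mass i x : mavg i x <= M / dside i ^+ n.
Proof.
rewrite -lee_fin -mavgE; apply: le_trans (dmean_le_integral ell_gt0 i x _ memu) _ => //.
by rewrite mu_int -EFinM mulrC.
Qed.

Lemma mavg_root x : dcube 0 0 x -> mavg 0 x = M / ell ^+ n.
Proof.
move=> hx; apply: EFin_inj; rewrite -mavgE /dmean -(dcube_eq hx).
rewrite (_ : integral _ _ _ = M%:E).
  by rewrite -EFinM mulrC /dside expr0 divr1.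
rewrite -mu_int integral_mkcond; apply: eq_integral => y _.
by rewrite patchE; case: ifPn => //; rewrite notin_setE => /mu_root /= ->.
Qed.

Lemma mavg_off i x : ~ dcube 0 0 x -> mavg i x = 0.
Proof.
move=> hx; apply: EFin_inj; rewrite -mavgE /dmean integral0_eq ?mule0// => y hy /=.
rewrite mu_root// => h0; apply: hx; apply: dcube_trans h0 _.
by apply: dcube_sym; exact: dcube_le (leq0n i) hy.
Qed.

(** Level 0 is half the root mean, so that every point of the root cube exceeds it already at
    generation 0. *)
Definition level k : R := M / ell ^+ n * 2 ^+ k / 2.

Lemma level_gt0 k : 0 < level k.
Proof. by rewrite !mulr_gt0 ?invr_gt0 ?exprn_gt0. Qed.

Lemma levelS k : level k.+1 = 2 * level k.
Proof. by rewrite /level exprS; ring. Qed.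

Lemma levelD k j : level (k + j) = 2 ^+ j * level k.
Proof. by rewrite /level exprD; ring. Qed.

Lemma level_le k j : (k <= j)%N -> level k <= level j.
Proof.
move=> kj; rewrite -(subnKC kj) levelD ler_peMl ?(ltW (level_gt0 _))//.
by rewrite exprn_ege1// ler1n.
Qed.

(** The Calderón-Zygmund selection as a predicate: for fixed [k], the cubes of generation [i] around
    such [x] are the maximal dyadic cubes whose mean exceeds [level k]. *)
Definition stops k i x : bool :=
  (level k < mavg i x) && [forall j : 'I_i, mavg j x <= level k].

Lemma stops_dconst k i x y : dcube i x y -> stops k i x = stops k i y.
Proof.
move=> h; rewrite /stops (mavg_dconst h); congr (_ && _).
apply: eq_forallb => j; rewrite (mavg_coarse _ h)//; exact: ltnW.
Qed.

Lemma stops_gt k i x : stops k i x -> level k < mavg i x.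
Proof. by case/andP. Qed.

(** The parent of a selected cube is not selected, and passing to a child multiplies the mean by at
    most [2 ^+ n]. The root has no parent, but its mean is exactly [2 * level 0]. *)
Lemma stops_le k i x : stops k i x -> mavg i x <= 2 ^+ n * level k.
Proof.
case/andP => h1 /forallP h2; case: i h1 h2 => [|i] h1 h2; last first.
  apply: le_trans (mavg_succ i x) _; rewrite ler_pM2l ?exprn_gt0//.
  exact: (h2 ord_max).
have hx : dcube 0 0 x.
  apply: contrapT => hx; move: h1; rewrite mavg_off// ltNge.
  by rewrite ltW// level_gt0.
rewrite mavg_root// (@le_trans _ _ (2 * level 0))//.
  by rewrite /level expr0 mulr1; lra.
apply: ler_pM => //; last exact: level_le.
  by rewrite ltW// level_gt0.
by rewrite -[X in X <= _]expr1 ler_eXn2l// ltr1n.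
Qed.

Lemma stops_uniq k i j x : stops k i x -> stops k j x -> i = j.
Proof.
wlog ij : i j / (i < j)%N => [h hi hj|].
  by case: (ltngtP i j) => // ij; [exact: h|apply/esym; exact: h].
move=> /andP[h1 _] /andP[_ /forallP/(_ (Ordinal ij))] /=.
by rewrite leNgt h1.
Qed.

Lemma stops_ex k i x : level k < mavg i x -> exists2 j, (j <= i)%N & stops k j x.
Proof.
move=> h; have ex : exists j, level k < mavg j x by exists i.
case: (ex_minnP ex) => j hj jmin; exists j; first exact: jmin.
rewrite /stops hj/=; apply/forallP => l; rewrite leNgt; apply/negP => /jmin.
by rewrite leqNgt ltn_ord.
Qed.

Lemma sum_dside_ge N j :
  \sum_(i < N) (j <= i)%N%:R * dside i <= 2 * dside j :> R.
Proof.
have dS i : 2 * dside i.+1 = dside i.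
  by rewrite /dside exprS; field; rewrite expf_neq0.
suff -> : \sum_(i < N) (j <= i)%N%:R * dside i = 2 * dside j - 2 * dside (maxn j N) :> R.
  by rewrite gerBl mulr_ge0// ltW// dside_gt0.
elim: N => [|N IH]; first by rewrite big_ord0 maxn0 subrr.
rewrite big_ord_recr/= IH; case: leqP => h.
  by rewrite mul1r (maxn_idPr (leqW h)) -(dS N); ring.
by rewrite mul0r addr0 !(maxn_idPl _)// ltnW.
Qed.

(* A scale [i] is charged to the levels below [mavg i x], each of which
   was first passed at some scale [j <= i]; summing over [i >= j] is geometric. *)
Lemma sum_mavg_le_stops N K x : B <= level K ->
  \sum_(i < N) dside i * mavg i x <=
  4 * \sum_(k < K) \sum_(i < N) (stops k i x)%:R * (dside i * level k).
Proof.
move=> BK.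
have S1 i : mavg i x <= 2 * \sum_(k < K) level k * [exists j : 'I_i.+1, stops k j x]%:R.
  have [hx|hx] := pselect (dcube 0 0 x); last first.
    rewrite mavg_off// mulr_ge0// sumr_ge0// => k _.
    by rewrite mulr_ge0 ?ler0n// ltW// level_gt0.
  have e0 : level 0 < mavg 0 x.
    rewrite mavg_root// /level expr0 mulr1 ltr_pdivrMr// ltr_pMr ?ltr1n//.
    by rewrite divr_gt0// exprn_gt0.
  have K0 : (0 < K)%N.
    rewrite lt0n; apply/eqP => K0; move: e0; rewrite ltNge.
    by rewrite (le_trans (mavg_le _ _))// -K0.
  (* [k] is the last level below [mavg i x]. If that mean is at most [2 * level 0], level 0 serves
     instead, since the root mean exceeds it at generation 0. *)
  have [k kK [h1 h2]] : exists2 k, (k < K)%N & mavg i x <= 2 * level k /\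
      exists2 j, (j <= i)%N & stops k j x.
    have [h|h] := leP (mavg i x) (2 * level 0).
      exists 0%N => //; split=> //; have [j j0 hj] := stops_ex e0.
      by exists j => //; rewrite (leq_trans j0).
    have ex : exists k, mavg i x <= level k by exists K; exact: le_trans (mavg_le _ _) BK.
    case: (ex_minnP ex) => -[|k] hk kmin.
      by move: h; rewrite -levelS ltNge (le_trans hk)// level_le.
    have kK : (k < K)%N by apply: kmin; exact: le_trans (mavg_le _ _) BK.
    exists k => //; split; first by rewrite -levelS.
    apply: stops_ex; rewrite ltNge; apply/negP => /kmin; by rewrite ltnn.
  apply: le_trans h1 _; rewrite ler_pM2l// (bigD1 (Ordinal kK))//=.
  have [j ji hj] := h2; have -> : [exists j : 'I_i.+1, stops k j x].
    by apply/existsP; exists (inord j); rewrite inordK.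
  rewrite mulr1 lerDl sumr_ge0// => l _.
  by rewrite mulr_ge0 ?ler0n// ltW// level_gt0.
apply: le_trans (_ : \sum_(i < N) dside i * (2 * \sum_(k < K) level k *
    [exists j : 'I_i.+1, stops k j x]%:R) <= _).
  by apply: ler_sum => i _; rewrite ler_pM2l// dside_gt0.
rewrite (eq_bigr (fun i : 'I_N => 2 * \sum_(k < K) level k *
    ([exists j : 'I_i.+1, stops k j x]%:R * dside i))); last first.
  move=> i _; rewrite mulrCA mulr_sumr; congr (_ * _); apply: eq_bigr => k _; ring.
rewrite -mulr_sumr exchange_big/=.
(* One factor 2 is the ratio of consecutive levels, the other the sum of the geometric series of the
   sides. *)
rewrite (_ : 4 = 2 * 2); last by rewrite -natrM.
rewrite -mulrA ler_pM2l// mulr_sumr; apply: ler_sum => k _.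
rewrite -mulr_sumr [X in _ <= 2 * X](eq_bigr (fun i : 'I_N => level k * ((stops k i x)%:R * dside i))); last first.
  by move=> i _; ring.
rewrite -mulr_sumr mulrCA ler_pM2l ?level_gt0//.
have [[j jN hj]|hn] := pselect (exists2 j, (j < N)%N & stops k j x).
  apply: le_trans (_ : 2 * dside j <= _); last first.
    rewrite ler_pM2l// (bigD1 (Ordinal jN))//= hj mul1r lerDl sumr_ge0// => l _.
    by rewrite mulr_ge0 ?ler0n// ltW// dside_gt0.
  apply: le_trans (sum_dside_ge N j); apply: ler_sum => i _.
  rewrite ler_pM2r ?dside_gt0// ler_nat; case: existsP => //= -[l hl].
  by rewrite (stops_uniq hj hl); have := ltn_ord l; rewrite ltnS => ->.
rewrite big1 => [|i _].
  by rewrite mulr_ge0// sumr_ge0// => i _; rewrite mulr_ge0 ?ler0n// ltW// dside_gt0.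
case: existsP => [[l hl]|]; last by rewrite mul0r.
by case: hn; exists l => //; apply: leq_trans (ltn_ord l) (ltn_ord i).
Qed.

Lemma measurable_stops k i : measurable_fun setT (fun x => (stops k i x)%:R : R).
Proof. by apply: (measurable_dconst ell_gt0 (i := i)) => x y /stops_dconst ->. Qed.

Lemma sum_stops_le1 N k x : \sum_(i < N) (stops k i x)%:R <= 1 :> R.
Proof.
have [[i hi]|hn] := pselect (exists i : 'I_N, stops k i x).
  rewrite (bigD1 i)//= hi big1 ?addr0// => j ji.
  by case: (boolP (stops k j x)) => // hj; case/eqP: ji; apply/val_inj/(stops_uniq hj hi).
by rewrite big1// => i _; case: (boolP (stops k i x)) => // hi; case: hn; exists i.
Qed.

(* By uniqueness of the stopping scale this is an indicator function. *)
Definition passed N k x : R := \sum_(i < N) (stops k i x)%:R.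

Lemma passed_ge0 N k x : 0 <= passed N k x.
Proof. by rewrite sumr_ge0// => i _; rewrite ler0n. Qed.

Lemma passedP N k x : (passed N k x = 1 /\ exists2 i, (i < N)%N & level k < mavg i x) \/
  (passed N k x = 0 /\ forall i, (i < N)%N -> mavg i x <= level k).
Proof.
have [[i iN hi]|hn] := pselect (exists2 i, (i < N)%N & level k < mavg i x).
  left; split; last by exists i.
  have [j ji hj] := stops_ex hi.
  rewrite /passed (bigD1 (Ordinal (leq_ltn_trans ji iN)))//= hj big1 ?addr0// => l ll.
  case: (boolP (stops k l x)) => // hl; case/eqP: ll; apply/val_inj.
  exact: (stops_uniq hl hj).
right; split; last by move=> i iN; rewrite leNgt; apply/negP => h; apply: hn; exists i.
rewrite /passed big1// => i _; case: (boolP (stops k i x)) => // hi; case: hn.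
by exists i => //; exact: stops_gt.
Qed.

Lemma measurable_passed N k : measurable_fun setT (passed N k).
Proof. by apply: measurable_sum => i; exact: measurable_stops. Qed.

Local Open Scope ereal_scope.

(** A packing estimate of weak (1,1) type: on stopping cubes of level [j] the mean of [mu] exceeds
    [level j], whereas over the surrounding stopping cube of level [k] it is at most
    [2 ^+ n * level k]. The ratio of these levels gives the decay in [j - k]. *)
Lemma integral_stops_passed N k i j (psi : T -> R) :
  (k <= j)%N -> (forall x, (0 <= psi x)%R) -> (forall x y, dcube i x y -> psi x = psi y) ->
  \int[leb]_x ((stops k i x)%:R * psi x * passed N j x)%:E <=
  (2 ^+ n / 2 ^+ (j - k))%:E * \int[leb]_x ((stops k i x)%:R * psi x)%:E.
Proof.
move=> kj p0 pc.
pose f x : R := ((stops k i x)%:R * psi x)%R.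
have f0 x : (0 <= f x)%R by rewrite mulr_ge0.
have fc x y : dcube i x y -> f x = f y by move=> h; rewrite /f (stops_dconst k h) (pc _ _ h).
have mf : measurable_fun setT f by exact: (measurable_dconst ell_gt0 (i := i)).
(* Level [j >= k] cannot be passed at a generation before level [k] is, so only [l >= i] matters.
   For these [l] the product is constant on cubes of generation [l], as the conditional expectation
   requires. *)
pose h l x : R := (f x * (if (i <= l)%N then (stops j l x)%:R else 0))%R.
have hc l x y : dcube l x y -> h l x = h l y.
  rewrite /h; case: leqP => il hl; last by rewrite !mulr0.
  by rewrite (stops_dconst j hl) (fc x y)//; exact: dcube_le il hl.
have h0 l x : (0 <= h l x)%R by rewrite /h mulr_ge0//; case: ifP.
have mh l : measurable_fun setT (h l).
  by apply: (measurable_dconst ell_gt0 (i := l)) => x y /hc.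
have E1 x : (f x * passed N j x)%R = (\sum_(l < N) h l x)%R.
  rewrite /passed mulr_sumr; apply: eq_bigr => l _; rewrite /h; case: leqP => // li.
  rewrite /f; case: (boolP (stops k i x)) => [hk|]; last by rewrite !mul0r.
  case: (boolP (stops j l x)) => [hj|]; last by rewrite !mulr0.
  case/andP: hk => _ /forallP/(_ (Ordinal li))/=.
  by rewrite leNgt (le_lt_trans (level_le kj))// stops_gt.
have E2 l : (level j)%:E * \int[leb]_x (h l x)%:E <= \int[leb]_x ((h l x)%:E * (mu x)%:E).
  rewrite -(@integral_dmean _ _ _ ell_gt0 l (EFin \o h l) (EFin \o mu))//; last first.
  - by move=> x y hl /=; rewrite (hc _ _ _ hl).
  - by move=> x /=; rewrite lee_fin.
  rewrite -ge0_integralZl//; last 3 first.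
  - exact/measurable_EFinP.
  - by move=> x _; rewrite lee_fin.
  - by rewrite lee_fin ltW// level_gt0.
  apply: ge0_le_integral => //.
  - by move=> x _; rewrite -EFinM lee_fin mulr_ge0// ltW// level_gt0.
  - by apply: measurable_funeM; exact/measurable_EFinP.
  - by apply: emeasurable_funM; [exact/measurable_EFinP|exact: measurable_dmean].
  move=> x _ /=; rewrite mavgE -!EFinM lee_fin mulrC.
  rewrite /h; case: leqP => il; last by rewrite !mulr0 !mul0r.
  case: (boolP (stops j l x)) => [hj|]; last by rewrite !mulr0 !mul0r.
  by rewrite mulr1 ler_wpM2l// ltW// stops_gt.
have E3 : (level j)%:E * \int[leb]_x (f x * passed N j x)%:E <=
    \int[leb]_x ((f x)%:E * (mu x)%:E).
  have -> : \int[leb]_x (f x * passed N j x)%:E = \sum_(l < N) \int[leb]_x (h l x)%:E.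
    rewrite -ge0_integral_sum//; last 2 first.
    - by move=> l; exact/measurable_EFinP.
    - by move=> l x _; rewrite lee_fin.
    by apply: eq_integral => x _; rewrite E1 sumEFin.
  rewrite ge0_sume_distrr; last by move=> l _; apply: integral_ge0 => x _; rewrite lee_fin.
  apply: le_trans (_ : \sum_(l < N) \int[leb]_x ((h l x)%:E * (mu x)%:E) <= _).
    by apply: lee_sum => l _; exact: E2.
  rewrite -ge0_integral_sum//; last 2 first.
  - by move=> l; apply: emeasurable_funM; exact/measurable_EFinP.
  - by move=> l x _; rewrite -EFinM lee_fin mulr_ge0.
  apply: ge0_le_integral => //.
  - by move=> x _; rewrite sume_ge0// => l _; rewrite -EFinM lee_fin mulr_ge0.
  - apply: emeasurable_sum => l; apply: emeasurable_funM; exact/measurable_EFinP.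
  - by apply: emeasurable_funM; exact/measurable_EFinP.
  move=> x _; rewrite (eq_bigr (fun l : 'I_N => (h l x * mu x)%:E)); last first.
    by move=> l _; rewrite EFinM.
  rewrite sumEFin -EFinM lee_fin -mulr_suml ler_wpM2r// -E1.
  by rewrite ler_piMr// sum_stops_le1.
have E4 : \int[leb]_x ((f x)%:E * (mu x)%:E) <= (2 ^+ n * level k)%:E * \int[leb]_x (f x)%:E.
  rewrite -(@integral_dmean _ _ _ ell_gt0 i (EFin \o f) (EFin \o mu))//; last first.
    by move=> x y hl /=; rewrite (fc _ _ hl).
  have k0 : (0 <= 2 ^+ n * level k)%R by rewrite mulr_ge0 ?exprn_ge0// ltW// level_gt0.
  rewrite -ge0_integralZl//; last 2 first.
  - exact/measurable_EFinP.
  - by move=> x _; rewrite lee_fin.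
  apply: ge0_le_integral => //.
  - by move=> x _ /=; rewrite mavgE -!EFinM lee_fin mulr_ge0// mavg_ge0.
  - by apply: emeasurable_funM; [exact/measurable_EFinP|exact: measurable_dmean].
  - by apply: measurable_funeM; exact/measurable_EFinP.
  move=> x _ /=; rewrite mavgE -!EFinM lee_fin mulrC.
  rewrite /f; case: (boolP (stops k i x)) => [hk|]; last by rewrite !mul0r !mulr0.
  by rewrite ler_wpM2r// ?mulr_ge0// stops_le.
rewrite -(@lee_pmul2l _ (level j)%:E)//; last by rewrite lte_fin level_gt0.
apply: le_trans (le_trans E3 E4) _; rewrite muleA -EFinM.
have -> : level j = (2 ^+ (j - k) * level k)%R by rewrite -levelD subnKC.
rewrite (_ : (2 ^+ (j - k) * level k) * (2 ^+ n / 2 ^+ (j - k)) = 2 ^+ n * level k)%R//.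
by field; rewrite expf_neq0.
Qed.

Local Close Scope ereal_scope.

(** The ratio [Num.sqrt 2] lies strictly between 1 and 2: above 1, so that negative powers of the
    weight are summable over the levels passed at a point; below 2, so that the decay [2^-(j-k)] of
    [integral_stops_passed] wins. *)
Definition level_weight N K k x : R :=
  \sum_(j < K) (if (k <= j)%N then Num.sqrt 2 ^+ (j - k) * passed N j x else 0).

Lemma level_weight_ge0 N K k x : 0 <= level_weight N K k x.
Proof.
apply: sumr_ge0 => j _; case: ifP => // _.
by rewrite mulr_ge0 ?passed_ge0// exprn_ge0.
Qed.

Lemma level_weight_ge N K k j x : (k <= j < K)%N -> passed N j x = 1 ->
  Num.sqrt 2 ^+ (j - k) <= level_weight N K k x.
Proof.
move=> /andP[kj jK] pj; rewrite /level_weight (bigD1 (Ordinal jK))//= kj pj mulr1.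
rewrite lerDl sumr_ge0// => i _; case: ifP => // _.
by rewrite mulr_ge0 ?passed_ge0// exprn_ge0.
Qed.

(** If [kap] is the highest level below [K] passed at [x], the weight at level [k] is at least
    [Num.sqrt 2 ^+ (kap - k)], and the sum is dominated by a geometric series of ratio [rho]. *)
Lemma sum_level_weight N K p x : 1 < p ->
  \sum_(k < K) passed N k x * level_weight N K k x `^ (1 - p) <=
  (1 - Num.sqrt 2 `^ (1 - p))^-1.
Proof.
move=> p1; set rho := Num.sqrt 2 `^ (1 - p).
have z1 : 1 < Num.sqrt 2 :> R by rewrite -{1}(@sqrtr1 R) ltr_sqrt// ltr1n.
have rho01 : 0 < rho < 1.
  rewrite powR_gt0/=; last exact: lt_trans z1.
  rewrite /rho -opprB powRN invf_lt1; last by rewrite powR_gt0// (lt_trans _ z1).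
  have := @gt0_ltr_powR R (p - 1) _ 1 (Num.sqrt 2); rewrite powR1; apply.
  - by rewrite subr_gt0.
  - by rewrite nnegrE.
  - by rewrite nnegrE.
  - by [].
have /andP[rho0 rho1] := rho01.
have [hn|hk] := pselect (forall k : 'I_K, passed N k x = 0).
  rewrite big1 => [|k _]; last by rewrite hn mul0r.
  by rewrite invr_ge0 subr_ge0 ltW.
have [k0 hk0] : exists k : 'I_K, passed N k x = 1.
  apply: contrapT => h; apply: hk => k; case: (passedP N k x) => -[//].
  by move=> h1; case: h; exists k.
pose P k := (k < K)%N && (passed N k x == 1).
have exP : exists k, P k by exists k0; rewrite /P ltn_ord hk0 eqxx.
have ubP k : P k -> (k <= K)%N by case/andP => /ltnW.
case: (ex_maxnP exP ubP) => kap /andP[kapK /eqP pkap] kapmax.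
apply: le_trans (_ : \sum_(k < K) (if (k <= kap)%N then rho ^+ (kap - k) else 0) <= _).
  apply: ler_sum => k _; case: (passedP N k x) => -[pk _]; rewrite pk; last first.
    by rewrite mul0r; case: ifP => // _; rewrite exprn_ge0// ltW.
  have kk : (k <= kap)%N by apply: kapmax; rewrite /P ltn_ord pk eqxx.
  rewrite kk mul1r; have := @level_weight_ge N K k kap x.
  rewrite kk kapK => /(_ isT pkap) h.
  have zk : 0 < Num.sqrt 2 ^+ (kap - k) :> R by rewrite exprn_gt0// (lt_trans _ z1).
  rewrite (_ : rho ^+ _ = (Num.sqrt 2 ^+ (kap - k)) `^ (1 - p)); last first.
    rewrite -(powR_mulrn _ (ltW rho0)) -(powR_mulrn _ (sqrtr_ge0 2)).
    by rewrite /rho -!powRrM mulrC.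
  rewrite -opprB !powRN lef_pV2 ?posrE ?powR_gt0//; last exact: lt_le_trans h.
  apply: ge0_ler_powR; rewrite ?nnegrE ?subr_ge0 ?(ltW p1) ?(ltW zk)//.
  exact: level_weight_ge0.
(* Truncated subtraction makes one formula cover both [K <= kap] and larger [K], which is what the
   induction on [K] needs. *)
suff -> : \sum_(k < K) (if (k <= kap)%N then rho ^+ (kap - k) else 0) =
    (rho ^+ (kap.+1 - K) - rho ^+ kap.+1) / (1 - rho).
  rewrite ler_pdivrMr ?subr_gt0// mulVf ?gt_eqF ?subr_gt0// lerBlDr.
  apply: (@le_trans _ _ 1); first by rewrite exprn_ile1 ?(ltW rho0) ?(ltW rho1).
  by rewrite lerDl exprn_ge0// ltW.
elim: {k0 hk0 P exP ubP kapK kapmax hk} K => [|K IH]; first by rewrite big_ord0 subn0 subrr mul0r.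
have r1 : 1 - rho != 0 by rewrite gt_eqF// subr_gt0.
rewrite big_ord_recr/= IH; case: leqP => h.
  by rewrite subSn// subSS exprS; field.
have -> : (kap.+1 - K = 0)%N by apply/eqP; rewrite subn_eq0.
have -> : (kap.+1 - K.+1 = 0)%N by apply/eqP; rewrite subn_eq0 ltnS ltnW.
by rewrite addr0.
Qed.

Lemma geometric_sum_le K k (rho : R) : 0 <= rho < 1 ->
  \sum_(j < K) (if (k <= j)%N then rho ^+ (j - k) else 0) <= (1 - rho)^-1.
Proof.
case/andP => r0 r1.
have r10 : 1 - rho != 0 by rewrite gt_eqF// subr_gt0.
suff -> : \sum_(j < K) (if (k <= j)%N then rho ^+ (j - k) else 0) =
    (1 - rho ^+ (K - k)) / (1 - rho).
  by rewrite ler_pdivrMr ?subr_gt0// mulVf// gerBl exprn_ge0.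
elim: K => [|K IH]; first by rewrite big_ord0 sub0n subrr mul0r.
rewrite big_ord_recr/= IH; case: leqP => h.
  by rewrite subSn// exprS; field.
have -> : (K.+1 - k = 0)%N by apply/eqP; rewrite subn_eq0.
have -> : (K - k = 0)%N by apply/eqP; rewrite subn_eq0 ltnW.
by rewrite addr0.
Qed.

Local Open Scope ereal_scope.

Lemma sqrt2_half : (0 <= Num.sqrt (2 : R) / 2 < 1)%R.
Proof.
rewrite divr_ge0 ?sqrtr_ge0//= ltr_pdivrMr// mul1r.
rewrite -ltr_sqr ?nnegrE ?sqrtr_ge0// sqr_sqrtr//.
by rewrite expr2 -natrM ltr_nat.
Qed.

(** Young's inequality is assumed with a free parameter [om], to be chosen as the level weight,
    which is at least 1 where level [k] is passed. The first terms then sum to a bounded multiple of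
    [g^p V] at each point. In the second terms the weight is integrated out by packing, the mean is
    moved off [h k], and the [h k] add up to at most [D' * mu]. *)
Lemma dual_estimate N K p D D' (g : T -> R) (V : T -> \bar R) (h : nat -> T -> R) :
  (1 < p)%R -> (0 <= D)%R -> (B <= level K)%R ->
  (forall x, (0 <= g x)%R) -> measurable_fun setT g ->
  (forall x, 0 <= V x) -> measurable_fun setT V ->
  (forall k x, (0 <= h k x <= mu x)%R) -> (forall k, measurable_fun setT (h k)) ->
  (forall x, (\sum_(k < K) h k x <= D' * mu x)%R) ->
  (forall k i x om, (k < K)%N -> (i < N)%N -> stops k i x -> (0 < om)%R ->
    (g x * (dside i * level k))%:E <= (g x `^ p)%:E * V x * (om `^ (1 - p))%:E +
       (D * om)%:E * dmean ell i (EFin \o h k) x) ->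
  \int[leb]_x (g x * \sum_(i < N) dside i * mavg i x)%:E <=
  (4 / (1 - Num.sqrt 2 `^ (1 - p)))%:E * \int[leb]_x ((g x `^ p)%:E * V x) +
  (4 * D * (2 ^+ n / (1 - Num.sqrt 2 / 2)) * D' * M)%:E.
Proof.
move=> p1 D0 BK g0 mg V0 mV hmu mh hD young.
have h0 k x : (0 <= h k x)%R by case/andP: (hmu k x).
have meh k : measurable_fun setT (EFin \o h k) by exact/measurable_EFinP.
pose H k i x := fine (dmean ell i (EFin \o h k) x).
have HE k i x : dmean ell i (EFin \o h k) x = (H k i x)%:E.
  rewrite /H fineK// ge0_fin_numE; last by rewrite dmean_ge0// => y; rewrite lee_fin.
  apply: (@le_lt_trans _ _ (mavg i x)%:E); last by rewrite ltry.
  rewrite -mavgE; apply: le_dmean; [by []| |exact: meh|exact: memu|].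
    by move=> y; rewrite lee_fin.
  by move=> y _; rewrite lee_fin; case/andP: (hmu k y).
have H0 k i x : (0 <= H k i x)%R.
  by rewrite -lee_fin -HE dmean_ge0// => y; rewrite lee_fin.
have Hc k i x y : dcube i x y -> H k i x = H k i y.
  by move=> hxy; rewrite /H (dmean_dconst _ hxy).
have mH k i : measurable_fun setT (H k i).
  by apply: (measurable_dconst ell_gt0 (i := i)) => x y /(Hc k).
pose om k x := level_weight N K k x.
have mom k : measurable_fun setT (om k).
  rewrite /om /level_weight; apply: measurable_sum => j.
  case: (k <= j)%N; last exact: measurable_cst.
  by apply: measurable_funM => //; exact: measurable_passed.
have om0 k x : (0 <= om k x)%R by exact: level_weight_ge0.
pose E2 x : R := (\sum_(k < K) \sum_(i < N) (stops k i x)%:R * (D * om k x * H k i x))%R.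
have E20 x : (0 <= E2 x)%R.
  by apply: sumr_ge0 => k _; apply: sumr_ge0 => i _; rewrite !mulr_ge0.
have mterm k i : measurable_fun setT (fun x => (stops k i x)%:R * (D * om k x * H k i x))%R.
  apply: measurable_funM; first exact: measurable_stops.
  by apply: measurable_funM => //; exact: measurable_funM.
have mE2 : measurable_fun setT E2.
  by apply: measurable_sum => k; apply: measurable_sum => i.
pose F x := (g x `^ p)%:E * V x.
have F0 x : 0 <= F x by rewrite mule_ge0// lee_fin powR_ge0.
have mF : measurable_fun setT F.
  apply: emeasurable_funM => //; apply/measurable_EFinP.
  exact: (measurableT_comp (measurable_powR p) mg).
have c0 : (0 <= (1 - Num.sqrt 2 `^ (1 - p))^-1)%R.
  rewrite invr_ge0 subr_ge0 -opprB powRN invf_le1 ?powR_gt0 ?sqrtr_gt0//.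
  rewrite -[leLHS](@powRr0 _ (Num.sqrt 2)) ler_powR ?subr_ge0 ?(ltW p1)//.
  by rewrite -{1}(@sqrtr1 R) ler_sqrt// ler1n.
have P1 x : (g x * \sum_(i < N) dside i * mavg i x)%:E <=
   (4 / (1 - Num.sqrt 2 `^ (1 - p)))%:E * F x + 4%:E * (E2 x)%:E.
  apply: (@le_trans _ _ (4 * \sum_(k < K) \sum_(i < N) (stops k i x)%:R * (g x * (dside i * level k)))%:E).
    rewrite lee_fin; apply: le_trans (ler_wpM2l (g0 x) (sum_mavg_le_stops N x BK)) _.
    rewrite le_eqVlt; apply/orP; left; apply/eqP.
    rewrite mulrCA mulr_sumr; congr (_ * _)%R; apply: eq_bigr => k _.
    by rewrite mulr_sumr; apply: eq_bigr => i _; ring.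
  rewrite !EFinM -muleA -ge0_muleDr; last 2 first.
  - by rewrite mule_ge0// lee_fin.
  - by rewrite lee_fin.
  apply: lee_wpmul2l; first by rewrite lee_fin.
  apply: (@le_trans _ _ ((\sum_(k < K) passed N k x * om k x `^ (1 - p))%:E * F x + (E2 x)%:E)); last first.
    apply: leeD => //; apply: lee_wpmul2r => //; rewrite lee_fin.
    exact: sum_level_weight.
  rewrite -!sumEFin ge0_sume_distrl; last first.
    by move=> k _; rewrite lee_fin mulr_ge0 ?passed_ge0// powR_ge0.
  rewrite -big_split/=; apply: lee_sum => k _.
  rewrite /passed mulr_suml -!sumEFin ge0_sume_distrl; last first.
    by move=> i _; rewrite lee_fin mulr_ge0 ?powR_ge0.
  rewrite -big_split/=; apply: lee_sum => i _.
  case: (boolP (stops k i x)) => [hs|]; last by rewrite !mul0r mul0e adde0.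
  rewrite !mul1r muleC (EFinM _ (H k i x)) -HE.
  apply: young => //.
  have pk : passed N k x = 1%R.
    case: (passedP N k x) => -[] // _ /(_ i (ltn_ord i)).
    by rewrite leNgt stops_gt.
  have := @level_weight_ge N K k k x; rewrite leqnn ltn_ord subnn => /(_ isT pk).
  exact: lt_le_trans.
apply: (@le_trans _ _ (\int[leb]_x ((4 / (1 - Num.sqrt 2 `^ (1 - p)))%:E * F x + 4%:E * (E2 x)%:E))).
  apply: ge0_le_integral => //.
  - move=> x _; rewrite lee_fin mulr_ge0// sumr_ge0// => i _.
    by rewrite mulr_ge0 ?mavg_ge0// ltW// dside_gt0.
  - apply/measurable_EFinP; apply: measurable_funM => //; apply: measurable_sum => i.
    apply: measurable_funM => //; apply: (measurable_dconst ell_gt0 (i := i)) => x y.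
    exact: mavg_dconst.
  - apply: emeasurable_funD; first exact: measurable_funeM.
    by apply: measurable_funeM; exact/measurable_EFinP.
rewrite ge0_integralD//; last 4 first.
- by move=> x _; rewrite mule_ge0// lee_fin mulr_ge0.
- exact: measurable_funeM.
- by move=> x _; rewrite -EFinM lee_fin mulr_ge0.
- by apply: measurable_funeM; exact/measurable_EFinP.
rewrite ge0_integralZl//; last by rewrite lee_fin mulr_ge0.
apply: leeD => //.
rewrite ge0_integralZl//; last 2 first.
- exact/measurable_EFinP.
- by move=> x _; rewrite lee_fin.
rewrite -!mulrA EFinM; apply: lee_wpmul2l; first by rewrite lee_fin.
(* The weight is not constant on cubes of generation [i], so it is expanded into the [passed N j].
   Each of them costs [Num.sqrt 2 ^+ (j - k)] and gains [2 ^+ n / 2 ^+ (j - k)], which leaves a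
   geometric series of ratio [Num.sqrt 2 / 2]. *)
have IH k i : \int[leb]_x ((stops k i x)%:R * (D * om k x * H k i x))%:E <=
    (D * (2 ^+ n / (1 - Num.sqrt 2 / 2)))%:E * \int[leb]_x ((stops k i x)%:R * H k i x)%:E.
  pose G j x : R := ((stops k i x)%:R * H k i x * passed N j x)%R.
  have G0 j x : (0 <= G j x)%R by rewrite !mulr_ge0// passed_ge0.
  have mG j : measurable_fun setT (G j).
    apply: measurable_funM; last exact: measurable_passed.
    by apply: measurable_funM => //; exact: measurable_stops.
  pose c j : R := (D * (if (k <= j)%N then Num.sqrt 2 ^+ (j - k) else 0))%R.
  have cj0 j : (0 <= c j)%R by rewrite mulr_ge0//; case: ifP => // _; rewrite exprn_ge0.
  have -> : \int[leb]_x ((stops k i x)%:R * (D * om k x * H k i x))%:E =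
      \sum_(j < K) (c j)%:E * \int[leb]_x (G j x)%:E.
    rewrite (eq_integral (fun x => \sum_(j < K) ((c j)%:E * (G j x)%:E))); last first.
      move=> x _; rewrite (eq_bigr (fun j : 'I_K => (c j * G j x)%:E)); last first.
        by move=> j _; rewrite EFinM.
      rewrite sumEFin; congr _%:E; rewrite /om /level_weight mulr_sumr mulr_suml mulr_sumr.
      by apply: eq_bigr => j _; rewrite /c /G; case: ifP => _; ring.
    rewrite ge0_integral_sum//; last 2 first.
    - by move=> j; apply: measurable_funeM; exact/measurable_EFinP.
    - by move=> j x _; rewrite -EFinM lee_fin mulr_ge0.
    apply: eq_bigr => j _; rewrite ge0_integralZl//.
    - exact/measurable_EFinP.
    - by move=> x _; rewrite lee_fin.
    - by rewrite lee_fin.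
  have I0 : 0 <= \int[leb]_x ((stops k i x)%:R * H k i x)%:E.
    by apply: integral_ge0 => x _; rewrite lee_fin mulr_ge0.
  apply: (@le_trans _ _ (\sum_(j < K) ((D * 2 ^+ n) * (if (k <= j)%N then (Num.sqrt 2 / 2) ^+ (j - k) else 0))%:E *
     \int[leb]_x ((stops k i x)%:R * H k i x)%:E)).
    apply: lee_sum => j _; rewrite /c; case: leqP => kj; last by rewrite !mulr0 !mul0e.
    apply: le_trans (lee_wpmul2l _ (@integral_stops_passed N k i j (H k i) kj _ _)) _ => //.
    - by rewrite lee_fin mulr_ge0// exprn_ge0.
    - by move=> x y; exact: Hc.
    rewrite muleA -EFinM expr_div_n le_eqVlt; apply/orP; left; apply/eqP; congr (_%:E * _); ring.
  rewrite -ge0_sume_distrl; last first.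
    by move=> j _; rewrite lee_fin !mulr_ge0//; case: ifP.
  apply: lee_wpmul2r => //; rewrite sumEFin lee_fin -mulr_sumr -mulrA.
  rewrite ler_wpM2l// ler_wpM2l//; apply: geometric_sum_le.
  exact: sqrt2_half.
rewrite /E2 (eq_integral (fun x => \sum_(k < K) \sum_(i < N)
    ((stops k i x)%:R * (D * om k x * H k i x))%:E)); last first.
  by move=> x _; rewrite -sumEFin; apply: eq_bigr => k _; rewrite -sumEFin.
have tpos k i x : 0 <= ((stops k i x)%:R * (D * om k x * H k i x))%:E.
  by rewrite lee_fin !mulr_ge0.
rewrite ge0_integral_sum//; last 2 first.
- by move=> k; apply: emeasurable_sum => i; exact/measurable_EFinP.
- by move=> k x _; apply: sume_ge0.
apply: (@le_trans _ _ (\sum_(k < K) (D * (2 ^+ n / (1 - Num.sqrt 2 / 2)))%:E * \int[leb]_x (h k x)%:E)).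
  apply: lee_sum => k _; rewrite ge0_integral_sum//; last first.
    by move=> i; exact/measurable_EFinP.
  apply: (le_trans (lee_sum _ (fun (i : 'I_N) _ => IH k i))).
  have cc : (0 <= D * (2 ^+ n / (1 - Num.sqrt 2 / 2)))%R.
    rewrite mulr_ge0// divr_ge0 ?exprn_ge0// subr_ge0.
    by have /andP[_ /ltW] := sqrt2_half.
  rewrite -ge0_sume_distrr; last first.
    by move=> i _; apply: integral_ge0 => x _; rewrite lee_fin mulr_ge0.
  apply: lee_wpmul2l; first by rewrite lee_fin.
  (* With the weight gone, the remaining factor is constant on cubes of generation [i], so the mean
     of [h k] may be replaced by [h k] itself; the stopping cubes of one level are disjoint. *)
  rewrite (eq_bigr (fun i : 'I_N => \int[leb]_x ((stops k i x)%:R * h k x)%:E)); last first.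
    move=> i _.
    have := @integral_dmean _ _ _ ell_gt0 i (fun x => (stops k i x)%:R%:E) (EFin \o h k).
    rewrite /comp => e; rewrite (eq_integral (fun x => (stops k i x)%:R%:E * dmean ell i (EFin \o h k) x)); last first.
      by move=> x _; rewrite HE EFinM.
    rewrite e//.
    - by move=> y; rewrite lee_fin.
    - exact: meh.
    - by move=> x y hxy; rewrite (stops_dconst k hxy).
  rewrite -ge0_integral_sum//; last 2 first.
  - move=> i; apply/measurable_EFinP; apply: measurable_funM => //; exact: measurable_stops.
  - by move=> i x _; rewrite lee_fin mulr_ge0.
  apply: ge0_le_integral => //.
  - by move=> x _; apply: sume_ge0 => i _; rewrite lee_fin mulr_ge0.
  - apply: emeasurable_sum => i; apply/measurable_EFinP; apply: measurable_funM => //.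
    exact: measurable_stops.
  - exact: meh.
  move=> x _; rewrite sumEFin lee_fin -mulr_suml ler_piMl//.
  exact: sum_stops_le1.
have cc : (0 <= D * (2 ^+ n / (1 - Num.sqrt 2 / 2)))%R.
  rewrite mulr_ge0// divr_ge0 ?exprn_ge0// subr_ge0.
  by have /andP[_ /ltW] := sqrt2_half.
rewrite -ge0_sume_distrr; last by move=> k _; apply: integral_ge0 => x _; rewrite lee_fin.
rewrite [X in _ <= X](_ : _ = ((D * (2 ^+ n / (1 - Num.sqrt 2 / 2))) * (D' * M))%:E); last by congr _%:E; ring.
rewrite [X in _ <= X]EFinM; apply: lee_wpmul2l; first by rewrite lee_fin.
rewrite -ge0_integral_sum//; last by move=> k x _; rewrite lee_fin.
apply: (@le_trans _ _ (\int[leb]_x (D' * mu x)%:E)).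
  apply: ge0_le_integral => //.
  - by move=> x _; apply: sume_ge0 => i _; rewrite lee_fin.
  - by apply: emeasurable_sum => i; exact: meh.
  - by apply/measurable_EFinP; apply: measurable_funM.
  by move=> x _; rewrite sumEFin lee_fin.
under eq_integral do rewrite EFinM.
rewrite EFinM -mu_int; have [D'0|D'0] := leP 0%R D'.
  by rewrite ge0_integralZl// => x _; rewrite lee_fin.
rewrite integralZl//; apply/integrableP; split; first exact: memu.
  rewrite (eq_integral (fun x => (mu x)%:E)) ?mu_int ?ltry// => x _.
  by rewrite /= ger0_norm.
by move=> k; exact: meh.
Qed.

Lemma dmeanZ i (c : R) (f : T -> R) x : (0 <= c)%R -> (forall y, (0 <= f y)%R) ->
  measurable_fun setT f ->
  dmean ell i (fun y => (c * f y)%:E) x = c%:E * dmean ell i (EFin \o f) x.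
Proof.
move=> c0 f0 mf; rewrite -(@dmeanZl _ _ _ ell_gt0 i (cst c%:E) (EFin \o f) x)//.
exact/measurable_EFinP.
Qed.

(** Values of [mu] up to [T0 / 2] contribute at most half of a mean exceeding [T0], so they are
    dropped. The damping exponent [gam * bet] will turn out to be [1 + eps * bet]. *)
Definition layer (gam bet T0 : R) (y : T) : R :=
  if (T0 / 2 < mu y)%R then (mu y * ln (expR 1 + mu y / T0) `^ (- (gam * bet)))%R else 0%R.

(** The outer 4 undoes the bound on [a / 4] and the base of the power is [A * a / lam], both in the
    proof of [orlicz_layer]. *)
Definition layer_cst (gam bet : R) : R :=
  (4 * (4 * (2 `^ gam * (1 + 2 ^+ n * gam `^ gam))) `^ bet)%R.

Lemma measurable_log_power (T0 s : R) :
  measurable_fun setT (fun y => ln (expR 1 + mu y / T0) `^ s)%R.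
Proof.
apply: (measurableT_comp (measurable_powR s)).
apply: (measurableT_comp (@measurable_ln R)).
by apply: measurable_funD => //; exact: measurable_funM.
Qed.

Lemma measurable_layer gam bet T0 : measurable_fun setT (layer gam bet T0).
Proof.
apply: measurable_fun_ifT.
- by apply: measurable_fun_ltr.
- by apply: measurable_funM => //; exact: measurable_log_power.
- exact: measurable_cst.
Qed.

Lemma layer_itv gam bet T0 y : (0 <= gam)%R -> (0 <= bet)%R -> (0 < T0)%R ->
  (0 <= layer gam bet T0 y <= mu y)%R.
Proof.
move=> g0 b0 T00; rewrite /layer; case: ifP => _; last by rewrite lexx mu_ge0.
rewrite mulr_ge0 ?powR_ge0//= ler_piMr// powRN invf_le1.
  rewrite -[leLHS](@powRr0 _ (ln (expR 1 + mu y / T0))) ler_powR ?mulr_ge0//.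
  by rewrite ln_e_ge1// divr_ge0// ltW.
by rewrite powR_gt0// (lt_le_trans ltr01)// ln_e_ge1// divr_ge0// ltW.
Qed.

(** Above [T0 / 2], [power_split] divides [mu] into a multiple of the layer and [mu * L^gam / A].
    The latter is compared with the Orlicz integrand by [log_change_scale], legitimate since
    [T0 < mavg i x <= lam]; its mean is a small part of [mavg i x], so the layer must carry a fixed
    fraction of that mean. *)
Lemma orlicz_layer gam bet T0 lam i x :
  (0 < gam)%R -> (0 < bet)%R -> (0 < T0)%R -> (0 < lam)%R ->
  (T0 < mavg i x)%R -> (mavg i x <= 2 ^+ n * T0)%R ->
  dmean ell i (fun y => (LlogL gam (mu y / lam))%:E) x <= 1 ->
  (mavg i x <= lam)%R /\
  (mavg i x `^ (1 + bet))%:E <= (layer_cst gam bet * lam `^ bet)%:E *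
    dmean ell i (EFin \o layer gam bet T0) x.
Proof.
move=> g0 b0 T00 l0 Ta aT hO; set a := mavg i x in Ta aT *.
pose X y : R := ln (expR 1 + mu y / lam).
pose L y : R := ln (expR 1 + mu y / T0).
have X1 y : (1 <= X y)%R by rewrite ln_e_ge1// divr_ge0// ltW.
have L1 y : (1 <= L y)%R by rewrite ln_e_ge1// divr_ge0// ltW.
have a0 : (0 < a)%R by exact: lt_trans Ta.
pose f3 y : R := (mu y * X y `^ gam)%R.
have f30 y : (0 <= f3 y)%R by rewrite mulr_ge0// powR_ge0.
have mf3 : measurable_fun setT f3.
  by apply: measurable_funM => //; exact: measurable_log_power.
have E0 : dmean ell i (EFin \o f3) x <= lam%:E.
  have -> : EFin \o f3 = fun y => (lam * LlogL gam (mu y / lam))%:E.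
    apply/funext => y; rewrite /= /f3 /LlogL -/(X y); congr _%:E.
    by rewrite mulrA [(lam * _)%R]mulrC divfK ?gt_eqF.
  rewrite dmeanZ ?(ltW l0)//.
  - rewrite -[leRHS]mule1; apply: lee_wpmul2l => //; by rewrite lee_fin ltW.
  - by move=> y; rewrite /LlogL mulr_ge0 ?powR_ge0// divr_ge0// ltW.
  - apply: measurable_funM; first exact: measurable_funM.
    exact: measurable_log_power.
have al : (a <= lam)%R.
  rewrite -lee_fin -mavgE; apply: le_trans E0; apply: le_dmean.
  - by [].
  - by [].
  - exact: memu.
  - exact/measurable_EFinP.
  - move=> y _; rewrite lee_fin /f3 ler_peMr// -[leLHS](@powRr0 _ (X y)) ler_powR//.
    exact: ltW.
split=> //.
have Tl : (T0 <= lam)%R by rewrite (le_trans (ltW Ta)).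
pose C3 : R := (2 `^ gam * (1 + 2 ^+ n * gam `^ gam))%R.
have C30 : (0 < C3)%R.
  by rewrite mulr_gt0 ?powR_gt0// ltr_wpDr// mulr_ge0 ?powR_ge0// exprn_ge0.
(* Chosen so that the last two terms of [PW] have mean at most [a / 4], using [a <= 2 ^+ n * T0].
   The first term is [T0 / 2 < a / 2], hence the layer retains at least [a / 4]. *)
pose A : R := (4 * C3 * lam / a)%R.
have A0 : (0 < A)%R by rewrite /A divr_gt0// mulr_gt0// mulr_gt0.
pose h := layer gam bet T0.
have h0 y : (0 <= h y)%R by case/andP: (layer_itv y (ltW g0) (ltW b0) T00).
have mh : measurable_fun setT h by exact: measurable_layer.
pose c3 : R := (A^-1 * 2 `^ gam)%R.
pose c4 : R := (A^-1 * 2 `^ gam * (gam `^ gam * (lam / T0)))%R.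
have c30 : (0 <= c3)%R by rewrite mulr_ge0 ?powR_ge0// invr_ge0 ltW.
have c40 : (0 <= c4)%R.
  by rewrite !mulr_ge0 ?powR_ge0// ?invr_ge0 ltW.
have PW y : (mu y <= T0 / 2 + A `^ bet * h y + c3 * f3 y + c4 * mu y)%R.
  have cf : (0 <= c3 * f3 y + c4 * mu y)%R by rewrite addr_ge0// mulr_ge0.
  rewrite -addrA /h /layer; case: ifPn => [hT|]; last first.
    rewrite -leNgt mulr0 addr0 => hT; apply: le_trans hT _; by rewrite lerDl.
  apply: (@le_trans _ _ (mu y * (A `^ bet * L y `^ (- (gam * bet)) + A^-1 * L y `^ gam))%R).
    by rewrite ler_peMr// power_split.
  apply: (@le_trans _ _ (A `^ bet * (mu y * L y `^ (- (gam * bet))) + mu y * A^-1 *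
     (2 `^ gam * (X y `^ gam + gam `^ gam * (lam / T0))))%R).
    rewrite mulrDr [X in (X + _ <= _)%R]mulrCA lerD2l [leLHS]mulrA.
    apply: ler_wpM2l; first by rewrite mulr_ge0// invr_ge0 ltW.
    exact: log_change_scale.
  rewrite -addrA -[leLHS]add0r lerD ?divr_ge0 ?(ltW T00)// lerD2l.
  by apply: ler_eq; rewrite /c3 /c4 /f3; ring.
have [Hr HrE] : exists Hr : R, dmean ell i (EFin \o h) x = Hr%:E.
  have hle : dmean ell i (EFin \o h) x <= a%:E.
    rewrite -mavgE; apply: le_dmean; [by []| | |exact: memu|].
    - by move=> y; rewrite lee_fin.
    - exact/measurable_EFinP.
    - by move=> y _; rewrite lee_fin; case/andP: (layer_itv y (ltW g0) (ltW b0) T00).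
  exists (fine (dmean ell i (EFin \o h) x)); rewrite fineK// ge0_fin_numE.
    by apply: le_lt_trans hle _; rewrite ltry.
  by apply: dmean_ge0 => // y; rewrite lee_fin.
have [r3 r3E] : exists2 r3 : R, dmean ell i (EFin \o f3) x = r3%:E & (r3 <= lam)%R.
  exists (fine (dmean ell i (EFin \o f3) x)).
    rewrite fineK// ge0_fin_numE; first by apply: le_lt_trans E0 _; rewrite ltry.
    by apply: dmean_ge0 => // y; rewrite lee_fin.
  rewrite -lee_fin fineK// ge0_fin_numE; first by apply: le_lt_trans E0 _; rewrite ltry.
  by apply: dmean_ge0 => // y; rewrite lee_fin.
move=> r3l.
have Aver : (a <= T0 / 2 + A `^ bet * Hr + c3 * r3 + c4 * a)%R.
  rewrite -lee_fin -mavgE.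
  pose F1 y := (T0 / 2)%R%:E : \bar R.
  pose F2 y := (A `^ bet * h y)%:E.
  pose F3 y := (c3 * f3 y)%:E.
  pose F4 y := (c4 * mu y)%:E.
  have F10 (y : T) : 0 <= F1 y by rewrite lee_fin divr_ge0// ltW.
  have F20 y : 0 <= F2 y by rewrite lee_fin mulr_ge0// powR_ge0.
  have F30 y : 0 <= F3 y by rewrite lee_fin mulr_ge0.
  have F40 y : 0 <= F4 y by rewrite lee_fin mulr_ge0.
  have mF1 : measurable_fun setT (F1 : T -> \bar R) by exact: measurable_cst.
  have mF2 : measurable_fun setT F2 by apply/measurable_EFinP; exact: measurable_funM.
  have mF3 : measurable_fun setT F3 by apply/measurable_EFinP; exact: measurable_funM.
  have mF4 : measurable_fun setT F4 by apply/measurable_EFinP; exact: measurable_funM.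
  apply: (@le_trans _ _ (dmean ell i (((F1 \+ F2) \+ F3) \+ F4) x)).
    apply: le_dmean; [by []| |exact: memu| |].
    - by move=> y; rewrite lee_fin.
    - by do 3 (apply: emeasurable_funD => //).
    - by move=> y _; rewrite -!EFinD lee_fin.
  rewrite !dmeanD//; first last.
  - by do 2 (apply: emeasurable_funD => //).
  - by move=> y; rewrite adde_ge0// adde_ge0.
  - by apply: emeasurable_funD.
  - by move=> y; rewrite adde_ge0.
  rewrite dmean_cst// !dmeanZ// ?powR_ge0// HrE r3E mavgE.
  by rewrite -!EFinM -!EFinD.
have H0 : (0 <= Hr)%R by rewrite -lee_fin -HrE; apply: dmean_ge0 => // y; rewrite lee_fin.
have key : (a / 4 <= A `^ bet * Hr)%R.
  have h34 : (c3 * r3 + c4 * a <= a / 4)%R.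
    apply: (@le_trans _ _ (A^-1 * (C3 * lam))%R).
      apply: (@le_trans _ _ (c3 * lam + c4 * (2 ^+ n * T0))%R).
        by apply: lerD; apply: ler_wpM2l.
      apply: ler_eq; rewrite /c3 /c4 /C3; field.
      by rewrite !gt_eqF.
    by apply: ler_eq; rewrite /A; field; rewrite !gt_eqF.
  lra.
rewrite HrE -EFinM lee_fin powRD ?(gt_eqF a0) ?implybT// powRr1 ?(ltW a0)//.
have -> : (layer_cst gam bet * lam `^ bet * Hr = 4 * (A `^ bet * Hr) * a `^ bet)%R.
  rewrite /layer_cst -/C3 /A.
  have -> : (4 * C3 * lam / a = (4 * C3) * (lam / a))%R by rewrite [RHS]mulrA.
  have h4C : (0 <= 4 * C3)%R by rewrite mulr_ge0// ltW.
  have hla : (0 <= lam / a)%R by rewrite divr_ge0// ltW.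
  rewrite (powRM bet h4C hla).
  rewrite [((lam / a) `^ bet)%R]powRM ?(ltW l0) ?invr_ge0 ?(ltW a0)//.
  have : (a^-1 `^ bet * a `^ bet = 1)%R.
    by rewrite -powRM ?invr_ge0 ?(ltW a0)// mulVf ?gt_eqF// powR1.
  by move=> e1; rewrite -[LHS]mulr1 -e1; ring.
rewrite ler_wpM2r ?powR_ge0//; lra.
Qed.

Lemma exists_level : exists K, (B <= level K)%R.
Proof.
have l0 := level_gt0 0.
exists (Num.bound `|B / level 0|%R); rewrite -[level _]/(level (0 + _)) levelD -ler_pdivrMr//.
apply: (@le_trans _ _ (Num.bound `|B / level 0|%R)%:R).
  by apply: le_trans (ler_norm _) _; apply: ltW; exact: archi_boundP.
by rewrite -natrX ler_nat ltnW// ltn_expl.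
Qed.

Definition layer_sum_cst (e : R) : R := ((ln 2 / 4) `^ (- (1 + e)) * (1 + e^-1))%R.

(** The maximal function enters only through the last hypothesis: any [lam] strictly above the
    critical value determined by [V x] makes the normalized Orlicz integral at most 1. No infimum
    has to be attained. *)
Lemma dual_bound N (p q eps : R) (g : T -> R) (V : T -> \bar R) :
  let s := (p / (p - 1))%R in let bet := (s / q)%R in let gam := (q / s + eps)%R in
  let alpha := (n%:R - q / p * (n%:R - p))%R in
  (1 < p)%R -> (p <= q)%R -> (0 < eps)%R ->
  (forall x, (0 <= g x)%R) -> measurable_fun setT g ->
  (forall x, 0 <= V x) -> measurable_fun setT V ->
  (forall x i lam, (0 < lam)%R -> V x < ((dside i `^ alpha * lam) `^ (p / q))%:E ->
    dmean ell i (fun y => (LlogL gam (mu y / lam))%:E) x <= 1) ->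
  \int[leb]_x (g x * \sum_(i < N) dside i * mavg i x)%:E <=
  (4 / (1 - Num.sqrt 2 `^ (1 - p)))%:E * \int[leb]_x ((g x `^ p)%:E * V x) +
  (4 * (layer_cst gam bet * 2 `^ bet) * (2 ^+ n / (1 - Num.sqrt 2 / 2)) *
   layer_sum_cst (eps * bet) * (M `^ (s - 1 - bet) * M))%:E.
Proof.
move=> s bet gam alpha p1 pq eps0 g0 mg V0 mV HV.
have p0 : (0 < p)%R by exact: lt_trans p1.
have q0 : (0 < q)%R by exact: lt_le_trans pq.
have s0 : (0 < s)%R by rewrite divr_gt0// subr_gt0.
have b0 : (0 < bet)%R by rewrite divr_gt0.
have gam0 : (0 < gam)%R by rewrite addr_gt0// divr_gt0.
have gb : (gam * bet = 1 + eps * bet)%R.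
  by rewrite /gam mulrDl /bet; congr (_ + _)%R; field; rewrite !gt_eqF.
have [K BK] := exists_level.
pose C4 := layer_cst gam bet.
have C40 : (0 <= C4)%R by rewrite mulr_ge0 ?powR_ge0.
pose D : R := (C4 * 2 `^ bet * M `^ (s - 1 - bet))%R.
have D0 : (0 <= D)%R by rewrite !mulr_ge0 ?powR_ge0.
apply: le_trans (@dual_estimate N K p D (layer_sum_cst (eps * bet)) g V
  (fun k => layer gam bet (level k)) p1 D0 BK g0 mg V0 mV _ _ _ _) _.
- by move=> k x; apply: layer_itv; [exact: ltW|exact: ltW|exact: level_gt0].
- by move=> k; exact: measurable_layer.
- move=> x; rewrite mulrC.
  have -> : (\sum_(k < K) layer gam bet (level k) x = mu x * \sum_(k < K)
     (if level 0 * 2 ^+ k / 2 < mu x then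
       ln (expR 1 + mu x / (level 0 * 2 ^+ k)) `^ (- (1 + eps * bet)) else 0))%R.
    rewrite mulr_sumr; apply: eq_bigr => k _; rewrite /layer -gb.
    have -> : level k = (level 0 * 2 ^+ k)%R by rewrite -[level k]/(level (0 + k)) levelD mulrC.
    by case: ifP => // _; rewrite mulr0.
  rewrite ler_wpM2l//; apply: sum_log_levels => //; first exact: mulr_gt0.
  exact: level_gt0.
- move=> k i x om kK iN hs om0.
  set T0 := level k; set a := mavg i x.
  have T00 : (0 < T0)%R by exact: level_gt0.
  have Ta : (T0 < a)%R by exact: stops_gt.
  have a0 : (0 < a)%R by exact: lt_trans Ta.
  have aT : (a <= 2 ^+ n * T0)%R by exact: stops_le.
  have li0 : (0 < dside i)%R by exact: dside_gt0.
  have H00 : 0 <= dmean ell i (EFin \o layer gam bet T0) x.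
    apply: dmean_ge0 => // y; rewrite lee_fin.
    by case/andP: (layer_itv y (ltW gam0) (ltW b0) T00).
  have RH0 : 0 <= (D * om)%:E * dmean ell i (EFin \o layer gam bet T0) x.
    by rewrite mule_ge0// lee_fin mulr_ge0// ltW.
  (* Where [V x] is infinite the right-hand side is too, unless [g x = 0], and then the left-hand
     side vanishes. *)
  have := HV x i; have := V0 x; case: (V x) => [v| |] // v0 HVx; last first.
    have [->|gn0] := eqVneq (g x) 0%R.
      by rewrite mul0r adde_ge0// mule_ge0 ?lee_fin ?powR_ge0// mule_ge0// lee_fin powR_ge0.
    have gp : (0 < g x)%R by rewrite lt_neqAle eq_sym gn0 g0.
    rewrite gt0_muley ?lte_fin ?powR_gt0// gt0_mulye ?lte_fin ?powR_gt0//.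
    by rewrite addye ?leey// gt_eqF// (lt_le_trans _ RH0)// ltNy0.
  rewrite lee_fin in v0.
  have HV' lam : (0 < lam)%R -> (v < (dside i `^ alpha * lam) `^ (p / q))%R ->
      (a <= lam)%R /\ (a `^ (1 + bet))%:E <= (C4 * lam `^ bet)%:E *
      dmean ell i (EFin \o layer gam bet T0) x.
    by move=> l0 vl; apply: orlicz_layer => //; apply: HVx.
  (* If [V x] were 0, every positive [lam] would be admissible; [lam = a / 2] contradicts
     [a <= lam]. *)
  have vgt0 : (0 < v)%R.
    rewrite lt_neqAle v0 andbT eq_sym; apply/eqP => v00.
    have a20 : (0 < a / 2)%R by rewrite divr_gt0.
    have va : (v < (dside i `^ alpha * (a / 2)) `^ (p / q))%R.
      by rewrite v00 powR_gt0// mulr_gt0 ?powR_gt0.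
    have [al _] := HV' _ a20 va.
    lra.
  (* Twice the critical value, because the hypothesis on [V] asks for a strict inequality. This is
     the factor 2 in [young_scaled]. *)
  pose lam : R := (2 * (v `^ (q / p) * dside i `^ (- alpha)))%R.
  have l0 : (0 < lam)%R by rewrite !mulr_gt0 ?powR_gt0.
  have vl : (v < (dside i `^ alpha * lam) `^ (p / q))%R.
    have -> : (dside i `^ alpha * lam = 2 * v `^ (q / p))%R.
      rewrite /lam mulrCA; congr (_ * _)%R; rewrite mulrCA -powRD ?subrr ?powRr0 ?mulr1//.
      by rewrite (gt_eqF li0) implybT.
    rewrite powRM ?powR_ge0// -powRrM.
    have -> : (q / p * (p / q) = 1)%R by field; rewrite !gt_eqF.
    rewrite powRr1// ltr_pMl//; have := @gt0_ltr_powR R (p / q)%R _ 1%R 2%R; rewrite powR1; apply.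
    + by rewrite divr_gt0.
    + by rewrite nnegrE.
    + by rewrite nnegrE.
    + by rewrite ltr1n.
  have [al HA] := HV' lam l0 vl.
  have Hle : dmean ell i (EFin \o layer gam bet T0) x <= a%:E.
    rewrite -mavgE; apply: le_dmean; [by []| | |exact: memu|].
    + by move=> y; rewrite lee_fin; case/andP: (layer_itv y (ltW gam0) (ltW b0) T00).
    + by apply/measurable_EFinP; exact: measurable_layer.
    + by move=> y _; rewrite lee_fin; case/andP: (layer_itv y (ltW gam0) (ltW b0) T00).
  move: H00 HA Hle; case: (dmean _ _ _ _) => [H| |] // H00 HA _.
  rewrite -!EFinM -EFinD lee_fin; rewrite -EFinM lee_fin in HA; rewrite lee_fin in H00.
  rewrite [X in (_ <= _ + X)%R](_ : _ = C4 * 2 `^ bet * M `^ (s - 1 - bet) * om * H)%R; last first.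
    by rewrite /D.
  have aM : (a <= M / dside i `^ n%:R)%R.
    by rewrite powR_mulrn ?(ltW li0)//; exact: mavg_le_mass.
  have := @young_scaled R p q n%:R (g x) (dside i) T0 a M v om H C4 p1 pq (g0 x) li0 T00 Ta aM vgt0 om0 H00 C40.
  by apply; exact: HA.
apply: leeD => //; rewrite lee_fin; apply: ler_eq; rewrite /D /C4; ring.
Qed.

End stopping.

(** * Gradients of Lipschitz functions *)

Section lipschitz_line.
Context {R : realType}.
Variables (phi : R -> R) (L : R).
Hypothesis L_gt0 : 0 < L.
Hypothesis phi_lip : forall x y, `|phi x - phi y| <= L * `|x - y|.

Lemma lipschitz_continuousR (f : R -> R) (K : R) : 0 < K ->
  (forall x y, `|f x - f y| <= K * `|x - y|) -> continuous f.
Proof.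
move=> K0 fK x; apply/cvgrPdist_le => e e0; near=> y.
apply: le_trans (fK _ _) _; rewrite mulrC -ler_pdivlMr//.
near: y; apply: cvgr_dist_le; first exact: cvg_id.
exact: divr_gt0.
Unshelve. all: by end_near. Qed.

Lemma continuous_right_continuous (f : R -> R) : continuous f -> right_continuous f.
Proof. by move=> f2 x; apply: cvg_at_right_filter; exact: f2. Qed.

(** Adding [L * x] to [phi] or to [- phi] gives nondecreasing functions, hence Lebesgue-Stieltjes
    measures, which [phi] itself need not have. *)
Definition lip_up (x : R) : R := L * x + phi x.
Definition lip_dn (x : R) : R := L * x - phi x.

Let lip_up_lip x y : `|lip_up x - lip_up y| <= (L + L) * `|x - y|.
Proof.
rewrite /lip_up opprD addrACA -mulrBr mulrDl; apply: le_trans (ler_normD _ _) _.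
by rewrite normrM gtr0_norm// lerD2l.
Qed.

Let lip_dn_lip x y : `|lip_dn x - lip_dn y| <= (L + L) * `|x - y|.
Proof.
rewrite /lip_dn (_ : _ - _ = (L * x - L * y) - (phi x - phi y)); last by ring.
rewrite -mulrBr mulrDl; apply: le_trans (ler_normB _ _) _.
by rewrite normrM gtr0_norm// lerD2l.
Qed.

Let up_nd : nondecreasing lip_up.
Proof.
move=> x y xy; rewrite /lip_up -subr_ge0.
have := phi_lip x y; rewrite ler_norml => /andP[_].
rewrite ler0_norm ?subr_le0//; lra.
Qed.

Let dn_nd : nondecreasing lip_dn.
Proof.
move=> x y xy; rewrite /lip_dn -subr_ge0.
have := phi_lip x y; rewrite ler_norml => /andP[+ _].
rewrite ler0_norm ?subr_le0//; lra.
Qed.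

Let LL : 0 < L + L. Proof. by rewrite addr_gt0. Qed.

HB.instance Definition _ := isCumulative.Build R _ R lip_up up_nd
  (continuous_right_continuous (lipschitz_continuousR LL lip_up_lip)).
HB.instance Definition _ := isCumulative.Build R _ R lip_dn dn_nd
  (continuous_right_continuous (lipschitz_continuousR LL lip_dn_lip)).

Lemma lebesgue_stieltjes_oc (f : cumulative R R) a b : a <= b ->
  lebesgue_stieltjes_measure f `]a, b] = (f b - f a)%:E.
Proof.
move=> ab; rewrite /lebesgue_stieltjes_measure /measure_extension.
rewrite measurable_mu_extE/=; last exact: is_ocitv.
by rewrite wlength_itv_bnd.
Qed.

Let nu_up := lebesgue_stieltjes_measure lip_up.
Let nu_dn := lebesgue_stieltjes_measure lip_dn.

(** The two Stieltjes measures add up to [2 L] times Lebesgue measure, as their values on half-open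
    intervals show, so each vanishes on Lebesgue null sets. *)
Lemma lip_up_abs_cont (A : set (measurableTypeR R)) :
  measurable A -> lebesgue_measure A = 0%E -> nu_up A = 0%E.
Proof.
move=> mA A0.
have c0 : 0 <= (L + L)^-1 by rewrite invr_ge0 (ltW LL).
pose mm := mscale (NngNum c0) (measure_add nu_up nu_dn).
have mmE S : mm S = (((L + L)^-1)%:E * (nu_up S + nu_dn S))%E.
  by rewrite -measure_addE.
have := @lebesgue_measure_unique R mm.
have H X : ocitv X -> lebesgue_measure X = mm X.
  move=> [[x y] _ <-] /=; have [xy|yx] := ltP x y; last first.
    by rewrite set_itv_ge -?leNgt ?bnd_simp// !measure0.
  rewrite lebesgue_measure_itv/= lte_fin xy -EFinD mmE.
  rewrite /nu_up /nu_dn !lebesgue_stieltjes_oc ?(ltW xy)// -EFinD -EFinM.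
  by congr _%:E; rewrite /= /lip_up /lip_dn; field; rewrite (gt_eqF LL).
move=> hU; have := hU H A mA; rewrite [LHS]A0 => hA; have : mm A = 0%E by rewrite hA.
rewrite mmE => /eqP.
rewrite mule_eq0 eqe invr_eq0 (gt_eqF LL)/= padde_eq0//.
by move=> /andP[/eqP].
Qed.

(** Rademacher's theorem on the line together with the fundamental theorem of calculus:
    Radon-Nikodym yields a density [f1] of the measure of [lip_up], Lebesgue differentiation
    identifies it almost everywhere, and [h = f1 - L]. *)
Lemma lipschitz_ae_integral (a b : R) : a < b -> exists h : R -> R,
  [/\ lebesgue_measure.-integrable `]a, b] (EFin \o h),
      ((phi b - phi a)%:E = \int[lebesgue_measure]_(x in `]a, b]) (h x)%:E)%E &
      \forall x \ae (@lebesgue_measure R), `]a, b[%classic x -> derivable phi x 1 /\ 'D_1 phi x = h x].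
Proof.
move=> ab.
have fin : (nu_up `]a, b] < +oo)%E by rewrite /nu_up lebesgue_stieltjes_oc ?(ltW ab)// ltry.
have mab : measurable (`]a, b]%classic : set (measurableTypeR R)) by exact: measurable_itv.
(* The restriction to the bounded interval makes the measure finite and its density integrable. *)
pose nu := mfrestr mab fin.
have nuE A : nu A = nu_up (A `&` `]a, b]) by [].
have ac : nu `<< (@lebesgue_measure R).
  apply/null_content_dominatesP => A mA A0; rewrite nuE.
  apply: lip_up_abs_cont; first exact: measurableI.
  by apply/eqP; rewrite eq_le measure_ge0 andbT -A0 le_measure ?inE//; exact: measurableI.
have [f [f0 ffin fint fE]] := radon_nikodym_sigma_finite ac.
pose f1 := fine \o f.
have f1E : EFin \o f1 = f by apply/funext => x; rewrite /= fineK.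
have f1int : lebesgue_measure.-integrable setT (EFin \o f1) by rewrite f1E.
have upE y : a <= y <= b -> ((lip_up y - lip_up a)%:E = \int[lebesgue_measure]_(x in `]a, y]) (f1 x)%:E)%E.
  move=> /andP[ay yb].
  rewrite -(lebesgue_stieltjes_oc lip_up ay) -/nu_up.
  have -> : nu_up (`]a, y]%classic : set (measurableTypeR R)) = nu (`]a, y]%classic : set (measurableTypeR R)).
    rewrite nuE setIidl// => x /=; rewrite !in_itv/= => /andP[-> xy] /=; exact: le_trans yb.
  transitivity (\int[lebesgue_measure]_(x in `]a, y]) f x)%E; first by apply: fE; exact: measurable_itv.
  by apply: eq_integral => x _; rewrite -[in LHS]f1E.
have icst : lebesgue_measure.-integrable `]a, b] (cst L%:E : R -> \bar R).
  apply/integrableP; split; first exact: measurable_cst.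
  rewrite integral_cst//= lebesgue_measure_itv/= lte_fin ab -EFinB -EFinM ltry.
  by [].
exists (fun x => f1 x - L); split.
- rewrite (_ : EFin \o _ = (EFin \o f1) \- cst L%:E)%E; last by apply/funext => x.
  by apply: integrableB => //; exact: integrableS f1int.
- have := upE b; rewrite lexx (ltW ab) => /(_ isT) h.
  under eq_integral do rewrite EFinB.
  rewrite integralB_EFin//; last exact: integrableS f1int.
  rewrite -h integral_cst//= lebesgue_measure_itv/= lte_fin ab.
  by congr _%:E; rewrite /lip_up; ring.
have lint : locally_integrable setT f1.
  by apply: open_integrable_locally => //; exact: openT.
have := lebesgue_differentiation lint.
apply: (@filterS _ _ (ae_filter_ringOfSetsType _)) => x lx; rewrite /= in_itv/= => /andP[ax xb].
have f1b : lebesgue_measure.-integrable [set` Interval (BRight a) (BRight b)] (EFin \o f1).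
  exact: integrableS f1int.
have bax : (BRight a < BRight x)%O by rewrite bnd_simp.
have := @FTC1_lebesgue_pt R f1 (BRight a) x b xb f1b bax lx; move=> [].
set F := (fun y => _) => dF FE.
(* Near [x] the function [phi] is the primitive of [f1] corrected by an affine function, so
   differentiability transfers to it. *)
have nearE : \forall y \near x, phi y = F y - L * y + lip_up a.
  have : \forall y \near x, y \in `]a, b[ by apply: near_in_itvoo; rewrite in_itv/= ax.
  apply: filterS => y; rewrite in_itv/= => /andP[ay yb].
  have := upE y; rewrite (ltW ay) (ltW yb) => /(_ isT) h.
  rewrite /F /Rintegral -h /= /lip_up; ring.
have dG : is_derive x (1 : R) (fun y => F y - L * y + lip_up a) (f1 x - L).
  have d1 : is_derive x (1 : R) F (f1 x).
    by split; [exact: dF|rewrite -derive1E; exact: FE].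
  have d2 : is_derive x (1 : R) (fun y => L * y) L.
    have := is_deriveZ (L : R) (@is_derive_id R R x 1); rewrite /GRing.scale/= mulr1; exact.
  have := is_deriveD (is_deriveB d1 d2) (is_derive_cst (lip_up a) x 1).
  by rewrite addr0.
have near2 : \forall y \near x, (fun y => F y - L * y + lip_up a) y = phi y.
  by apply: filterS nearE.
have d3 : is_derive x (1 : R) phi (f1 x - L).
  exact: (@near_eq_is_derive R R^o R^o _ _ x 1 _ near2 dG).
by split; case: d3.
Qed.

(** The majorant [g] has to dominate the derivative only where it exists, which is almost
    everywhere; conventional values of the derivative elsewhere do not matter. *)
Lemma lipschitz_le_integral_derive (a b : R) (g : R -> \bar R) : a <= b ->
  (forall x, 0 <= g x)%E -> measurable_fun setT g ->
  (forall x, derivable phi x 1 -> (`|'D_1 phi x|)%:E <= g x)%E ->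
  ((`|phi b - phi a|)%:E <= \int[lebesgue_measure]_(x in `[a, b]) g x)%E.
Proof.
move=> + g0 mg hg; rewrite le_eqVlt => /predU1P[<-|ab].
  by rewrite subrr normr0 integral_ge0.
have [h [hint hE hae]] := lipschitz_ae_integral ab.
apply: (@le_trans _ _ (\int[lebesgue_measure]_(x in `]a, b]) g x)%E); last first.
  apply: ge0_subset_integral => //.
  - exact: measurable_funTS.
  - by move=> x /=; rewrite !in_itv/= => /andP[/ltW -> ->].
rewrite -abse_EFin hE; apply: le_trans (le_abse_integral _ _ _) _ => //.
  by case/integrableP : hint.
apply: ae_ge0_le_integral => //.
- by apply: measurableT_comp => //; case/integrableP : hint.
- exact: measurable_funTS.
have nb : \forall x \ae (@lebesgue_measure R), x <> b.
  exists [set b]; split=> //; first exact: lebesgue_measure_set1.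
  by move=> x /=; apply: contra_notP => xb.
apply: (@filterS2 _ _ (ae_filter_ringOfSetsType _) _ _ _ _ hae nb) => x hx xb; rewrite /= in_itv/= => /andP[ax xb'].
have [|dx <-] := hx; first by rewrite /= in_itv/= ax lt_neqAle xb' andbT; apply/eqP.
exact: hg.
Qed.

End lipschitz_line.

(** * Borel sets of row vectors and measurability of partial derivatives *)

Section borel_rV.
Context {R : realType} (n : nat).
Local Notation T := 'rV[R]_n.

Lemma dcube_ball i (x y : T) : dcube 1 i x y -> ball x (2 * (2 ^+ i)^-1) y.
Proof.
rewrite dcube_itv// => h; have hx : dcube 1 i x x by [].
rewrite dcube_itv// in hx.
split=> [|c d]; first by rewrite mulr_gt0// invr_gt0 exprn_gt0.
rewrite (ord1 c) /ball/=.
have := h d; have := hx d; rewrite /= !in_itv/= /dside div1r => /andP[a1 a2] /andP[b1 b2].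
have p0 : 0 < (2 ^+ i)^-1 :> R by rewrite invr_gt0 exprn_gt0.
rewrite ltr_norml; apply/andP; split; lra.
Qed.

(* An open set is the union over i of its interior cubes of generation i. *)
Lemma measurable_open_rV (U : set T) : open U -> measurable U.
Proof.
move=> oU.
have -> : U = \bigcup_i [set x | `[< dcube 1 i x `<=` U >] = true].
  apply/seteqP; split=> x.
    move=> Ux; have /nbhs_ballP[e/= e0 eU] : nbhs x U by exact: open_nbhs_nbhs.
    pose i := Num.bound (2 / e); exists i => //=; apply/asboolP => y hy.
    apply: eU; apply: le_ball (dcube_ball hy).
    rewrite -ler_pdivlMl// -[leRHS]invrK lef_pV2 ?posrE ?exprn_gt0//; last first.
      by rewrite invr_gt0 mulr_gt0 ?invr_gt0.
    rewrite invfM invrK.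
    have h : 2 / e <= i%:R.
      by apply: le_trans (ler_norm _) _; rewrite ger0_norm ?divr_ge0 ?(ltW e0)//; apply/ltW/archi_boundP; rewrite divr_ge0 ?(ltW e0).
    apply: (le_trans h); rewrite -natrX ler_nat ltnW//; exact: ltn_expl.
  by move=> [i _ /= /asboolP]; apply; exact: dcube_refl.
apply: bigcup_measurable => i _.
have mf : measurable_fun setT (fun x : T => `[< dcube 1 i x `<=` U >]).
  apply: (@measurable_dconst _ _ 1 ltr01 _ _ i) => x y hxy.
  by rewrite (dcube_eq hxy).
by have := mf measurableT [set true]; rewrite setTI; apply.
Qed.

Lemma measurable_closed_rV (U : set T) : closed U -> measurable U.
Proof.
by move=> cU; rewrite -[U]setCK; apply: measurableC; apply: measurable_open_rV; exact: closed_openC.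
Qed.

Lemma continuous_measurable_rV (f : T -> R) : continuous f -> measurable_fun setT f.
Proof.
move=> cf; apply: (measurability _ (RGenOInfty.measurableE R)) => //.
move=> _ [_ [a ->] <-]; rewrite setTI; apply: measurable_open_rV.
by apply: open_comp => // x _; exact: cf.
Qed.

Lemma translation_continuous (a : T) : continuous (fun x : T => a + x).
Proof. by move=> x; exact: (@cvgD R T T (nbhs x) _ _ _ _ _ (cvg_cst a) cvg_id). Qed.

Definition evec (c : 'I_n) : T := delta_mx ord0 c.

Definition dquot (v : T -> R) c (h : R) (x : T) : R := h^-1 * (v (h *: evec c + x) - v x).

Lemma continuous_dquot v c h : continuous v -> continuous (dquot v c h).
Proof.
move=> cv x.
have hA : v (h *: evec c + y) @[y --> x] --> v (h *: evec c + x).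
  apply: (@continuous_comp _ _ _ (fun x : T => h *: evec c + x) v); last exact: cv.
  exact: translation_continuous.
exact: (cvgM (cvg_cst h^-1) (cvgB hA (cv x))).
Qed.

Lemma dquotE (v : T -> R) c x :
  (fun h : R => h^-1 *: ((v \o shift x) (h *: evec c) - v x)) = dquot v c ^~ x.
Proof. by []. Qed.

Definition partial_derivable (v : T -> R) c : set T :=
  [set x | derivable (v : T -> R^o) x (evec c)].

(** The Cauchy criterion for the difference quotients with countable parameters: each such set is
    closed when [v] is continuous, and the points of partial differentiability are a countable
    intersection of countable unions of them. *)
Definition small_osc v c (k N : nat) : set T := [set x | forall h h' : R,
  h != 0 -> h' != 0 -> `|h| < N.+1%:R^-1 -> `|h'| < N.+1%:R^-1 ->
  `|dquot v c h x - dquot v c h' x| <= k.+1%:R^-1].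

Lemma continuous_osc v c h h' : continuous v ->
  continuous (fun x => `|dquot v c h x - dquot v c h' x|).
Proof.
move=> cv x.
exact: (cvg_norm (cvgB (@continuous_dquot v c h cv x) (@continuous_dquot v c h' cv x))).
Qed.

Lemma closed_small_osc v c k N : continuous v -> closed (small_osc v c k N).
Proof.
move=> cv; pose P (hh : R * R) := [/\ hh.1 != 0, hh.2 != 0, `|hh.1| < N.+1%:R^-1 & `|hh.2| < N.+1%:R^-1].
rewrite (_ : small_osc _ _ _ _ = \bigcap_(hh in P)
    [set x | `|dquot v c hh.1 x - dquot v c hh.2 x| <= k.+1%:R^-1]); last first.
  apply/seteqP; split=> x hx; first by move=> [h h'] [/= *]; exact: hx.
  by move=> h h' *; apply: (hx (h, h')).
apply: closed_bigI => hh _.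
apply: (@closed_comp _ _ (fun x : T => `|dquot v c hh.1 x - dquot v c hh.2 x|) [set r | r <= k.+1%:R^-1]).
  by move=> x _; exact: continuous_osc.
exact: closed_le.
Qed.

Lemma partial_derivableE v c : partial_derivable v c =
  \bigcap_k \bigcup_N small_osc v c k N.
Proof.
apply/seteqP; split=> x.
  rewrite /partial_derivable /= /derivable dquotE => /cvg_ex[/= l hl] k _.
  move/cvgrPdist_le : hl => /(_ (k.+1%:R^-1 / 2)) h.
  have [|e/= e0 he] := h; first by rewrite divr_gt0.
  pose N := Num.bound (e^-1); exists N => //= h1 h2 h10 h20 h1N h2N.
  have Ne : N.+1%:R^-1 <= e.
    rewrite -[leRHS]invrK lef_pV2 ?posrE ?invr_gt0//.
    apply: (@le_trans _ _ N%:R); last by rewrite ler_nat.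
    by apply/ltW/archi_boundP; rewrite invr_ge0 ltW.
  have b1 : `|l - dquot v c h1 x| <= k.+1%:R^-1 / 2.
    by apply: he => //=; rewrite sub0r normrN; exact: lt_le_trans Ne.
  have b2 : `|l - dquot v c h2 x| <= k.+1%:R^-1 / 2.
    by apply: he => //=; rewrite sub0r normrN; exact: lt_le_trans Ne.
  rewrite (_ : dquot v c h1 x - _ = (l - dquot v c h2 x) - (l - dquot v c h1 x)); last by ring.
  apply: le_trans (ler_normB _ _) _; by apply: le_trans (lerD b2 b1) _; rewrite -splitr.
move=> hx; rewrite /partial_derivable /= /derivable dquotE.
apply: cauchy_cvg; apply/cauchy_ballP => e e0.
pose k := Num.bound (e^-1).
have ke : k.+1%:R^-1 < e.
  rewrite -[ltRHS]invrK ltf_pV2 ?posrE ?invr_gt0//.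
  apply: (@lt_le_trans _ _ k%:R); last by rewrite ler_nat.
  by apply/archi_boundP; rewrite invr_ge0 ltW.
have [N _ hN] := hx k I.
rewrite near2E.
pose S : set R := [set h | h != 0 /\ `|h| < N.+1%:R^-1].
have hS : (0^') S.
  exists N.+1%:R^-1 => /=; first by rewrite invr_gt0.
  by move=> h /=; rewrite sub0r normrN.
exists ((dquot v c ^~ x) @` S, (dquot v c ^~ x) @` S) => /=.
  by split; apply: filterS hS => h Sh; exists h.
move=> [_ _] [/= [h1 [h10 h1N] <-] [h2 [h20 h2N] <-]].
by rewrite /ball/=; apply: le_lt_trans ke; exact: hN.
Qed.

Lemma measurable_partial_derivable v c : continuous v -> measurable (partial_derivable v c).
Proof.
move=> cv; rewrite partial_derivableE; apply: bigcap_measurable => // k _.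
apply: bigcup_measurable => N _; apply: measurable_closed_rV; exact: closed_small_osc.
Qed.

Definition pderive (v : T -> R) c (x : T) : R := 'D_(evec c) (v : T -> R^o) x.

Lemma pderive0 v c x : ~ partial_derivable v c x -> pderive v c x = 0.
Proof. by move=> h; rewrite /pderive /derive dvgP. Qed.

(** The increments [1/(m+1)] give a sequence of continuous quotients; cut off outside the points of
    differentiability, where the derivative takes the default value 0, it converges everywhere. *)
Lemma measurable_pderive v c : continuous v -> measurable_fun setT (pderive v c).
Proof.
move=> cv.
pose f (m : nat) x : R := dquot v c m.+1%:R^-1 x * \1_(partial_derivable v c) x.
apply: (@measurable_fun_cvg _ _ _ _ f).
  move=> m; apply: measurable_funM.
    by apply: continuous_measurable_rV; exact: continuous_dquot.
  by apply: measurable_indic; exact: measurable_partial_derivable.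
move=> x _; rewrite /f indicE; case: (boolP (x \in _)) => [|]; last first.
  rewrite notin_setE => hx; rewrite pderive0//.
  rewrite (_ : (fun _ => _) = cst 0); first exact: cvg_cst.
  by apply/funext => m /=; rewrite mulr0.
rewrite inE => hx.
rewrite (_ : (fun _ => _) = (fun m => dquot v c m.+1%:R^-1 x)); last first.
  by apply/funext => m; rewrite mulr1.
have hc : dquot v c h x @[h --> 0^'] --> pderive v c x.
  by rewrite -dquotE; exact: hx.
have hh : (m.+1%:R^-1 : R) @[m --> \oo] --> 0^'.
  move=> A [e/= e0 eA].
  have /cvgrPdist_lt/(_ e e0) := @cvg_harmonic R.
  by apply: filterS => m hm; apply: eA.
exact: cvg_comp hh hc.
Qed.

Definition coord_upd (x : T) (c : 'I_n) (r : R) : T :=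
  \row_i (if i == c then r else x ord0 i).

Lemma coord_updS x c r h : coord_upd x c (h + r) = h *: evec c + coord_upd x c r.
Proof.
apply/rowP => i; rewrite !mxE eqxx/=; case: eqVneq => [_|ic]; first by rewrite mulr1.
by rewrite mulr0 add0r.
Qed.

Lemma measurable_coord_upd x c : measurable_fun setT (coord_upd x c).
Proof.
apply/measurable_fun_coorP => i.
have [->|ic] := eqVneq i c.
  rewrite (_ : _ \o _ = idfun); first exact: measurable_id.
  by apply/funext => r /=; rewrite mxE eqxx.
rewrite (_ : _ \o _ = cst (x ord0 i)); first exact: measurable_cst.
by apply/funext => r /=; rewrite mxE (negbTE ic).
Qed.

Lemma line_quot (v : T -> R) x c r (h : R) :
  h^-1 *: (((fun r => v (coord_upd x c r)) \o shift r) (h *: (1 : R)) - v (coord_upd x c r)) =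
  dquot v c h (coord_upd x c r).
Proof. by rewrite /= /dquot /GRing.scale/= mulr1 coord_updS. Qed.

Lemma derive_line (v : T -> R) x c r :
  'D_1 (fun r => v (coord_upd x c r) : R^o) r = pderive v c (coord_upd x c r).
Proof.
by rewrite /derive (funext (line_quot v x c r)) /pderive /derive dquotE.
Qed.

Lemma norm_coord_upd x c r s : `|coord_upd x c r - coord_upd x c s| <= `|r - s|.
Proof.
rewrite (_ : coord_upd x c r - _ = (r - s) *: evec c); last first.
  apply/rowP => i; rewrite !mxE eqxx/=; case: eqVneq => [_|ic]; first by rewrite mulr1.
  by rewrite subrr mulr0.
rewrite normrZ ler_piMr// /Num.Def.normr/= mx_normrE.
apply: bigmax_le => // -[i j] _ /=; rewrite !mxE.
by case: (_ && _) => //; rewrite ?normr1 ?normr0.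
Qed.

Lemma lipschitz_continuous_rV (v : T -> R) (K : R) : 0 < K ->
  (forall x y, `|v x - v y| <= K * `|x - y|) -> continuous v.
Proof.
move=> K0 vK z; have FF : Filter (nbhs z) by exact: nbhs_filter.
apply/cvgrPdist_lt => e e0.
suff : nbhs (z : T) [set t : T | `|v z - v t| < e] by [].
apply/nbhs_ballP; exists (e / K) => /=; first exact: divr_gt0.
move=> y zy; apply: le_lt_trans (vK _ _) _; rewrite mulrC -ltr_pdivlMr//.
by move: zy; rewrite -ball_normE.
Qed.

Lemma lipschitz_line_le (v : T -> R) (K : R) x c a b : 0 < K ->
  (forall x y, `|v x - v y| <= K * `|x - y|) -> a <= b ->
  ((`|v (coord_upd x c b) - v (coord_upd x c a)|)%:E <=
   \int[lebesgue_measure]_(r in `[a, b]) (`|pderive v c (coord_upd x c r)|)%:E)%E.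
Proof.
move=> K0 vK ab.
have cv := lipschitz_continuous_rV K0 vK.
apply: (@lipschitz_le_integral_derive R (fun r => v (coord_upd x c r)) K) => //.
- move=> r s; apply: le_trans (vK _ _) _; rewrite ler_pM2l//.
  exact: norm_coord_upd.
- apply/measurable_EFinP; apply: measurableT_comp => //.
  apply: (measurableT_comp (measurable_pderive c cv)).
  exact: measurable_coord_upd.
- by move=> r _; rewrite derive_line.
Qed.

End borel_rV.

(** * A Poincaré inequality on boxes *)

Section poincare.
Context {R : realType}.
Local Open Scope ereal_scope.

Definition hitv (a l : R) : set (measurableTypeR R) := `[a, (a + l)%R[%classic.

(** Boxes with arbitrary corners, rather than cubes of the grid, let the induction on the dimension
    split off the first coordinate. *)
Definition hbox n (a : 'I_n -> R) (l : R) : set 'rV[R]_n :=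
  [set x | forall c, hitv (a c) l (x ord0 c)].

Lemma measurable_hitv a l : measurable (hitv a l).
Proof. exact: measurable_itv. Qed.

Lemma measurable_hbox n (a : 'I_n -> R) l : measurable (hbox a l).
Proof.
apply: (measurable_coordinatewise (A := fun c => hitv (a c) l)) => c.
exact: measurable_hitv.
Qed.

Hint Resolve measurable_hitv measurable_hbox : core.

Lemma lebesgue_hitv a l : (0 < l)%R -> lebesgue_measure (hitv a l) = l%:E.
Proof.
by move=> l0; rewrite lebesgue_measure_itv/= lte_fin ltrDl l0 -EFinB addrAC subrr add0r.
Qed.

Lemma hbox_cons n (a : 'I_n.+1 -> R) l (z : measurableTypeR R * 'rV[R]_n) :
  hbox a l (cons_rV z) <-> hitv (a ord0) l z.1 /\ hbox (a \o lift ord0) l z.2.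
Proof.
split=> [h|[h1 h2] c].
  split=> [|c]; first by have := h ord0; rewrite cons_rV0.
  by have := h (lift ord0 c); rewrite cons_rVS.
by case: (unliftP ord0 c) => [j ->|->]; rewrite ?cons_rVS ?cons_rV0//; exact: h2.
Qed.

Lemma measurable_cons_pair n (f : 'rV[R]_n.+1 -> \bar R) :
  measurable_fun setT f -> measurable_fun setT (fun z => f (@cons_rV R n z)).
Proof.
move=> mf _ Y mY; have h := mf measurableT Y mY; rewrite setTI in h.
exact: (@measurable_cons_rV R n measurableT _ h).
Qed.

Lemma measurable_cons_r n (f : 'rV[R]_n.+1 -> \bar R) (r : R) :
  measurable_fun setT f -> measurable_fun setT (fun x => f (@cons_rV R n (r, x))).
Proof.
move=> mf; apply: (measurableT_comp (measurable_cons_pair mf)).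
exact: measurable_pair1.
Qed.

Lemma measurable_cons_integral n (f : 'rV[R]_n.+1 -> \bar R) (B : set 'rV[R]_n) :
  measurable B -> (forall x, 0 <= f x) -> measurable_fun setT f ->
  measurable_fun setT (fun r : measurableTypeR R =>
    \int[lebesgue_rV n]_(x in B) f (cons_rV (r, x))).
Proof.
move=> mB f0 mf.
pose F (z : measurableTypeR R * 'rV[R]_n) := f (cons_rV z) * (\1_B z.2)%:E.
have mF : measurable_fun setT F.
  apply: emeasurable_funM; first exact: measurable_cons_pair.
  by apply/measurable_EFinP; apply: (measurableT_comp (measurable_indic mB) measurable_snd).
have F0 z : 0 <= F z by rewrite mule_ge0// lee_fin.
have := @measurable_fun_fubini_tonelli_F _ _ _ _ _ (lebesgue_rV n) F mF F0.
rewrite (_ : fubini_F _ _ = (fun r : measurableTypeR R =>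
    \int[lebesgue_rV n]_(x in B) f (cons_rV (r, x))))//.
apply/funext => r; rewrite /fubini_F [RHS]integral_mkcond.
apply: eq_integral => x _; rewrite /F/= patchE indicE.
by case: ifPn => hB; rewrite ?hB ?(negbTE hB) ?mule1 ?mule0.
Qed.

Lemma integral_hboxS n (a : 'I_n.+1 -> R) l (f : 'rV[R]_n.+1 -> \bar R) :
  (forall x, 0 <= f x) -> measurable_fun setT f ->
  \int[lebesgue_rV n.+1]_(x in hbox a l) f x =
  \int[lebesgue_measure]_(r in hitv (a ord0) l)
    \int[lebesgue_rV n]_(x in hbox (a \o lift ord0) l) f (cons_rV (r, x)).
Proof.
move=> f0 mf; rewrite integral_mkcond.
pose F (z : measurableTypeR R * 'rV[R]_n) := (f \_ (hbox a l)) (cons_rV z).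
have F0 z : 0 <= F z by rewrite /F patchE; case: ifP.
have mfb : measurable_fun setT (f \_ (hbox a l)).
  apply/(measurable_restrictT _ _).1; first exact: measurable_hbox.
  exact: measurable_funTS.
have mF : measurable_fun setT F by exact: measurable_cons_pair.
transitivity (\int[lebesgue_measure \x lebesgue_rV n]_z F z).
  rewrite /= /lebesgue_cons.
  rewrite (@ge0_integral_pushforward _ _ _ _ _ _ (@measurable_cons_rV R n) _ setT
    (f \_ (hbox a l)) measurableT mfb); last first.
    by move=> x _; rewrite patchE; case: ifP.
  by rewrite preimage_setT.
rewrite fubini_tonelli1// /fubini_F [RHS]integral_mkcond; apply: eq_integral => r _.
rewrite patchE; case: ifPn => hr; last first.
  rewrite integral0_eq// => x _; rewrite /F patchE ifN// notin_setE => /hbox_cons[/= + _].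
  by move: hr; rewrite notin_setE.
rewrite inE in hr.
rewrite [RHS]integral_mkcond; apply: eq_integral => x _; rewrite /F !patchE.
case: ifPn => h1; case: ifPn => h2 //.
  by move: h1 h2; rewrite inE notin_setE => /hbox_cons[/= _ +].
move: h1 h2; rewrite inE notin_setE => + hx; case; apply/hbox_cons; split=> //.
Qed.

Lemma integral_hbox_swap n (a0 : R) (a : 'I_n -> R) l (f : 'rV[R]_n.+1 -> \bar R) :
  (forall x, 0 <= f x) -> measurable_fun setT f ->
  \int[lebesgue_rV n]_(x in hbox a l) \int[lebesgue_measure]_(r in hitv a0 l) f (cons_rV (r, x)) =
  \int[lebesgue_measure]_(r in hitv a0 l) \int[lebesgue_rV n]_(x in hbox a l) f (cons_rV (r, x)).
Proof.
move=> f0 mf.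
pose F (z : measurableTypeR R * 'rV[R]_n) :=
  f (cons_rV z) * ((\1_(hitv a0 l) z.1)%:E * (\1_(hbox a l) z.2)%:E).
have F0 z : 0 <= F z by rewrite mule_ge0// mule_ge0// lee_fin.
have mF : measurable_fun setT F.
  apply: emeasurable_funM; first exact: measurable_cons_pair.
  apply: emeasurable_funM; apply/measurable_EFinP.
    exact: (measurableT_comp (measurable_indic (measurable_hitv a0 l)) measurable_fst).
  exact: (measurableT_comp (measurable_indic (measurable_hbox a l)) measurable_snd).
have := @fubini_tonelli _ _ _ _ _ (@lebesgue_measure R) (lebesgue_rV n) F mF F0.
have E (r : R) (x : 'rV[R]_n) : F (r, x) =
   ((fun r => ((fun x => f (cons_rV (r, x))) \_ (hbox a l)) x) \_ (hitv a0 l)) r.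
  rewrite /F/= patchE !indicE; case: ifP => hr; last by rewrite mul0e mule0.
  by rewrite patchE mul1e; case: ifP => hx; rewrite ?mule1 ?mule0.
move=> h; rewrite [LHS]integral_mkcond [RHS]integral_mkcond; symmetry.
transitivity (\int[lebesgue_measure]_r \int[lebesgue_rV n]_x F (r, x)).
  apply: eq_integral => r _; rewrite patchE; case: ifPn => hr.
    rewrite [LHS]integral_mkcond; apply: eq_integral => x _.
    by rewrite E [RHS]patchE hr.
  by rewrite integral0_eq// => x _; rewrite E patchE ifN.
rewrite h; apply: eq_integral => x _; rewrite patchE; case: ifPn => hx.
  rewrite [RHS]integral_mkcond; apply: eq_integral => r _.
  by rewrite E !patchE hx.
by rewrite integral0_eq// => r _; rewrite E !patchE (negbTE hx); case: ifP.
Qed.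

Lemma coord_upd_cons0 n (z : measurableTypeR R * 'rV[R]_n) t :
  coord_upd (cons_rV z) ord0 t = cons_rV (t, z.2).
Proof.
apply/rowP => i; rewrite mxE; case: (unliftP ord0 i) => [j ->|->].
  by rewrite !cons_rVS.
by rewrite eqxx cons_rV0.
Qed.

Lemma coord_upd_consS n (z : measurableTypeR R * 'rV[R]_n) c t :
  coord_upd (cons_rV z) (lift ord0 c) t = cons_rV (z.1, coord_upd z.2 c t).
Proof.
apply/rowP => i; rewrite mxE; case: (unliftP ord0 i) => [j ->|->].
  by rewrite !cons_rVS mxE (inj_eq lift_inj).
by rewrite !cons_rV0.
Qed.

(* The mean of u over a subbox is compared with the mean over the box one
   coordinate at a time. *)
Lemma poincare_hbox n (a a' : 'I_n -> R) (l l' : R) (u g : 'rV[R]_n -> \bar R) :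
  (0 < l')%R -> (l' <= l)%R -> (forall c, hitv (a' c) l' `<=` hitv (a c) l) ->
  (forall x, 0 <= u x) -> measurable_fun setT u ->
  (forall x, 0 <= g x) -> measurable_fun setT g ->
  (forall x c s t, hitv (a c) l s -> hitv (a c) l t ->
    u (coord_upd x c t) <= u (coord_upd x c s) +
      \int[lebesgue_measure]_(r in hitv (a c) l) g (coord_upd x c r)) ->
  (l ^+ n)%:E * \int[lebesgue_rV n]_(x in hbox a' l') u x <=
  (l' ^+ n)%:E * \int[lebesgue_rV n]_(x in hbox a l) u x +
  (n%:R * l ^+ n.+1)%:E * \int[lebesgue_rV n]_(x in hbox a l) g x.
Proof.
move=> l'0 l'l; have l0 : (0 < l)%R by exact: lt_le_trans l'l.
elim: n a a' u g => [|n IH] a a' u g aa' u0 mu g0 mg H.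
  rewrite !expr0 !mul1e mul0r mul0e adde0.
  rewrite (_ : hbox a' l' = hbox a l)//.
  by apply/seteqP; split=> x _ [].
rewrite !integral_hboxS//.
set I := hitv (a ord0) l; set I' := hitv (a' ord0) l'.
set Q := hbox (a \o lift ord0) l; set Q' := hbox (a' \o lift ord0) l'.
pose U r := \int[lebesgue_rV n]_(x in Q) u (cons_rV (r, x)).
pose U' r := \int[lebesgue_rV n]_(x in Q') u (cons_rV (r, x)).
pose G r := \int[lebesgue_rV n]_(x in Q) g (cons_rV (r, x)).
have mI : measurable I by exact: measurable_hitv.
have mI' : measurable I' by exact: measurable_hitv.
have mQ : measurable Q by exact: measurable_hbox.
have mQ' : measurable Q' by exact: measurable_hbox.
have mU : measurable_fun setT U by exact: measurable_cons_integral.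
have mU' : measurable_fun setT U' by exact: measurable_cons_integral.
have mG : measurable_fun setT G by exact: measurable_cons_integral.
have U0 r : 0 <= U r by exact: integral_ge0.
have U'0 r : 0 <= U' r by exact: integral_ge0.
have G0 r : 0 <= G r by exact: integral_ge0.
have lI : lebesgue_measure I = l%:E by exact: lebesgue_hitv.
have lI' : lebesgue_measure I' = l'%:E by exact: lebesgue_hitv.
rewrite -/U -/U' -/G.
pose Gam := \int[lebesgue_measure]_(r in I) G r.
have Gam0 : 0 <= Gam by exact: integral_ge0.
have ln0 k : (0 <= l ^+ k)%R by rewrite exprn_ge0// ltW.
have l'n0 k : (0 <= l' ^+ k)%R by rewrite exprn_ge0// ltW.
(* The induction hypothesis on the slice at [r] treats all coordinates but the first. *)
have S1 r : (l ^+ n)%:E * U' r <= (l' ^+ n)%:E * U r + (n%:R * l ^+ n.+1)%:E * G r.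
  apply: (IH (a \o lift ord0) (a' \o lift ord0) (fun x => u (cons_rV (r, x))) (fun x => g (cons_rV (r, x)))) => //.
  - by move=> c; exact: aa'.
  - exact: measurable_cons_r.
  - exact: measurable_cons_r.
  - move=> x c s t hs ht; have := H (cons_rV (r, x)) (lift ord0 c) s t hs ht.
    rewrite !coord_upd_consS => h; apply: le_trans h _; apply: leeD => //.
    rewrite le_eqVlt; apply/orP; left; apply/eqP; apply: eq_integral => r' _.
    by rewrite coord_upd_consS.
have S2 : (l ^+ n)%:E * \int[lebesgue_measure]_(r in I') U' r <=
    (l' ^+ n)%:E * \int[lebesgue_measure]_(r in I') U r + (n%:R * l ^+ n.+1)%:E * Gam.
  rewrite -ge0_integralZl//; last 2 first.
  - exact: measurable_funTS.
  - by rewrite lee_fin.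
  apply: (@le_trans _ _ (\int[lebesgue_measure]_(r in I') ((l' ^+ n)%:E * U r + (n%:R * l ^+ n.+1)%:E * G r))).
    apply: ge0_le_integral => //.
    - by move=> r _; rewrite mule_ge0// lee_fin.
    - by apply: measurable_funTS; exact: measurable_funeM.
    - apply: measurable_funTS; apply: emeasurable_funD; exact: measurable_funeM.
  rewrite ge0_integralD//; last 4 first.
  - by move=> r _; rewrite mule_ge0// lee_fin.
  - by apply: measurable_funTS; exact: measurable_funeM.
  - by move=> r _; rewrite mule_ge0// lee_fin mulr_ge0.
  - by apply: measurable_funTS; exact: measurable_funeM.
  rewrite !ge0_integralZl//; last 4 first.
  - exact: measurable_funTS.
  - by rewrite lee_fin mulr_ge0.
  - exact: measurable_funTS.
  - by rewrite lee_fin.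
  apply: leeD => //; apply: lee_wpmul2l; first by rewrite lee_fin mulr_ge0.
  apply: ge0_subset_integral => //; first exact: measurable_funTS.
  exact: aa'.
have S3 s t : I s -> I t -> U t <= U s + Gam.
  move=> Is It.
  have mGi : measurable_fun setT (fun x => \int[lebesgue_measure]_(r in I) g (cons_rV (r, x))).
    pose F (z : measurableTypeR R * 'rV[R]_n) := g (cons_rV z) * (\1_I z.1)%:E.
    have mF : measurable_fun setT F.
      apply: emeasurable_funM; first exact: measurable_cons_pair.
      by apply/measurable_EFinP; apply: (measurableT_comp (measurable_indic mI) measurable_fst).
    have F0 z : 0 <= F z by rewrite mule_ge0// lee_fin.
    have := @measurable_fun_fubini_tonelli_G _ _ _ _ _ (@lebesgue_measure R) F mF F0.
    rewrite (_ : fubini_G _ _ = (fun x => \int[lebesgue_measure]_(r in I) g (cons_rV (r, x))))//.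
    apply/funext => x; rewrite /fubini_G [RHS]integral_mkcond.
    apply: eq_integral => r _; rewrite /F/= patchE indicE.
    by case: ifPn => hB; rewrite ?hB ?(negbTE hB) ?mule1 ?mule0.
  have Gi0 x : 0 <= \int[lebesgue_measure]_(r in I) g (cons_rV (r, x)) by exact: integral_ge0.
  apply: (@le_trans _ _ (\int[lebesgue_rV n]_(x in Q) (u (cons_rV (s, x)) +
     \int[lebesgue_measure]_(r in I) g (cons_rV (r, x))))).
    apply: ge0_le_integral => //.
    - by apply: measurable_funTS; exact: measurable_cons_r.
    - by apply: measurable_funTS; apply: emeasurable_funD => //; exact: measurable_cons_r.
    - move=> x _; have := H (cons_rV (0%R, x)) ord0 s t Is It.
      rewrite !coord_upd_cons0 => h; apply: le_trans h _; apply: leeD => //.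
      rewrite le_eqVlt; apply/orP; left; apply/eqP; apply: eq_integral => r' _.
      by rewrite coord_upd_cons0.
  rewrite ge0_integralD//; last 2 first.
  - by apply: measurable_funTS; exact: measurable_cons_r.
  - exact: measurable_funTS.
  by rewrite integral_hbox_swap.
(* Averaging [S3] over [s] bounds every slice integral by the mean over [I] plus [Gam]; integrating
   this over [t] in the subinterval [I'] gives [S5], the comparison in the first coordinate. *)
have S4 t : I t -> l%:E * U t <= \int[lebesgue_measure]_(r in I) U r + l%:E * Gam.
  move=> It; rewrite -lI muleC [lebesgue_measure I * _]muleC -!(integral_cst _ mI).
  rewrite -ge0_integralD//; last exact: measurable_funTS.
  apply: ge0_le_integral => //.
  - by move=> s _; exact: U0.
  - by apply: emeasurable_funD => //; exact: measurable_funTS.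
  - by move=> s Is; exact: S3.
have S5 : l%:E * \int[lebesgue_measure]_(r in I') U r <=
    l'%:E * (\int[lebesgue_measure]_(r in I) U r + l%:E * Gam).
  rewrite -ge0_integralZl//; last 2 first.
  - exact: measurable_funTS.
  - by rewrite lee_fin ltW.
  rewrite -lI' muleC -(integral_cst _ mI'); apply: ge0_le_integral => //.
  - by move=> r _; rewrite mule_ge0// lee_fin ltW.
  - by apply: measurable_funTS; exact: measurable_funeM.
  - by move=> r Ir; apply: S4; exact: (aa' ord0).
set A' := \int[lebesgue_measure]_(r in I') U' r in S2 *.
set B' := \int[lebesgue_measure]_(r in I') U r in S2 S5.
set AA := \int[lebesgue_measure]_(r in I) U r in S5 *.
have AA0 : 0 <= AA by exact: integral_ge0.
have B'0 : 0 <= B' by exact: integral_ge0.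
rewrite -/Gam.
apply: (@le_trans _ _ (l%:E * ((l' ^+ n)%:E * B' + (n%:R * l ^+ n.+1)%:E * Gam))).
  have -> : (l ^+ n.+1)%:E * A' = l%:E * ((l ^+ n)%:E * A').
    by rewrite muleA -EFinM -exprS.
  by apply: lee_wpmul2l => //; rewrite lee_fin ltW.
rewrite ge0_muleDr; last 2 first.
- by rewrite mule_ge0// lee_fin.
- by rewrite mule_ge0// lee_fin mulr_ge0.
rewrite muleCA.
apply: (@le_trans _ _ ((l' ^+ n)%:E * (l'%:E * (AA + l%:E * Gam)) + l%:E * ((n%:R * l ^+ n.+1)%:E * Gam))).
  by apply: leeD => //; apply: lee_wpmul2l => //; rewrite lee_fin.
rewrite !muleA -!EFinM ge0_muleDr//; last by rewrite mule_ge0// lee_fin ltW.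
rewrite -exprSr -addeA; apply: leeD => //.
rewrite muleA -EFinM -ge0_muleDl; last 2 first.
- by rewrite lee_fin mulr_ge0// ltW.
- by rewrite lee_fin !mulr_ge0// ltW.
apply: lee_wpmul2r => //; rewrite -EFinD lee_fin.
rewrite -[in leRHS]natr1 mulrDl mul1r addrC; apply: lerD.
  by apply: ler_eq; rewrite [in RHS]exprS; ring.
rewrite [leRHS]exprSr ler_wpM2r ?(ltW l0)//.
by apply: lerXn2r; rewrite ?nnegrE ?(ltW l0) ?(ltW l'0).
Qed.

End poincare.

(** * Pointwise bound by dyadic means of the gradient *)

Section representation.
Context {R : realType} (n : nat).
Local Notation T := 'rV[R]_n.
Local Notation leb := (lebesgue_rV n).
Variables (ell K : R) (u : T -> R).
Hypothesis ell_gt0 : 0 < ell.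
Hypothesis K_gt0 : 0 < K.
Hypothesis u_lip : forall x y, `|u x - u y| <= K * `|x - y|.
Hypothesis u_ge0 : forall x, 0 <= u x.
Local Notation dcube := (dcube ell).
Local Notation dside := (dside ell).
Implicit Types x y : T.

(** The [l^1] norm dominates each partial derivative and so suits an argument by coordinates; the
    Euclidean norm returns only at the end, through [grad_l1_euclidean]. *)
Definition grad_l1 (v : T -> R) (x : T) : R := \sum_(c < n) `|pderive v c x|.

Lemma grad_l1_ge0 v x : 0 <= grad_l1 v x.
Proof. exact: sumr_ge0. Qed.

Lemma measurable_grad_l1 v : continuous v -> measurable_fun setT (grad_l1 v).
Proof.
move=> cv; apply: measurable_sum => c; apply: measurableT_comp => //.
exact: measurable_pderive.
Qed.

Lemma pderive_le_grad_l1 v c x : `|pderive v c x| <= grad_l1 v x.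
Proof. by rewrite /grad_l1 (bigD1 c)//= lerDl sumr_ge0. Qed.

Let cu : continuous u. Proof. exact: lipschitz_continuous_rV u_lip. Qed.
Let mu : measurable_fun setT u. Proof. exact: continuous_measurable_rV. Qed.

Lemma line_le_grad_l1 (a l : R) x c s t : hitv a l s -> hitv a l t ->
  ((u (coord_upd x c t))%:E <= (u (coord_upd x c s))%:E +
   \int[lebesgue_measure]_(r in hitv a l) (grad_l1 u (coord_upd x c r))%:E)%E.
Proof.
move=> hs ht; pose A := Num.min s t; pose B := Num.max s t.
have AB : A <= B by rewrite /A /B; case: (leP s t) => // /ltW.
have := lipschitz_line_le x c K_gt0 u_lip AB.
have -> : `|u (coord_upd x c B) - u (coord_upd x c A)| = `|u (coord_upd x c t) - u (coord_upd x c s)|.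
  by rewrite /A /B; case: (leP s t) => // _; rewrite distrC.
move=> h; rewrite -leeBlDl// -EFinB.
apply: (@le_trans _ _ (`|u (coord_upd x c t) - u (coord_upd x c s)|)%:E).
  by rewrite lee_fin ler_norm.
apply: (le_trans h).
have mline v : measurable_fun setT v ->
    measurable_fun setT (fun r : R => (v (coord_upd x c r))%:E).
  move=> mv; apply/measurable_EFinP.
  exact: (measurableT_comp (f := v) mv (measurable_coord_upd x c)).
apply: (@le_trans _ _ (\int[lebesgue_measure]_(r in `[A, B]) (grad_l1 u (coord_upd x c r))%:E)%E).
  apply: ge0_le_integral => //.
  - apply: measurable_funTS; apply/measurable_EFinP; apply: measurableT_comp => //.
    apply: (measurableT_comp (measurable_pderive c cu)); exact: measurable_coord_upd.
  - by apply: measurable_funTS; apply: mline; exact: measurable_grad_l1.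
  - by move=> r _; rewrite lee_fin; exact: pderive_le_grad_l1.
apply: ge0_subset_integral => //.
- exact: measurable_hitv.
- by apply: measurable_funTS; apply: mline; exact: measurable_grad_l1.
- by move=> r _; rewrite lee_fin; exact: grad_l1_ge0.
move=> r /=; move: hs ht; rewrite /hitv/= !in_itv/= => /andP[s1 s2] /andP[t1 t2].
rewrite /A /B ge_min le_max => /andP[/orP[h1|h1] /orP[h2|h2]]; apply/andP; split.
all: first [exact: le_trans h1|exact: le_lt_trans h2 _].
Qed.

Lemma dcube_hbox i x : dcube i x = hbox (fun c => dcorner ell i x ord0 c) (dside i).
Proof. exact: dcube_itv. Qed.

Lemma hitv_dcorner_succ i x c :
  hitv (dcorner ell i.+1 x ord0 c) (dside i.+1) `<=` hitv (dcorner ell i x ord0 c) (dside i).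
Proof.
move=> t ht.
have : dcube i.+1 x (coord_upd x c t).
  rewrite dcube_hbox => d; rewrite [coord_upd _ _ _ _ _]mxE; case: (eqVneq d c) => [->//|_].
  by have : dcube i.+1 x x by []; rewrite dcube_hbox; apply.
move=> /(dcube_le ell_gt0 (leqnSn i)); rewrite dcube_hbox => /(_ c).
by rewrite [coord_upd _ _ _ _ _]mxE eqxx.
Qed.

Lemma dsideS i : dside i.+1 = dside i / 2.
Proof. by rewrite /dside exprS; field; rewrite expf_neq0. Qed.

(** This is [poincare_hbox] for a cube and its child, divided by both volumes; the factor [2 ^+ n]
    is the ratio of the volumes. *)
Lemma dmean_succ_le i x :
  (dmean ell i.+1 (EFin \o u) x <= dmean ell i (EFin \o u) x +
   (n%:R * 2 ^+ n * dside i)%:E * dmean ell i (EFin \o grad_l1 u) x)%E.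
Proof.
set l := dside i; set l' := dside i.+1.
have l0 : 0 < l by exact: dside_gt0.
have l'0 : 0 < l' by exact: dside_gt0.
have l'l : l' = l / 2 by exact: dsideS.
have h : ((l ^+ n)%:E * \int[leb]_(x0 in dcube i.+1 x) (EFin \o u) x0 <=
  (l' ^+ n)%:E * \int[leb]_(x0 in dcube i x) (EFin \o u) x0 +
  (n%:R * l ^+ n.+1)%:E * \int[leb]_(x0 in dcube i x) (EFin \o grad_l1 u) x0)%E.
  rewrite !dcube_hbox; apply: poincare_hbox => //.
  - by rewrite -/l' l'l ler_pdivrMr// ler_peMr ?(ltW l0)// ler1n.
  - by move=> c; exact: hitv_dcorner_succ.
  - exact/measurable_EFinP.
  - by move=> y; rewrite lee_fin grad_l1_ge0.
  - by apply/measurable_EFinP; exact: measurable_grad_l1.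
  - by move=> y c s t hs ht; exact: line_le_grad_l1.
rewrite /dmean -/l -/l'.
have c0 : (0 < (l ^+ n * l' ^+ n)^-1) by rewrite invr_gt0 mulr_gt0// exprn_gt0.
have g0 : (0 <= \int[leb]_(x0 in dcube i x) (EFin \o grad_l1 u) x0)%E.
  by apply: integral_ge0 => y _; rewrite lee_fin grad_l1_ge0.
have i0 : (0 <= \int[leb]_(x0 in dcube i x) (EFin \o u) x0)%E.
  by apply: integral_ge0 => y _; rewrite lee_fin.
set IA := (\int[leb]_(x0 in dcube i.+1 x) _)%E in h *.
set IB := (\int[leb]_(x0 in dcube i x) (EFin \o u) x0)%E in h i0 *.
set IG := (\int[leb]_(x0 in dcube i x) (EFin \o grad_l1 u) x0)%E in h g0 *.
clearbody IA IB IG.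
have := lee_wpmul2l (ltW c0 : (0 <= ((l ^+ n * l' ^+ n)^-1)%:E)%E) h.
rewrite ge0_muleDr; last 2 first.
- by rewrite mule_ge0// lee_fin exprn_ge0// ltW.
- by rewrite mule_ge0// lee_fin mulr_ge0// exprn_ge0// ltW.
rewrite !muleA -!EFinM.
have ln0 : l ^+ n != 0 by rewrite expf_neq0// gt_eqF.
have l'n0 : l' ^+ n != 0 by rewrite expf_neq0// gt_eqF.
have h2 : 2 ^+ n = l ^+ n / l' ^+ n.
  by rewrite -expr_div_n l'l; congr (_ ^+ n); field; rewrite gt_eqF.
rewrite h2 exprSr; move: (l ^+ n) (l' ^+ n) ln0 l'n0 => P P' P0 P'0.
rewrite (_ : (P * P')^-1 * P = P'^-1); last by rewrite invfM mulrAC mulVf// mul1r.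
rewrite (_ : (P * P')^-1 * P' = P^-1); last by rewrite invfM -mulrA mulVf// mulr1.
rewrite (_ : (P * P')^-1 * (n%:R * (P * l)) = n%:R * (P / P') * l / P)//.
by field; rewrite ?P0 ?P'0.
Qed.

Lemma norm_le_dside i x y : dcube i x y -> `|x - y| <= dside i.
Proof.
move=> hy; rewrite /Num.Def.normr/= mx_normrE; apply: bigmax_le => [|[a c] _ /=].
  by rewrite ltW// dside_gt0.
rewrite (ord1 a) !mxE.
have : dcube i x x by []; move: hy; rewrite !dcube_hbox => /(_ c) + /(_ c).
rewrite /hitv/= !in_itv/= => /andP[a1 a2] /andP[b1 b2].
rewrite ler_norml; apply/andP; split; lra.
Qed.

(** The Lipschitz bound replaces Lebesgue's differentiation theorem: the explicit error allows the
    scales to stop at a finite generation. *)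
Lemma le_dmean_dside i x : ((u x)%:E <= dmean ell i (EFin \o u) x + (K * dside i)%:E)%E.
Proof.
rewrite -(dmean_cst ell_gt0 i (u x) x) -[X in (_ + X)%E](dmean_cst ell_gt0 i (K * dside i) x).
have Kd : 0 <= K * dside i by rewrite mulr_ge0// ltW// dside_gt0.
rewrite -dmeanD//; last exact/measurable_EFinP.
apply: le_dmean; [by []| |exact: measurable_cst| |].
- by move=> y; rewrite lee_fin.
- by apply: emeasurable_funD; [exact/measurable_EFinP|exact: measurable_cst].
- move=> y hy; rewrite -EFinD lee_fin.
  have := u_lip x y; rewrite ler_norml => /andP[_ h].
  rewrite -lerBlDl; apply: le_trans h _; rewrite ler_pM2l//.
  exact: norm_le_dside.
Qed.

(** Telescoping over the generations gives a dyadic form of the bound of [u] by the Riesz potential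
    of order 1 of its gradient. *)
Lemma le_sum_dmean N x :
  ((u x)%:E <= dmean ell 0 (EFin \o u) x +
   \sum_(i < N) (n%:R * 2 ^+ n * dside i)%:E * dmean ell i (EFin \o grad_l1 u) x +
   (K * dside N)%:E)%E.
Proof.
apply: le_trans (le_dmean_dside N x) _; apply: leeD => //.
elim: N => [|N IH]; first by rewrite big_ord0 adde0.
apply: le_trans (dmean_succ_le N x) _; rewrite big_ord_recr/= addeA.
exact: leeD.
Qed.

End representation.

(** * Weak and strong type bounds *)

(** The additive bound is not homogeneous in the gradient. Rescaling the gradient by [eta] and
    choosing [eta] so that [eta^p G = M^(s - bet)] turns it into a product, and
    [(s - bet) / s = 1 - 1/q] leaves the power [M^(1/q)]. *)
Lemma scale_optimization (R : realType) (t M G C1 C2 p q : R) :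
  let s := p / (p - 1) in let bet := s / q in
  1 < p -> p <= q -> 0 < t -> 0 < M -> 0 <= G -> 0 <= C1 -> 0 <= C2 ->
  (forall eta, 0 < eta -> t * M * eta <= C1 * (eta `^ p * G) + C2 * M `^ (s - bet)) ->
  t `^ q * M <= (C1 + C2) `^ q * G `^ (q / p).
Proof.
move=> s bet p1 pq t0 M0 G0 C10 C20 H.
have p0 : 0 < p by exact: lt_trans p1.
have q0 : 0 < q by exact: lt_le_trans pq.
have p10 : p - 1 != 0 by rewrite subr_eq0 gt_eqF.
have s0 : 0 < s by rewrite divr_gt0// subr_gt0.
have [Y YE] : exists Y, Y = M `^ (s - bet) by eexists.
rewrite -YE in H; have Y0 : 0 < Y by rewrite YE powR_gt0.
have tM : 0 < t * M by rewrite mulr_gt0.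
(* For [G = 0] the left-hand side would grow with [eta] while the right-hand side stays fixed. *)
move: G0; rewrite le_eqVlt => /predU1P[G00|Gp].
  have e0 : 0 < (C2 * Y + 1) / (t * M).
    by rewrite divr_gt0// ltr_wpDl// mulr_ge0// ltW.
  have := H _ e0; rewrite -G00 mulr0 mulr0 add0r mulrC divfK ?gt_eqF//.
  lra.
have C0 : 0 <= C1 + C2 by rewrite addr_ge0.
pose eta := Y `^ p^-1 * G `^ (- p^-1).
have eta0 : 0 < eta by rewrite mulr_gt0// powR_gt0.
have etaG : eta `^ p * G = Y.
  rewrite /eta powRM ?powR_ge0// -!powRrM mulVf ?gt_eqF// mulNr mulVf ?gt_eqF//.
  by rewrite powRr1 ?(ltW Y0)// powRN powRr1 ?(ltW Gp)// divfK ?gt_eqF.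
have h : t * M * eta <= (C1 + C2) * Y.
  by have := H _ eta0; rewrite etaG mulrDl.
have G1 : G `^ (- p^-1) * G `^ p^-1 = 1.
  by rewrite -powRD ?addNr ?powRr0// (gt_eqF Gp) implybT.
have Y1 : Y = Y `^ p^-1 * Y `^ s^-1.
  rewrite -powRD; last by rewrite (gt_eqF Y0) implybT.
  have -> : p^-1 + s^-1 = 1 by rewrite /s; field; rewrite p10 gt_eqF.
  by rewrite powRr1 ?(ltW Y0).
have Yp : 0 < Y `^ p^-1 by rewrite powR_gt0.
have h2 : t * M <= (C1 + C2) * (Y `^ s^-1 * G `^ p^-1).
  rewrite -(ler_pM2r eta0); apply: (le_trans h).
  rewrite {1}Y1 /eta; apply: ler_eq.
  by rewrite -[LHS]mulr1 -G1; ring.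
have YM : Y `^ s^-1 = M `^ (1 - q^-1).
  rewrite YE -powRrM; congr (_ `^ _); rewrite /bet; field.
  by rewrite !gt_eqF.
have MM : M = M `^ q^-1 * M `^ (1 - q^-1).
  rewrite -powRD; last by rewrite (gt_eqF M0) implybT.
  by rewrite addrCA subrr addr0 powRr1 ?(ltW M0).
have Mq : 0 < M `^ (1 - q^-1) by rewrite powR_gt0.
have h3 : t * M `^ q^-1 <= (C1 + C2) * G `^ p^-1.
  rewrite -(ler_pM2r Mq) -mulrA -MM; apply: (le_trans h2).
  by rewrite YM; apply: ler_eq; ring.
have := @ge0_ler_powR R q (ltW q0) _ _ _ _ h3.
rewrite !nnegrE !mulr_ge0 ?powR_ge0 ?(ltW t0)// => /(_ isT isT).
rewrite powRM ?powR_ge0 ?(ltW t0)// -powRrM mulVf ?gt_eqF// powRr1 ?(ltW M0)//.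
by rewrite powRM ?powR_ge0// -powRrM [p^-1 * q]mulrC.
Qed.

Section weak_type.
Context {R : realType} (n : nat).
Local Notation T := 'rV[R]_n.
Local Notation leb := (lebesgue_rV n).
Variables (p q eps ell K B : R) (u w : T -> R) (V : T -> \bar R).
Let s := p / (p - 1).
Let bet := s / q.
Let gam := q / s + eps.
Let alpha := n%:R - q / p * (n%:R - p).
Hypothesis n_gt0 : (0 < n)%N.
Hypothesis p_gt1 : 1 < p.
Hypothesis p_le_q : p <= q.
Hypothesis eps_gt0 : 0 < eps.
Hypothesis ell_gt0 : 0 < ell.
Hypothesis K_gt0 : 0 < K.
Hypothesis u_lip : forall x y, `|u x - u y| <= K * `|x - y|.
Hypothesis u_ge0 : forall x, 0 <= u x.
Hypothesis w_ge0 : forall x, 0 <= w x.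
Hypothesis w_le : forall x, w x <= B.
Hypothesis mw : measurable_fun setT w.
Hypothesis V_ge0 : forall x, (0 <= V x)%E.
Hypothesis mV : measurable_fun setT V.
Hypothesis HV : forall x i lam, 0 < lam ->
  (V x < ((dside ell i `^ alpha * lam) `^ (p / q))%:E)%E ->
  (dmean ell i (fun y => (LlogL gam (w y / lam))%:E) x <= 1)%E.

Definition weak_cst1 : R := n%:R * 2 ^+ n * (4 / (1 - Num.sqrt 2 `^ (1 - p))).
Definition weak_cst2 : R := n%:R * 2 ^+ n * (4 * (layer_cst n gam bet * 2 `^ bet) *
   (2 ^+ n / (1 - Num.sqrt 2 / 2)) * layer_sum_cst (eps * bet)).
Definition weak_cst : R := 2 `^ q * (weak_cst1 + weak_cst2) `^ q.

Let cu : continuous u. Proof. exact: lipschitz_continuous_rV u_lip. Qed.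
Let mu_ : measurable_fun setT u. Proof. exact: continuous_measurable_rV. Qed.
Let mg : measurable_fun setT (grad_l1 u). Proof. exact: measurable_grad_l1. Qed.
Let p0 : 0 < p. Proof. exact: lt_trans p_gt1. Qed.
Let q0 : 0 < q. Proof. exact: lt_le_trans p_le_q. Qed.
Let s0 : 0 < s. Proof. by rewrite divr_gt0// subr_gt0. Qed.
Let bet0 : 0 < bet. Proof. by rewrite divr_gt0. Qed.
Let gam0 : 0 < gam. Proof. by rewrite addr_gt0// divr_gt0. Qed.

Lemma le_LlogL (e a b : R) : 0 <= e -> 0 <= a -> a <= b -> LlogL e a <= LlogL e b.
Proof.
move=> e0 a0 ab; have b0 := le_trans a0 ab.
rewrite /LlogL; apply: ler_pM => //; first exact: powR_ge0.
have h1 := le_trans ler01 (ln_e_ge1 a0); have h2 := le_trans ler01 (ln_e_ge1 b0).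
apply: ge0_ler_powR; [by []|by rewrite nnegrE|by rewrite nnegrE|].
by rewrite ler_ln ?posrE ?ltr_wpDr ?expR_gt0// lerD2l.
Qed.

Lemma LlogL_ge0 (e a : R) : 0 <= a -> 0 <= LlogL e a.
Proof. by move=> a0; rewrite mulr_ge0// powR_ge0. Qed.

Lemma measurable_LlogL_comp (e c : R) (f : T -> R) : measurable_fun setT f ->
  measurable_fun setT (fun y => LlogL e (f y / c)).
Proof.
move=> mf; have mfc : measurable_fun setT (fun y => f y / c) by exact: measurable_funM.
apply: measurable_funM => //; apply: (measurableT_comp (measurable_powR e)).
by apply: (measurableT_comp (@measurable_ln R)); exact: measurable_funD.
Qed.

Lemma weak_cst1_ge0 : 0 <= weak_cst1.
Proof.
rewrite mulr_ge0 ?mulr_ge0 ?exprn_ge0// invr_ge0 subr_ge0 -opprB powRN.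
rewrite invf_le1 ?powR_gt0 ?sqrtr_gt0//.
rewrite -[leLHS](@powRr0 _ (Num.sqrt 2)) ler_powR ?subr_ge0 ?(ltW p_gt1)//.
by rewrite -{1}(@sqrtr1 R) ler_sqrt// ler1n.
Qed.

Lemma weak_cst2_gt0 : 0 < weak_cst2.
Proof.
have g1 : 0 < gam `^ gam by rewrite powR_gt0.
have c3 : 0 < 1 + 2 ^+ n * gam `^ gam by rewrite ltr_wpDr// mulr_ge0 ?exprn_ge0// ltW.
have lc : 0 < layer_cst n gam bet.
  by rewrite /layer_cst mulr_gt0// powR_gt0// mulr_gt0// mulr_gt0// powR_gt0.
have ls : 0 < layer_sum_cst (eps * bet).
  rewrite /layer_sum_cst mulr_gt0 ?powR_gt0 ?divr_gt0 ?ln_gt0 ?ltr1n// addr_gt0// invr_gt0.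
  exact: mulr_gt0.
have s2 : 0 < 1 - Num.sqrt (2 : R) / 2.
  by rewrite subr_gt0; case/andP: (@sqrt2_half R).
have n0 : 0 < n%:R * 2 ^+ n :> R by rewrite mulr_gt0 ?ltr0n// exprn_gt0.
have b2 : 0 < 2 `^ bet by rewrite powR_gt0.
have d2 : 0 < 2 ^+ n / (1 - Num.sqrt 2 / 2) :> R by rewrite divr_gt0// exprn_gt0.
have a4 : 0 < 4 * (layer_cst n gam bet * 2 `^ bet) by exact: mulr_gt0 (mulr_gt0 lc b2).
exact: mulr_gt0 n0 (mulr_gt0 (mulr_gt0 a4 d2) ls).
Qed.

Lemma weak_cst_gt0 : 0 < weak_cst.
Proof.
by rewrite mulr_gt0 ?powR_gt0// ltr_wpDl ?weak_cst1_ge0// weak_cst2_gt0.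
Qed.

(** Of the height [t], one quarter is lost to the root mean and one to the error at the last
    generation; the remaining half is tested against the weight on the level set. *)
Lemma weak_type t : 0 < t -> (forall x, t <= u x -> dcube ell 0 0 x) ->
  (forall x, dmean ell 0 (EFin \o u) x <= (t / 4)%:E)%E ->
  ((t `^ q)%:E * \int[leb]_(x in [set x | (t <= u x)%R]) (w x)%:E <=
   weak_cst%:E * (\int[leb]_x ((grad_l1 u x `^ p)%:E * V x)) `^ (q / p))%E.
Proof.
move=> t0 root hroot; set E := [set x | (t <= u x)%R].
have mE : measurable E by rewrite /E -[X in measurable X]setTI; apply: measurable_fun_ler.
pose mu x : R := w x * \1_E x.
have mu0 x : 0 <= mu x by rewrite mulr_ge0.
have muw x : mu x <= w x by rewrite ler_piMr// indicE; case: (_ \in _).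
have muB x : mu x <= B by exact: le_trans (muw x) (w_le x).
have mmu : measurable_fun setT mu by apply: measurable_funM => //; exact: measurable_indic.
have muroot x : ~ dcube ell 0 0 x -> mu x = 0.
  move=> hx; rewrite /mu indicE memNset ?mulr0// => /root; exact: hx.
have -> : (\int[leb]_(x in E) (w x)%:E = \int[leb]_x (mu x)%:E)%E.
  rewrite integral_mkcond; apply: eq_integral => x _; rewrite patchE /mu indicE.
  by case: (_ \in _); rewrite ?mulr1 ?mulr0.
set G := (\int[leb]_x ((grad_l1 u x `^ p)%:E * V x))%E.
have G0 : (0 <= G)%E by apply: integral_ge0 => x _; rewrite mule_ge0// lee_fin powR_ge0.
have fin : (\int[leb]_x (mu x)%:E < +oo)%E.
  apply: (@le_lt_trans _ _ (\int[leb]_(x in dcube ell 0 0) (cst B%:E) x)%E).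
    rewrite [leRHS]integral_mkcond; apply: ge0_le_integral => //.
    - by move=> x _; rewrite lee_fin.
    - exact/measurable_EFinP.
    - by apply/(measurable_restrictT _ _).1 => //; exact: measurable_dcube.
    - move=> x _; rewrite patchE; case: ifPn; first by rewrite lee_fin.
      by rewrite notin_setE => /muroot ->.
  rewrite integral_cst; last exact: measurable_dcube.
  rewrite -[X in (_ * X)%E]/(leb (dcube ell 0 0)) (lebesgue_dcube ell_gt0).
  by rewrite -EFinM ltry.
have [M ME] : exists M : R, (\int[leb]_x (mu x)%:E = M%:E)%E.
  exists (fine (\int[leb]_x (mu x)%:E)%E); rewrite fineK// ge0_fin_numE// integral_ge0// => x _.
  by rewrite lee_fin.
have M0 : 0 <= M by rewrite -lee_fin -ME integral_ge0// => x _; rewrite lee_fin.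
rewrite ME; move: M0; rewrite le_eqVlt => /predU1P[<-|M0].
  by rewrite mule0 mule_ge0 ?poweR_ge0// lee_fin ltW// weak_cst_gt0.
have qp0 : 0 < q / p by rewrite divr_gt0.
move: G0; rewrite /G; case GE : (\int[leb]_x _)%E => [G1| |] // G10; last first.
  rewrite poweRyr ?gt_eqF// gt0_muley ?leey// lte_fin weak_cst_gt0.
  by [].
rewrite lee_fin in G10.
rewrite poweR_EFin -!EFinM lee_fin.
(* The number of generations depends on [u] and [t], which is harmless because no later bound
   involves [N]. *)
have [N hN] : exists N, K * dside ell N <= t / 4.
  have t4 : 0 < t / 4 by rewrite divr_gt0.
  have c0 : 0 <= K * ell / (t / 4) by rewrite divr_ge0 ?mulr_ge0// ltW.
  exists (Num.bound (K * ell / (t / 4))); rewrite /dside mulrA ler_pdivrMr ?exprn_gt0//.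
  rewrite [leRHS]mulrC -ler_pdivrMr//; apply: (le_trans (ltW (archi_boundP c0))).
  by rewrite -natrX ler_nat ltnW// ltn_expl.
pose S x : R := \sum_(i < N) dside ell i * mavg ell mu i x.
have mavgm i : measurable_fun setT (mavg ell mu i).
  by apply: (measurable_dconst ell_gt0 (i := i)) => x y; exact: mavg_dconst.
have S0 x : 0 <= S x.
  apply: sumr_ge0 => i _; rewrite mulr_ge0 ?(ltW (dside_gt0 _ _))//.
  exact: (mavg_ge0 ell_gt0 mu0 muB mmu).
have mS : measurable_fun setT S by apply: measurable_sum => i; exact: measurable_funM.
have gpos x : 0 <= grad_l1 u x by exact: grad_l1_ge0.
have main1 : ((t / 2 * M)%:E <= (n%:R * 2 ^+ n)%:E * \int[leb]_x (grad_l1 u x * S x)%:E)%E.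
  rewrite [(t / 2 * M)%:E]EFinM -ME -ge0_integralZl//; last 3 first.
  - exact/measurable_EFinP.
  - by move=> x _; rewrite lee_fin.
  - by rewrite lee_fin divr_ge0// ltW.
  pose D i := dmean ell i (EFin \o grad_l1 u).
  have D0 i x : (0 <= D i x)%E by apply: dmean_ge0 => // y; rewrite lee_fin.
  have mD i : measurable_fun setT (D i) by exact: measurable_dmean.
  pose c i : R := n%:R * 2 ^+ n * dside ell i.
  have c0 i : 0 <= c i by rewrite !mulr_ge0 ?exprn_ge0// ltW// dside_gt0.
  apply: (@le_trans _ _ (\int[leb]_x (\sum_(i < N) (c i)%:E * ((mu x)%:E * D i x)))%E).
    apply: ge0_le_integral => //.
    - by move=> x _; rewrite -EFinM lee_fin mulr_ge0// divr_ge0// ltW.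
    - by apply: measurable_funeM; exact/measurable_EFinP.
    - apply: emeasurable_sum => i; apply: measurable_funeM; apply: emeasurable_funM => //.
      exact/measurable_EFinP.
    move=> x _; have [xE|xE] := pselect (E x); last first.
      rewrite /mu indicE memNset// mulr0 mule0 sume_ge0// => i _.
      by rewrite mul0e mule0.
    have h := le_sum_dmean ell_gt0 K_gt0 u_lip u_ge0 N x.
    have hs : ((t / 2)%:E <= \sum_(i < N) (c i)%:E * D i x)%E.
      have s0' : (0 <= \sum_(i < N) (c i)%:E * D i x)%E.
        by apply: sume_ge0 => i _; rewrite mule_ge0// lee_fin.
      have : (t%:E <= (t / 4)%:E + \sum_(i < N) (c i)%:E * D i x + (t / 4)%:E)%E.
        apply: (@le_trans _ _ (u x)%:E); first by rewrite lee_fin.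
        apply: (le_trans h); apply: leeD; last by rewrite lee_fin.
        by apply: leeD.
      move: s0'; case: (\sum_(i < N) _)%E => [r| |] //.
        by rewrite !lee_fin => _; lra.
      by move=> _ _; rewrite leey.
    rewrite (eq_bigr (fun i : 'I_N => (mu x)%:E * ((c i)%:E * D i x))%E); last first.
      by move=> i _; rewrite muleCA.
    rewrite -ge0_sume_distrr; last by move=> i _; rewrite mule_ge0// lee_fin.
    by rewrite muleC; apply: lee_wpmul2l; rewrite ?lee_fin.
  rewrite ge0_integral_sum//; last 2 first.
  - move=> i; apply: measurable_funeM; apply: emeasurable_funM => //.
    exact/measurable_EFinP.
  - by move=> i x _; rewrite mule_ge0 ?lee_fin// mule_ge0// lee_fin.
  rewrite (eq_bigr (fun i : 'I_N => (n%:R * 2 ^+ n)%:E *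
     \int[leb]_x (grad_l1 u x * (dside ell i * mavg ell mu i x))%:E)%E); last first.
    move=> i _; rewrite ge0_integralZl//; last 3 first.
    - by apply: emeasurable_funM => //; exact/measurable_EFinP.
    - by move=> x _; rewrite mule_ge0// lee_fin.
    - by rewrite lee_fin.
    have mue y : (0 <= (EFin \o mu) y)%E by rewrite lee_fin.
    have mmue : measurable_fun setT (EFin \o mu) by exact/measurable_EFinP.
    have ge y : (0 <= (EFin \o grad_l1 u) y)%E by rewrite lee_fin.
    have mge : measurable_fun setT (EFin \o grad_l1 u) by exact/measurable_EFinP.
    rewrite (dmean_adjoint ell_gt0 i mue mmue ge mge).
    rewrite /c [(_ * dside ell i)%:E]EFinM -muleA; congr (_ * _)%E.
    rewrite -ge0_integralZl//; last 3 first.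
    - by apply: emeasurable_funM; [exact: measurable_dmean|exact/measurable_EFinP].
    - by move=> x _; apply: mule_ge0 => //; exact: dmean_ge0.
    - by rewrite lee_fin ltW// dside_gt0.
    apply: eq_integral => x _ /=.
    rewrite (mavgE ell_gt0 mu0 muB mmu) -!EFinM; congr _%:E; ring.
  rewrite -ge0_sume_distrr; last first.
    move=> i _; apply: integral_ge0 => x _; rewrite lee_fin mulr_ge0// mulr_ge0//.
      by rewrite ltW// dside_gt0.
    exact: (mavg_ge0 ell_gt0 mu0 muB mmu).
  apply: lee_wpmul2l; first by rewrite lee_fin mulr_ge0// exprn_ge0.
  rewrite -ge0_integral_sum//; last 2 first.
  - move=> i; apply/measurable_EFinP; apply: measurable_funM => //; exact: measurable_funM.
  - move=> i x _; rewrite lee_fin mulr_ge0// mulr_ge0//.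
      by rewrite ltW// dside_gt0.
    exact: (mavg_ge0 ell_gt0 mu0 muB mmu).
  rewrite le_eqVlt; apply/orP; left; apply/eqP; apply: eq_integral => x _.
  by rewrite sumEFin /S mulr_sumr.
have HVmu x i lam : 0 < lam -> (V x < ((dside ell i `^ alpha * lam) `^ (p / q))%:E)%E ->
    (dmean ell i (fun y => (LlogL gam (mu y / lam))%:E) x <= 1)%E.
  move=> l0 hV; apply: le_trans (HV l0 hV); apply: le_dmean => //.
  - by move=> y; rewrite lee_fin LlogL_ge0// divr_ge0// ltW.
  - by apply/measurable_EFinP; exact: measurable_LlogL_comp.
  - by apply/measurable_EFinP; exact: measurable_LlogL_comp.
  - move=> y _; rewrite lee_fin; apply: le_LlogL; rewrite ?(ltW gam0) ?divr_ge0 ?(ltW l0)//.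
    by rewrite ler_pM2r// invr_gt0.
(* The dual bound is applied to [eta] times the gradient, to prepare the optimization over [eta]. *)
have step eta : 0 < eta -> t / 2 * M * eta <=
    weak_cst1 * (eta `^ p * G1) + weak_cst2 * M `^ (s - bet).
  move=> eta0; pose g x := eta * grad_l1 u x.
  have g0 x : 0 <= g x by rewrite mulr_ge0// ltW.
  have mg' : measurable_fun setT g by exact: measurable_funM.
  have := @dual_bound _ n ell mu B M ell_gt0 mu0 muB mmu muroot ME M0 n_gt0 N p q eps g V
    p_gt1 p_le_q eps_gt0 g0 mg' V_ge0 mV HVmu.
  have -> : (\int[leb]_x (g x * \sum_(i < N) dside ell i * mavg ell mu i x)%:E =
      eta%:E * \int[leb]_x (grad_l1 u x * S x)%:E)%E.
    rewrite -ge0_integralZl//; last 3 first.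
    - by apply/measurable_EFinP; exact: measurable_funM.
    - by move=> x _; rewrite lee_fin mulr_ge0.
    - by rewrite lee_fin ltW.
    by apply: eq_integral => x _; rewrite -EFinM mulrA.
  have -> : (\int[leb]_x ((g x `^ p)%:E * V x) = (eta `^ p * G1)%:E)%E.
    rewrite EFinM -GE -ge0_integralZl//; last 3 first.
    - apply: emeasurable_funM => //; apply/measurable_EFinP.
      exact: (measurableT_comp (measurable_powR p) mg).
    - by move=> x _; rewrite mule_ge0// lee_fin powR_ge0.
    - by rewrite lee_fin powR_ge0.
    apply: eq_integral => x _; by rewrite muleA -EFinM /g powRM// ltW.
  move=> h.
  have h2 := lee_wpmul2l (_ : (0 <= eta%:E)%E) main1.
  have {}h2 := h2 (ltW eta0).
  have c0 : 0 <= n%:R * 2 ^+ n :> R by rewrite mulr_ge0// exprn_ge0.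
  have h3 := lee_wpmul2l (c0 : (0 <= (n%:R * 2 ^+ n)%:E)%E) h.
  rewrite muleCA in h2.
  have h4 : eta * (t / 2 * M) <= n%:R * 2 ^+ n *
     (4 / (1 - Num.sqrt 2 `^ (1 - p)) * (eta `^ p * G1) +
      4 * (layer_cst n gam bet * 2 `^ bet) * (2 ^+ n / (1 - Num.sqrt 2 / 2)) *
      layer_sum_cst (eps * bet) * (M `^ (s - 1 - bet) * M)).
    by rewrite -lee_fin; exact: le_trans h2 h3.
  rewrite mulrC; apply: (le_trans h4); apply: ler_eq.
  rewrite /weak_cst1 /weak_cst2 -/s -/bet -/gam.
  have -> : M `^ (s - bet) = M `^ (s - 1 - bet) * M.
    rewrite -[X in _ = _ * X]powRr1 ?(ltW M0)// -powRD; last by rewrite (gt_eqF M0) implybT.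
    by congr (_ `^ _); ring.
  ring.
have t20 : 0 < t / 2 by rewrite divr_gt0.
have := @scale_optimization R (t / 2) M G1 weak_cst1 weak_cst2 p q p_gt1 p_le_q t20 M0 G10
  weak_cst1_ge0 (ltW weak_cst2_gt0) step.
rewrite /weak_cst => h.
have -> : t `^ q = 2 `^ q * (t / 2) `^ q.
  by rewrite -powRM ?(ltW t20)//; congr (_ `^ _); rewrite mulrC divfK.
by rewrite -!mulrA ler_wpM2l ?powR_ge0.
Qed.

End weak_type.

(** * Comparison of integrals with one measurable integrand *)

Section lower_integral.
Context d (T : measurableType d) (R : realType).
Variables (mu : {measure set T -> \bar R}) (D : set T).
Hypothesis mD : measurable D.
Implicit Types f g : T -> \bar R.
Local Open Scope ereal_scope.

Import HBNNSimple.

(* The integral of a nonnegative function being the supremum of the integrals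
   of the simple functions below it, only one side has to be measurable. *)
Lemma ge0_le_integral_ptw f g : (forall x, D x -> 0 <= f x) ->
  (forall x, D x -> f x <= g x) ->
  \int[mu]_(x in D) f x <= \int[mu]_(x in D) g x.
Proof.
move=> f0 fg; have g0 x : D x -> 0 <= g x by move=> Dx; exact: le_trans (f0 _ Dx) (fg _ Dx).
rewrite !ge0_integralE//; apply: ereal_sup_le => _ [h /= hf <-]; exists h => //= x.
apply: le_trans (hf x) _; rewrite !patchE; case: ifPn => //; rewrite inE; exact: fg.
Qed.

(** Every simple function below [f] is almost everywhere below [g], so the measurable comparison
    applies to it. *)
Lemma ge0_ae_le_integral_measurabler f g : (forall x, D x -> 0 <= f x) ->
  (forall x, D x -> 0 <= g x) -> measurable_fun D g ->
  {ae mu, forall x, D x -> f x <= g x} ->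
  \int[mu]_(x in D) f x <= \int[mu]_(x in D) g x.
Proof.
move=> f0 g0 mg fg; rewrite (ge0_integralE _ f0); apply: ge_ereal_sup => _ [h /= hf <-].
have := @integral_nnsfun _ _ _ mu _ measurableT h; rewrite patch_setT => <-;
rewrite [leRHS]integral_mkcond; apply: ae_ge0_le_integral => //.
- by move=> x _; rewrite lee_fin.
- exact/measurable_EFinP.
- by move=> x _; exact: erestrict_ge0.
- by apply/(measurable_restrictT _ _).1.
apply: (@filterS _ _ (ae_filter_ringOfSetsType _)) fg => x fg _.
apply: le_trans (hf x) _; rewrite !patchE; case: ifPn => //; rewrite inE => /fg.
exact.
Qed.

(** The exceptional null set may be removed from the integral of the measurable [f]; off it the
    comparison holds pointwise. *)
Lemma ge0_ae_le_integral_measurablel f g : (forall x, D x -> 0 <= f x) ->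
  (forall x, D x -> 0 <= g x) -> measurable_fun D f ->
  {ae mu, forall x, D x -> f x <= g x} ->
  \int[mu]_(x in D) f x <= \int[mu]_(x in D) g x.
Proof.
move=> f0 g0 mf [N [mN N0 hN]]; rewrite (ge0_negligible_integral mN)//.
rewrite integral_mkcond [leRHS]integral_mkcond.
have pos (A : set T) (h : T -> \bar R) x : (forall x, A x -> 0 <= h x) -> 0 <= (h \_ A) x.
  by move=> h0; exact: erestrict_ge0.
rewrite !ge0_integralTE//; last 2 first.
- by move=> x; exact: pos.
- by move=> x; apply: pos => y [Dy _]; exact: f0.
apply: ereal_sup_le => _ [h /= hf <-]; exists h => //= x.
apply: le_trans (hf x) _; rewrite !patchE.
have [Dx|nDx] := pselect (D x); last first.
  by rewrite memNset ?memNset// => -[].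
have [Nx|nNx] := pselect (N x).
  by rewrite memNset ?(mem_set Dx) ?g0// => -[].
rewrite mem_set// (mem_set Dx); apply: contrapT => h'; apply: nNx; apply: hN.
by move=> /(_ Dx).
Qed.

End lower_integral.

(** * Local rules for partial derivatives and truncation *)

Section pderive_local.
Context {R : realType} (n : nat).
Local Notation T := 'rV[R]_n.
Implicit Types (v : T -> R) (c : 'I_n) (x : T).

Lemma near_line (P : set T) c x : nbhs x P ->
  \forall h \near (0 : R)^', P (h *: evec c + x).
Proof.
case/nbhs_ballP => e/= e0 eP; near=> h; apply: eP.
rewrite -ball_normE /= opprD addrCA subrr addr0 normrN normrZ.
apply: (@le_lt_trans _ _ `|h|); last by near: h; exact: dnbhs0_lt.
rewrite ler_piMr// /Num.Def.normr/= mx_normrE; apply: bigmax_le => // -[i j] _ /=.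
by rewrite mxE; case: (_ && _); rewrite ?normr1 ?normr0.
Unshelve. all: by end_near. Qed.

Lemma cvg_dquot v c x : partial_derivable v c x ->
  dquot v c h x @[h --> (0 : R)^'] --> pderive v c x.
Proof. by rewrite -dquotE; exact. Qed.

Lemma cvg_pderive v c x l : dquot v c h x @[h --> (0 : R)^'] --> l -> pderive v c x = l.
Proof. by move=> h; rewrite /pderive /derive dquotE; exact: cvg_lim. Qed.

Lemma pderive_le v c x L : 0 <= L ->
  (\forall h \near (0 : R)^', `|dquot v c h x| <= L) -> `|pderive v c x| <= L.
Proof.
move=> L0 hL; have [hx|hx] := pselect (partial_derivable v c x); last first.
  by rewrite pderive0// normr0.
exact: (cvgr_to_le (cvg_norm (cvg_dquot hx)) hL).
Qed.

Lemma pderive_local_lip v c x L : 0 <= L ->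
  (\forall y \near x, `|v y - v x| <= L * `|y - x|) -> `|pderive v c x| <= L.
Proof.
move=> L0 hL; apply: pderive_le => //; near=> h.
have h0 : h != 0 by near: h; exact: nbhs_dnbhs_neq.
have : `|v (h *: evec c + x) - v x| <= L * `|h *: evec c + x - x|.
  by near: h; exact: (near_line c hL).
rewrite addrK normrZ => hh; rewrite /dquot normrM normfV mulrC ler_pdivrMr ?normr_gt0//.
apply: (le_trans hh); rewrite ler_wpM2l// ler_piMr// /Num.Def.normr/= mx_normrE.
apply: bigmax_le => // -[i j] _ /=.
by rewrite mxE; case: (_ && _); rewrite ?normr1 ?normr0.
Unshelve. all: by end_near. Qed.

(** Fermat's rule: the quotients from the two sides have opposite signs. A positive [s] covers
    minima, a negative one maxima; where the derivative does not exist its default value is 0. *)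
Lemma pderive_extremum v c x (s : R) : s != 0 -> (forall y, s * v x <= s * v y) ->
  pderive v c x = 0.
Proof.
move=> s0 hv; have [hx|hx] := pselect (partial_derivable v c x); last exact: pderive0.
have hc := cvg_dquot hx.
have hs : s * dquot v c h x @[h --> (0 : R)^'] --> s * pderive v c x.
  exact: cvgMr.
have sq (h : R) : s * dquot v c h x = h^-1 * (s * v (h *: evec c + x) - s * v x).
  by rewrite /dquot; ring.
suff : s * pderive v c x = 0 by move/eqP; rewrite mulf_eq0 (negbTE s0) => /eqP.
apply/eqP; rewrite eq_le; apply/andP; split.
  have hl : s * dquot v c h x @[h --> (0 : R)^'-] --> s * pderive v c x.
    exact: cvg_dnbhs_at_left.
  apply: (cvgr_to_le hl); near=> h; rewrite sq.
  rewrite mulr_le0_ge0 ?subr_ge0// invr_le0; apply: ltW; near: h; exact: nbhs_left_lt.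
have hr : s * dquot v c h x @[h --> (0 : R)^'+] --> s * pderive v c x.
  exact: cvg_dnbhs_at_right.
apply: (cvgr_to_ge hr); near=> h; rewrite sq.
rewrite mulr_ge0 ?subr_ge0// invr_ge0; apply: ltW; near: h; exact: nbhs_right_gt.
Unshelve. all: by end_near. Qed.

(** Here [s] is 1 or -1. Only an inequality is claimed: if [v] is not differentiable its derivative
    is 0 by default, otherwise [v'] inherits differentiability. *)
Lemma pderive_near_affine v v' c x (s b : R) : s ^+ 2 = 1 ->
  (\forall y \near x, v y = s * v' y + b) -> `|pderive v c x| <= `|pderive v' c x|.
Proof.
move=> s1 hv; have [hx|hx] := pselect (partial_derivable v c x); last first.
  by rewrite pderive0// normr0.
have hc := cvg_dquot hx.
have hs : s * dquot v c h x @[h --> (0 : R)^'] --> s * pderive v c x.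
  exact: cvgMr.
rewrite (@cvg_pderive v' c x (s * pderive v c x)); last first.
  apply: cvg_trans hs; apply: near_eq_cvg; near=> h.
  have e1 : v (h *: evec c + x) = s * v' (h *: evec c + x) + b.
    by near: h; exact: (near_line c hv).
  rewrite /dquot e1 (nbhs_singleton hv).
  move: (v' (h *: evec c + x)) (v' x) => A B.
  transitivity (s ^+ 2 * (h^-1 * (A - B))); last by rewrite s1 mul1r.
  by ring.
have s2 : `|s| ^+ 2 = 1 by rewrite -normrX s1 normr1.
by rewrite normrM; move/eqP: s2; rewrite sqrp_eq1// => /eqP ->; rewrite mul1r.
Unshelve. all: by end_near. Qed.

End pderive_local.

Section truncation.
Context {R : realType} (n : nat).
Local Notation T := 'rV[R]_n.
Variables (u : T -> R) (K : R).
Hypothesis K_gt0 : 0 < K.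
Hypothesis u_lip : forall x y, `|u x - u y| <= K * `|x - y|.
Implicit Types (c : 'I_n) (x y : T) (t : R).

(** Maz'ya's truncation: the slice of [|u|] between the heights [t] and [2 * t], lowered to start at
    0. *)
Definition trunc t x : R := Num.min (Num.max (`|u x| - t) 0) t.

Lemma trunc_lip t x y : `|trunc t x - trunc t y| <= K * `|x - y|.
Proof.
apply: le_trans (u_lip x y); apply: le_trans (ler_dist_dist _ _).
have maxL (a b z : R) : `|Num.max a z - Num.max b z| <= `|a - b|.
  case: (leP a z) => az; case: (leP b z) => bz; rewrite ?lexx ?subrr ?normr0//.
    rewrite distrC [leRHS]distrC gtr0_norm ?subr_gt0//; apply: le_trans (ler_norm _); exact: lerB.
  rewrite gtr0_norm ?subr_gt0//; apply: le_trans (ler_norm _); exact: lerB.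
have minL (a b z : R) : `|Num.min a z - Num.min b z| <= `|a - b|.
  have minE (d : R) : Num.min d z = - Num.max (- d) (- z) by rewrite oppr_max !opprK.
  by rewrite !minE opprK addrC distrC; apply: le_trans (maxL _ _ _) _; rewrite opprK addrC distrC.
apply: le_trans (minL _ _ _) _; apply: le_trans (maxL _ _ _) _.
by rewrite opprB addrA subrK.
Qed.

Lemma trunc_ge0 t x : 0 <= t -> 0 <= trunc t x.
Proof. by move=> t0; rewrite /trunc le_min t0 le_max lexx orbT. Qed.

Lemma trunc_le t x : trunc t x <= t.
Proof. by rewrite /trunc ge_min lexx orbT. Qed.

Lemma trunc_eq0 t x : 0 <= t -> `|u x| <= t -> trunc t x = 0.
Proof. move=> t0 h; rewrite /trunc max_r ?min_l//; lra. Qed.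

Lemma trunc_geE t x : 0 < t -> (t <= trunc t x) = (2 * t <= `|u x|).
Proof.
by move=> t0; rewrite /trunc le_min lexx andbT le_max; apply/idP/idP; [case/orP|move=> ?; apply/orP; left]; lra.
Qed.

(** Where [|u| <= t] the truncation attains its minimum, where [|u| >= 2 * t] its maximum; Fermat's
    rule applies at every such point, so the level sets need no separate argument. In between it
    agrees locally with [u] or [- u] up to a constant. *)
Lemma pderive_trunc t c x : 0 < t ->
  `|pderive (trunc t) c x| <= `|pderive u c x| * (t < `|u x| < 2 * t)%R%:R.
Proof.
move=> t0; case: (boolP (t < `|u x| < 2 * t)) => [/andP[h1 h2]|h]; last first.
  rewrite mulr0; have [hl|hl] := leP (`|u x|) t.
    rewrite (@pderive_extremum _ _ _ _ _ 1) ?normr0 ?oner_neq0// => y.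
    by rewrite !mul1r (trunc_eq0 (ltW t0) hl) trunc_ge0// ltW.
  have hg : 2 * t <= `|u x| by move: h; rewrite hl/= -leNgt.
  rewrite (@pderive_extremum _ _ _ _ _ (-1)) ?normr0 ?oppr_eq0 ?oner_neq0// => y.
  rewrite !mulN1r lerN2; apply: (le_trans (trunc_le t y)).
  by rewrite trunc_geE.
rewrite mulr1.
have cn : continuous (fun y => `|u y|).
  apply: (@lipschitz_continuous_rV _ _ _ K) => // y z.
  exact: le_trans (ler_dist_dist _ _) (u_lip _ _).
have cux : continuous u by exact: (lipschitz_continuous_rV K_gt0 u_lip).
have near1 : \forall y \near x, t < `|u y| < 2 * t.
  have a1 : \forall y \near x, t < `|u y| by apply: (cvgr_gt _ (cn x)).
  have a2 : \forall y \near x, `|u y| < 2 * t by apply: (cvgr_lt _ (cn x)).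
  near=> y; apply/andP; split; near: y; [exact: a1|exact: a2].
have tE y : t < `|u y| < 2 * t -> trunc t y = `|u y| - t.
  move=> /andP[? ?]; rewrite /trunc max_l ?min_l//; lra.
have [u0|u0] := leP 0 (u x).
  apply: (@pderive_near_affine _ _ _ _ _ _ 1 (- t)); first by rewrite expr1n.
  have up : 0 < u x by rewrite -(ger0_norm u0); exact: lt_trans h1.
  have a3 : \forall y \near x, 0 < u y by apply: (cvgr_gt _ (cux x)).
  near=> y; rewrite tE; last by near: y; exact: near1.
  by rewrite mul1r gtr0_norm//; near: y; exact: a3.
apply: (@pderive_near_affine _ _ _ _ _ _ (-1) (- t)); first by rewrite sqrrN expr1n.
have a3 : \forall y \near x, u y < 0 by apply: (cvgr_lt _ (cux x)).
near=> y; rewrite tE; last by near: y; exact: near1.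
by rewrite mulN1r ltr0_norm//; near: y; exact: a3.
Unshelve. all: by end_near. Qed.

Lemma grad_l1_trunc t x : 0 < t ->
  grad_l1 (trunc t) x <= grad_l1 u x * (t < `|u x| < 2 * t)%R%:R.
Proof.
by move=> t0; rewrite /grad_l1 mulr_suml; apply: ler_sum => c _; exact: pderive_trunc.
Qed.

Lemma grad_l1_euclidean x : grad_l1 u x <= n%:R * euclidean_norm (gradient u x).
Proof.
rewrite /grad_l1; apply: (@le_trans _ _ (\sum_(c < n) euclidean_norm (gradient u x))).
  apply: ler_sum => c _; rewrite /euclidean_norm -sqrtr_sqr ler_wsqrtr//.
  rewrite (bigD1 c)//= [X in X ^+ 2 + _]mxE -[X in X <= _]addr0 lerD//.
  by rewrite sumr_ge0// => i _; rewrite sqr_ge0.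
by rewrite sumr_const card_ord mulr_natl.
Qed.

End truncation.

(** * A dyadic maximal function *)

Section dyadic_maximal.
Context {R : realType} (n : nat).
Local Notation T := 'rV[R]_n.
Local Notation leb := (lebesgue_rV n).
Variables (p q alpha gam : R) (w w' : T -> R).
Hypothesis p_gt0 : 0 < p.
Hypothesis q_gt0 : 0 < q.
Hypothesis gam_ge0 : 0 <= gam.
Implicit Types (x : T) (i : nat).

Lemma measurable_cube (a : T) l : measurable (cube a l).
Proof.
rewrite (_ : cube a l = [set x | forall c, `[a ord0 c, a ord0 c + l]%classic (x ord0 c)]).
  apply: (measurable_coordinatewise (A := fun c => `[a ord0 c, a ord0 c + l]%classic)) => c.
  exact: measurable_itv.
by apply/seteqP; split=> x h c; have := h c; rewrite /= in_itv.
Qed.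

Lemma orlicz_average_ge0 Theta (f : T -> R) (Q : set T) : (0 <= orlicz_average Theta f Q)%E.
Proof. by apply: le_ereal_inf_tmp => _ [l [l0 _] <-]; rewrite lee_fin ltW. Qed.

Definition dorlicz ell i x : \bar R :=
  ((dside ell i `^ alpha)%:E *
   orlicz_average (LlogL gam) w (cube (dcorner ell i x) (dside ell i)))%E.

(* A Borel minorant of the weight in the Sobolev inequality: a supremum over
   uncountably many closed cubes need not be Borel measurable. *)
Definition dmaximal ell x : \bar R := esups (fun i => dorlicz ell i x `^ (p / q))%E 0.

Lemma dorlicz_ge0 ell i x : (0 <= dorlicz ell i x)%E.
Proof. by rewrite mule_ge0 ?orlicz_average_ge0// lee_fin powR_ge0. Qed.

Lemma dorlicz_le_dmaximal ell i x : (dorlicz ell i x `^ (p / q) <= dmaximal ell x)%E.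
Proof. by apply: ereal_sup_ubound; exists i. Qed.

Lemma dmaximal_ge0 ell x : (0 <= dmaximal ell x)%E.
Proof. by apply: le_trans (dorlicz_le_dmaximal ell 0 x); exact: poweR_ge0. Qed.

Lemma le_poweR (r : R) (x y : \bar R) : 0 <= r -> (0 <= x)%E -> (x <= y)%E ->
  (x `^ r <= y `^ r)%E.
Proof.
move=> r0 x0 xy; apply: gt0_ler_poweR => //; rewrite in_itv/= leey andbT//.
exact: le_trans xy.
Qed.

Lemma measurable_dmaximal ell : 0 < ell -> measurable_fun setT (dmaximal ell).
Proof.
move=> l0; apply: (@measurable_fun_esups _ _ _ _ (fun i x => dorlicz ell i x `^ (p / q))%E) => i.
apply: (measurable_dconst l0 (i := i)) => x y h; rewrite /dorlicz.
suff -> : dcorner ell i x = dcorner ell i y by [].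
by apply/rowP => c; rewrite !mxE h.
Qed.

Lemma dmaximal_le ell x : 0 < ell ->
  (dmaximal ell x <= orlicz_maximal alpha (LlogL gam) w x `^ (p / q))%E.
Proof.
move=> l0; apply: ge_ereal_sup => _ [i _ <-]; apply: le_poweR.
- by rewrite divr_ge0 ?ltW.
- exact: dorlicz_ge0.
apply: ereal_sup_ubound; exists (dcorner ell i x), (dside ell i); split=> //.
- exact: dside_gt0.
- by apply: (dcube_subset_cube l0 (x := x)); exact: dcube_refl.
Qed.

Hypothesis w'_ge0 : forall x, 0 <= w' x.
Hypothesis mw' : measurable_fun setT w'.
Hypothesis w'_le : {ae leb, forall x, w' x <= `|w x|}.

(** A strict bound on the infimum supplies an admissible [lam' < lam]. Monotonicity then passes from
    the closed cube to the dyadic one, from [w] to its minorant and from [lam'] to [lam]. *)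
Lemma dmaximal_orlicz ell x i lam : 0 < ell -> 0 < lam ->
  (dmaximal ell x < ((dside ell i `^ alpha * lam) `^ (p / q))%:E)%E ->
  (dmean ell i (fun y => (LlogL gam (w' y / lam))%:E) x <= 1)%E.
Proof.
move=> l0 lam0 h.
have s0 : 0 < dside ell i by exact: dside_gt0.
have a0 : 0 < dside ell i `^ alpha by rewrite powR_gt0.
have pq0 : 0 <= p / q by rewrite divr_ge0 ?ltW.
have : (dorlicz ell i x < (dside ell i `^ alpha * lam)%:E)%E.
  rewrite ltNge; apply/negP => h'.
  have := le_poweR pq0 _ h'; rewrite lee_fin mulr_ge0 ?(ltW a0) ?(ltW lam0)// => /(_ isT).
  rewrite poweR_EFin => h2; have := lt_le_trans h h2.
  by rewrite ltNge dorlicz_le_dmaximal.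
rewrite /dorlicz EFinM lte_pmul2l//.
move=> /ereal_inf_lt[_ [lam' [lam'0 hl] <-]]; rewrite lte_fin => ll.
have cE := lebesgue_rV_cube (dcorner ell i x) s0.
rewrite cE [fine _]/= in hl; rewrite /dmean; apply: le_trans hl.
apply: lee_wpmul2l; first by rewrite lee_fin invr_ge0 exprn_ge0// ltW.
have mL : measurable_fun setT (fun y => (LlogL gam (w' y / lam))%:E).
  by apply/measurable_EFinP; exact: measurable_LlogL_comp.
have L0 y : 0 <= LlogL gam (w' y / lam) by rewrite LlogL_ge0// divr_ge0// ltW.
apply: (@le_trans _ _ (\int[leb]_(y in cube (dcorner ell i x) (dside ell i))
    (LlogL gam (w' y / lam))%:E)%E).
  apply: ge0_subset_integral => //.
  - exact: measurable_dcube.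
  - exact: measurable_cube.
  - exact: measurable_funTS.
  - by move=> y _; rewrite lee_fin.
  - by move=> y hy; exact: (dcube_subset_cube l0 hy).
apply: ge0_ae_le_integral_measurablel => //.
- exact: measurable_cube.
- by move=> y _; rewrite lee_fin.
- by move=> y _; rewrite lee_fin LlogL_ge0// divr_ge0// ltW.
- exact: measurable_funTS.
apply: (@filterS _ _ (ae_filter_ringOfSetsType _)) w'_le => y hy _; rewrite lee_fin.
apply: le_LlogL => //; first by rewrite divr_ge0// ltW.
apply: (@le_trans _ _ (`|w y| / lam)); first by rewrite ler_pM2r ?invr_gt0.
by rewrite ler_wpM2l// lef_pV2// ltW.
Qed.

End dyadic_maximal.

Section poweR_sum.
Context {R : realType}.
Local Open Scope ereal_scope.

Lemma poweRD_ge (a b : \bar R) (r : R) : (1 <= r)%R -> 0 <= a -> 0 <= b ->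
  a `^ r + b `^ r <= (a + b) `^ r.
Proof.
move=> r1; have r0 : (0 < r)%R by exact: lt_le_trans r1.
case: a => [a| |] //; case: b => [b| |] // a0 b0; last 3 first.
- by rewrite addey// poweRyr ?leey// gt_eqF.
- by rewrite addye// poweRyr ?leey// gt_eqF.
- by rewrite addye// poweRyr ?leey// gt_eqF.
rewrite !poweR_EFin lee_fin; rewrite !lee_fin in a0 b0.
have ab0 : (0 <= a + b)%R by exact: addr_ge0.
rewrite -(mulr_powRB1 a0 r0) -(mulr_powRB1 b0 r0) -(mulr_powRB1 ab0 r0) mulrDl.
by apply: lerD; apply: ler_wpM2l => //; apply: ge0_ler_powR;
  rewrite ?nnegrE ?subr_ge0 ?lerDl ?lerDr.
Qed.

(** Used with [r = q / p], at least 1 by [p <= q], to add the energies of the truncations before the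
    power is taken. *)
Lemma sum_poweR_le (N : nat) (a : nat -> \bar R) (r : R) : (1 <= r)%R ->
  (forall j, 0 <= a j) ->
  \sum_(j < N) a j `^ r <= (\sum_(j < N) a j) `^ r.
Proof.
move=> r1 a0; elim: N => [|N IH].
  by rewrite !big_ord0 poweR_ge0.
rewrite !big_ord_recr/=; apply: le_trans (poweRD_ge r1 _ (a0 N)).
  exact: leeD.
by apply: sume_ge0.
Qed.

End poweR_sum.

(** * Summation over dyadic heights *)

Section layers.
Context {R : realType} (n : nat).
Local Notation T := 'rV[R]_n.
Local Notation leb := (lebesgue_rV n).
Variables (p q eps K B Rad S : R) (u w w' : T -> R).
Let gam := q / (p / (p - 1)) + eps.
Let alpha := n%:R - q / p * (n%:R - p).
Hypothesis n_gt0 : (0 < n)%N.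
Hypothesis p_gt1 : 1 < p.
Hypothesis p_le_q : p <= q.
Hypothesis eps_gt0 : 0 < eps.
Hypothesis K_gt0 : 0 < K.
Hypothesis u_lip : forall x y, `|u x - u y| <= K * `|x - y|.
Hypothesis Rad_gt0 : 0 < Rad.
Hypothesis S_gt0 : 0 < S.
Hypothesis u_supp : forall x, u x != 0 -> `|x| <= Rad.
Hypothesis w'_ge0 : forall x, 0 <= w' x.
Hypothesis w'_leB : forall x, w' x <= B.
Hypothesis mw' : measurable_fun setT w'.
Hypothesis w'_le : {ae leb, forall x, w' x <= `|w x|}.

(* The support of u fills at most a 4^-n part of the root cube. *)
Let ell := 8 * Rad.
Let ell_gt0 : 0 < ell. Proof. exact: mulr_gt0. Qed.
Let p0 : 0 < p. Proof. exact: lt_trans p_gt1. Qed.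
Let q0 : 0 < q. Proof. exact: lt_le_trans p_le_q. Qed.
Let gam0 : 0 < gam. Proof. by rewrite addr_gt0// !divr_gt0// subr_gt0. Qed.
Let V := orlicz_maximal alpha (LlogL gam) w.
Let V' := dmaximal p q alpha gam w ell.
Let cu : continuous u. Proof. exact: (lipschitz_continuous_rV K_gt0 u_lip). Qed.
Let mu_ : measurable_fun setT u. Proof. exact: continuous_measurable_rV. Qed.
Let mnu : measurable_fun setT (fun x => `|u x|).
Proof. exact: measurableT_comp. Qed.

Lemma trunc_root t x : 0 < t -> t <= trunc u t x -> dcube ell 0 0 x.
Proof.
move=> t0; rewrite trunc_geE// => h.
have ux : u x != 0 by rewrite -normr_gt0; apply: lt_le_trans h; rewrite mulr_gt0.
have hx := u_supp ux; rewrite dcube_hbox// => c; rewrite /hitv/= in_itv/=.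
have : `|x ord0 c| <= Rad.
  apply: le_trans hx; rewrite /Num.Def.normr/= mx_normrE.
  exact: (le_bigmax _ (fun i : 'I_1 * 'I_n => `|x i.1 i.2|) (ord0, c)).
rewrite /dcorner /dindex /dside !mxE expr0 mul0r add0r mul1r !divr1.
have -> : Num.floor (2^-1 : R) = 0.
  by apply/eqP; rewrite floor_eq; apply/andP; split; lra.
rewrite ler_norml sub0r /ell => /andP[h1 h2]; apply/andP; split; have := Rad_gt0; lra.
Qed.

Lemma dmean_trunc_le t x : 0 < t ->
  (dmean ell 0 (EFin \o trunc u t) x <= (t / 4)%:E)%E.
Proof.
move=> t0; have mt : measurable_fun setT (trunc u t).
  exact: (continuous_measurable_rV (lipschitz_continuous_rV K_gt0 (trunc_lip u_lip t))).
apply: le_trans (dmean_le_integral ell_gt0 0 x _ _) _ => /=.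
- by move=> y; rewrite lee_fin trunc_ge0// ltW.
- exact/measurable_EFinP.
pose a : T := \row__ (- Rad).
have R20 : 0 < 2 * Rad by rewrite mulr_gt0.
apply: (@le_trans _ _ (((dside ell 0 ^+ n)^-1)%:E * (t%:E * leb (cube a (2 * Rad))))%E).
  apply: lee_wpmul2l; first by rewrite lee_fin invr_ge0 exprn_ge0// ltW// dside_gt0.
  rewrite -integral_cst; last exact: measurable_cube.
  rewrite [leRHS]integral_mkcond; apply: ge0_le_integral_ptw => y _.
    by rewrite lee_fin trunc_ge0// ltW.
  rewrite patchE; case: ifPn; first by rewrite lee_fin trunc_le.
  rewrite notin_setE => hy; rewrite lee_fin.
  have [uy|uy] := eqVneq (u y) 0; first by rewrite trunc_eq0 ?uy ?normr0// ltW.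
  exfalso; apply: hy => c; rewrite mxE.
  have : `|y ord0 c| <= Rad.
    apply: le_trans (u_supp uy); rewrite /Num.Def.normr/= mx_normrE.
    exact: (le_bigmax _ (fun i : 'I_1 * 'I_n => `|y i.1 i.2|) (ord0, c)).
  rewrite ler_norml => /andP[h1 h2]; apply/andP; split; lra.
rewrite lebesgue_rV_cube// -!EFinM lee_fin /dside expr0 divr1 mulrC -mulrA.
rewrite ler_wpM2l ?(ltW t0)// -expr_div_n /ell.
have -> : 2 * Rad / (8 * Rad) = 4^-1 by field; rewrite gt_eqF.
case: n n_gt0 => // m _; rewrite exprS ler_piMr ?invr_ge0// exprn_ile1 ?invr_ge0//.
by rewrite invf_le1// ler1n.
Qed.

Lemma trunc_weak_type t : 0 < t ->
  ((t `^ q)%:E * \int[leb]_(x in [set x | (2 * t <= `|u x|)%R]) (w' x)%:E <=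
   (weak_cst n p q eps)%:E *
   (\int[leb]_x ((grad_l1 (trunc u t) x `^ p)%:E * V' x)) `^ (q / p))%E.
Proof.
move=> t0; rewrite (_ : [set x | _] = [set x | t <= trunc u t x]); last first.
  by apply/seteqP; split=> x /=; rewrite trunc_geE.
apply: (weak_type n_gt0 p_gt1 p_le_q eps_gt0 ell_gt0 K_gt0 (trunc_lip u_lip t) _ w'_ge0 w'_leB mw') => //.
- by move=> x; rewrite trunc_ge0// ltW.
- by move=> x; exact: dmaximal_ge0.
- exact: measurable_dmaximal.
- move=> x i lam lam0 h; apply: (@dmaximal_orlicz _ _ p q alpha gam w w') => //.
  exact: ltW.
- by move=> x; exact: trunc_root.
- by move=> x; exact: dmean_trunc_le.
Qed.

(** The shift by 2 makes [4 * layer_height 0 = S], so the layers from [2 * layer_height j] to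
    [4 * layer_height j] exhaust the heights between 0 and [S]. *)
Definition layer_height j : R := S / 2 ^+ j.+2.

Lemma layer_height_gt0 j : 0 < layer_height j.
Proof. by rewrite divr_gt0// exprn_gt0. Qed.

Definition layer_fun N x : R := \sum_(j < N)
  (4 * layer_height j) `^ q * (2 * layer_height j <= `|u x| < 4 * layer_height j)%R%:R.

Lemma layer_height_double j : 2 * layer_height j.+1 = layer_height j.
Proof. by rewrite /layer_height exprS; field; rewrite expf_neq0. Qed.

Lemma sum_layer_indic N x : \sum_(j < N) (layer_height j < `|u x| < 2 * layer_height j)%R%:R <= 1 :> R.
Proof.
have ltl i j : (i < j)%N -> 2 * layer_height j <= layer_height i.
  elim: j => // j IH; rewrite ltnS leq_eqVlt => /predU1P[->|/IH h].
    by rewrite layer_height_double.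
  rewrite layer_height_double; apply: le_trans h; rewrite ler_peMl ?ler1n//.
  exact/ltW/layer_height_gt0.
have [[i hi]|hn] := pselect (exists i : 'I_N, layer_height i < `|u x| < 2 * layer_height i); last first.
  by rewrite big1// => i _; case: (boolP (_ < _ < _)) => // hi; case: hn; exists i.
rewrite (bigD1 i)//= hi big1 ?addr0// => j ji.
case: (boolP (_ < _ < _)) => // hj; case/eqP: ji; apply/val_inj.
case/andP: hi => i1 i2; case/andP: hj => j1 j2.
case: (ltngtP j i) => // /ltl h; exfalso.
  by have := lt_trans (le_lt_trans h j1) i2; rewrite ltxx.
by have := lt_trans (le_lt_trans h i1) j2; rewrite ltxx.
Qed.

(** The weight of the layer starting at height [2 h] is controlled by the energy of the truncation
    at [h], which lives on the strip [h < |u| < 2 h] just below. These strips are disjoint, so all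
    the energies together are at most one energy of [u]. *)
Lemma layer_integral N :
  (\int[leb]_x (layer_fun N x * w' x)%:E <=
   (4 `^ q * weak_cst n p q eps)%:E *
   ((n%:R `^ p)%:E * \int[leb]_x ((`|euclidean_norm (gradient u x)| `^ p)%:E * V x `^ (p / q)))
     `^ (q / p))%E.
Proof.
pose E j : set T := [set x | 2 * layer_height j <= `|u x|].
have mE j : measurable (E j) by rewrite /E -[X in measurable X]setTI; apply: measurable_fun_ler.
have h0 j := layer_height_gt0 j.
pose a j : \bar R := (\int[leb]_x ((grad_l1 (trunc u (layer_height j)) x `^ p)%:E * V' x))%E.
have mg j : measurable_fun setT (grad_l1 (trunc u (layer_height j))).
  apply: measurable_grad_l1.
  exact: (lipschitz_continuous_rV K_gt0 (trunc_lip u_lip _)).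
have V'0 x : (0 <= V' x)%E by exact: dmaximal_ge0.
have mV' : measurable_fun setT V' by exact: measurable_dmaximal.
have a0 j : (0 <= a j)%E by apply: integral_ge0 => x _; rewrite mule_ge0// lee_fin powR_ge0.
have W0 : 0 < weak_cst n p q eps by exact: weak_cst_gt0.
have r1 : 1 <= q / p by rewrite ler_pdivlMr// mul1r.
have r0 : 0 <= q / p by exact: le_trans r1.
apply: (@le_trans _ _ (\sum_(j < N) ((4 `^ q)%:E * (((layer_height j `^ q)%:E *
    \int[leb]_(x in E j) (w' x)%:E))))%E).
  rewrite (eq_bigr (fun j : 'I_N => \int[leb]_x (((4 * layer_height j) `^ q) * (\1_(E j) x * w' x))%:E)%E); last first.
    move=> j _; rewrite muleA -EFinM -powRM// ?(ltW (h0 _))//.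
    rewrite [in LHS]integral_mkcond -ge0_integralZl//; last 3 first.
    - by apply/(measurable_restrictT _ _).1 => //; apply/measurable_EFinP; exact: measurable_funTS.
    - by move=> x _; apply: erestrict_ge0 => y _; rewrite lee_fin.
    - by rewrite lee_fin powR_ge0.
    apply: eq_integral => x _; rewrite patchE indicE; case: (_ \in _).
      by rewrite mul1r EFinM.
    by rewrite mul0r mulr0 mule0.
  have mt j : measurable_fun setT (fun x => ((4 * layer_height j) `^ q * (\1_(E j) x * w' x)))%R.
    apply: measurable_funM => //; apply: measurable_funM => //; exact: measurable_indic.
  rewrite -ge0_integral_sum//; last 2 first.
  - by move=> j; exact/measurable_EFinP.
  - by move=> j x _; rewrite lee_fin !mulr_ge0// powR_ge0.
  apply: ge0_le_integral_ptw => x _.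
    rewrite lee_fin mulr_ge0// sumr_ge0// => j _; by rewrite mulr_ge0// powR_ge0.
  rewrite sumEFin lee_fin mulr_suml; apply: ler_sum => j _.
  rewrite -mulrA ler_wpM2l ?powR_ge0// ler_wpM2r// indicE.
  case: (boolP (_ <= _ < _)) => [/andP[h _]|_] //.
  by rewrite mem_set.
apply: (@le_trans _ _ (\sum_(j < N) ((4 `^ q)%:E * ((weak_cst n p q eps)%:E * a j `^ (q / p))))%E).
  apply: lee_sum => j _; apply: lee_wpmul2l; first by rewrite lee_fin powR_ge0.
  exact: trunc_weak_type.
have -> : (\sum_(j < N) ((4 `^ q)%:E * ((weak_cst n p q eps)%:E * a j `^ (q / p))) =
   (4 `^ q * weak_cst n p q eps)%:E * \sum_(j < N) (a j `^ (q / p)))%E.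
  rewrite ge0_sume_distrr; last by move=> j _; exact: poweR_ge0.
  by apply: eq_bigr => j _; rewrite muleA EFinM.
have c0 : 0 <= 4 `^ q * weak_cst n p q eps by rewrite mulr_ge0 ?powR_ge0// ltW.
apply: lee_wpmul2l; first by rewrite lee_fin.
apply: le_trans (sum_poweR_le N r1 a0) _.
apply: le_poweR => //; first by apply: sume_ge0.
rewrite /a -ge0_integral_sum//; last 2 first.
- move=> j; apply: emeasurable_funM => //; apply/measurable_EFinP.
  exact: (measurableT_comp (measurable_powR p) (mg j)).
- by move=> j x _; rewrite mule_ge0// lee_fin powR_ge0.
pose F x : \bar R := ((grad_l1 u x `^ p)%:E * V' x)%E.
have mgu : measurable_fun setT (grad_l1 u) by exact: measurable_grad_l1.
have mF : measurable_fun setT F.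
  apply: emeasurable_funM => //; apply/measurable_EFinP.
  exact: (measurableT_comp (measurable_powR p) mgu).
apply: (@le_trans _ _ (\int[leb]_x F x)%E).
  apply: ge0_le_integral_ptw => x _.
    by apply: sume_ge0 => j _; rewrite mule_ge0// lee_fin powR_ge0.
  rewrite -ge0_sume_distrl; last by move=> j _; rewrite lee_fin powR_ge0.
  apply: lee_wpmul2r => //; rewrite sumEFin lee_fin.
  apply: (@le_trans _ _ (\sum_(j < N) grad_l1 u x `^ p *
      (layer_height j < `|u x| < 2 * layer_height j)%R%:R)).
    apply: ler_sum => j _; have := grad_l1_trunc K_gt0 u_lip x (h0 j).
    case: (_ < _ < _); rewrite ?mulr1 ?mulr0 => hh.
      by apply: ge0_ler_powR => //; rewrite ?nnegrE ?grad_l1_ge0// ltW.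
    have -> : grad_l1 (trunc u (layer_height j)) x = 0.
      by apply/eqP; rewrite eq_le hh grad_l1_ge0.
    by rewrite powR0// gt_eqF.
  by rewrite -mulr_sumr ler_piMr ?powR_ge0// sum_layer_indic.
have np0 : 0 < n%:R `^ p :> R by rewrite powR_gt0// ltr0n.
(* The integrand with the true maximal function may fail to be measurable, so the constant is taken
   out of the Borel integrand [F] before the comparison. *)
pose F2 x : \bar R := ((n%:R `^ p)^-1%:E * F x)%E.
have -> : (\int[leb]_x F x = (n%:R `^ p)%:E * \int[leb]_x F2 x)%E.
  have F0 x : setT x -> (0 <= F x)%E by move=> _; rewrite mule_ge0// lee_fin powR_ge0.
  have i0 : (0 <= ((n%:R `^ p)^-1)%:E :> \bar R)%E by rewrite lee_fin invr_ge0 ltW.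
  rewrite /F2 (ge0_integralZl _ measurableT mF F0 i0).
  by rewrite muleA -EFinM divff ?gt_eqF// mul1e.
apply: lee_wpmul2l; first by rewrite lee_fin ltW.
apply: ge0_le_integral_ptw => x _.
  by rewrite mule_ge0 ?lee_fin ?invr_ge0 ?(ltW np0)// mule_ge0// lee_fin powR_ge0.
rewrite /F2 /F muleA -EFinM; apply: lee_pmul => //.
- by rewrite lee_fin mulr_ge0 ?powR_ge0// invr_ge0 ltW.
- rewrite lee_fin ler_pdivrMl// ger0_norm ?sqrtr_ge0//.
  rewrite -powRM ?sqrtr_ge0// ?ler0n//; apply: ge0_ler_powR; rewrite ?(ltW p0)//.
  + by rewrite nnegrE grad_l1_ge0.
  + by rewrite nnegrE mulr_ge0 ?ler0n ?sqrtr_ge0.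
  + exact: grad_l1_euclidean.
- exact: dmaximal_le.
Qed.

End layers.

Section strong_type.
Context {R : realType} (n : nat).
Local Notation T := 'rV[R]_n.
Local Notation leb := (lebesgue_rV n).

Lemma Lip_c_bounds (u : T -> R) : Lip_c u -> exists K Rad S : R,
  [/\ 0 < K, 0 < Rad, 0 < S & [/\ forall x y, `|u x - u y| <= K * `|x - y|,
     forall x, u x != 0 -> `|x| <= Rad & forall x, `|u x| < S]].
Proof.
move=> [ul uc]; have [K K0 uK] := pinfty_ex_gt0 ul.
have uK' x y : `|u x - u y| <= K * `|x - y| by exact: (uK (x, y)).
have [Rad Rad0 hR] := pinfty_ex_gt0 (compact_bounded uc).
have uR x : u x != 0 -> `|x| <= Rad by move=> ux; apply: hR; exact: subset_closure.
have S0 : 0 < `|u 0| + K * Rad + 1 by rewrite ltr_wpDl// addr_ge0// mulr_ge0// ltW.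
exists K, Rad, (`|u 0| + K * Rad + 1); split=> //; split=> // x.
have [->|ux] := eqVneq (u x) 0; first by rewrite normr0.
rewrite (@le_lt_trans _ _ (`|u 0| + K * Rad))// ?ltrDl//.
have -> : u x = u 0 + (u x - u 0) by rewrite addrC subrK.
apply: le_trans (ler_normD _ _) _; rewrite lerD2l; apply: le_trans (uK' _ _) _.
by rewrite ler_pM2l// subr0; exact: uR.
Qed.

Lemma layer_fun_ge q S (u : T -> R) x : 0 < q -> 0 < S -> `|u x| < S -> u x != 0 ->
  exists j, forall N, (j < N)%N -> `|u x| `^ q <= layer_fun q S u N x.
Proof.
move=> q0 S0 uS ux; have ux0 : 0 < `|u x| by rewrite normr_gt0.
pose P j := S / 2 ^+ j.+1 <= `|u x|.
have exP : exists j, P j.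
  exists (Num.bound (S / `|u x|)); rewrite /P ler_pdivrMr ?exprn_gt0// mulrC -ler_pdivrMr//.
  apply: le_trans (ltW (archi_boundP _)) _; first by rewrite divr_ge0// ltW.
  by rewrite -natrX ler_nat ltnW// (ltn_trans (ltnSn _))// ltn_expl.
case: (ex_minnP exP) => j Pj minj; exists j => N jN.
have d0 (k : nat) : 2 ^+ k != 0 :> R by rewrite expf_neq0.
have h4 : `|u x| < 4 * layer_height S j.
  have -> : 4 * layer_height S j = S / 2 ^+ j.
    by rewrite /layer_height !exprS; field.
  case: j {Pj jN} minj => [|j] minj; first by rewrite expr0 divr1.
  by rewrite ltNge; apply/negP => /minj; rewrite ltnn.
have h2 : 2 * layer_height S j <= `|u x|.
  have -> // : 2 * layer_height S j = S / 2 ^+ j.+1.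
  by rewrite /layer_height !exprS; field.
rewrite /layer_fun (bigD1 (Ordinal jN))//= h2 h4 mulr1 ler_wpDr//.
  by rewrite sumr_ge0// => i _; rewrite mulr_ge0// powR_ge0.
apply: ge0_ler_powR; rewrite ?nnegrE ?(ltW q0)// ltW//.
by rewrite mulr_gt0// layer_height_gt0.
Qed.

(** The bound for finitely many layers and a bounded Borel weight is uniform in both; a single index
    [N] drives the number of layers and the truncation of the weight, and monotone convergence
    concludes. *)
Lemma strong_type (p q eps : R) (u w : T -> R) : (0 < n)%N -> 1 < p -> p <= q -> 0 < eps ->
  Lip_c u -> weight w ->
  (\int[leb]_x ((`|u x| `^ q)%:E * (w x)%:E) <=
   (4 `^ q * weak_cst n p q eps)%:E *
   ((n%:R `^ p)%:E * \int[leb]_x ((`|euclidean_norm (gradient u x)| `^ p)%:E *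
     orlicz_maximal (n%:R - q / p * (n%:R - p))
       (LlogL (q / (p / (p - 1)) + eps)) w x `^ (p / q))) `^ (q / p))%E.
Proof.
move=> n0 p1 pq eps0 /Lip_c_bounds[K [Rad [S [K0 Rad0 S0 [uK uR uS]]]]] [w0 [g mg wg] _].
have q0 : 0 < q by rewrite (lt_le_trans _ pq)// (lt_trans _ p1).
set X := (X in (_ <= X)%E).
(* Built from the Borel representative [g] of the weight, made nonnegative everywhere and cut at
   height [N]. *)
pose wN (N : nat) x := Num.min (Num.max (g x) 0) N%:R.
have mwN N : measurable_fun setT (wN N).
  by apply: measurable_minr => //; exact: measurable_maxr.
have wN0 N x : 0 <= wN N x by rewrite /wN le_min ler0n andbT le_max lexx orbT.
have wNN N x : wN N x <= N%:R by rewrite /wN ge_min lexx orbT.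
have wNw N : {ae leb, forall x, wN N x <= `|w x|}.
  apply: (@filterS _ _ (ae_filter_ringOfSetsType _)) wg => x /(_ I) gw.
  by rewrite /wN -gw ge_min ger0_norm// max_l// lexx.
have mu_ : measurable_fun setT u.
  exact: (continuous_measurable_rV (lipschitz_continuous_rV K0 uK)).
pose F N x : \bar R := (layer_fun q S u N x * wN N x)%:E.
have lay0 N x : 0 <= layer_fun q S u N x.
  by rewrite sumr_ge0// => j _; rewrite mulr_ge0// powR_ge0.
have F0 N x : (0 <= F N x)%E by rewrite lee_fin mulr_ge0.
have mF N : measurable_fun setT (F N).
  apply/measurable_EFinP; apply: measurable_funM => //.
  apply: measurable_sum => j; apply: measurable_funM => //.
  pose A := [set x | 2 * layer_height S j <= `|u x|] `&` [set x | `|u x| < 4 * layer_height S j].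
  have mnu : measurable_fun setT (fun x => `|u x|) by exact: measurableT_comp.
  have mA : measurable A.
    apply: measurableI; rewrite -[X in measurable X]setTI.
      exact: measurable_fun_ler.
    exact: measurable_fun_ltr.
  rewrite (_ : (fun _ => _) = \1_A); first exact: measurable_indic.
  apply/funext => x; rewrite indicE; congr (nat_of_bool _)%:R.
  by apply/idP/idP => [/andP[h1 h2]|]; [rewrite inE|rewrite inE => -[/= -> ->]].
have ndF x : {homo F ^~ x : N M / (N <= M)%N >-> (N <= M)%E}.
  move=> N M NM; rewrite lee_fin; apply: ler_pM => //.
    rewrite /layer_fun -!(big_mkord xpredT (fun j => (4 * layer_height S j) `^ q *
      (2 * layer_height S j <= `|u x| < 4 * layer_height S j)%R%:R)).
    rewrite [leRHS](big_cat_nat (leq0n N) NM)//= lerDl sumr_ge0// => j _.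
    by rewrite mulr_ge0// powR_ge0.
  by rewrite /wN; apply: le_min2; rewrite ?ler_nat.
have FX N : (\int[leb]_x F N x <= X)%E.
  exact: (@layer_integral _ n p q eps K N%:R Rad S u w (wN N) n0 p1 pq eps0 K0 uK Rad0 S0 uR
    (wN0 N) (wNN N) (mwN N) (wNw N) N).
have mgp : measurable_fun setT (fun x => Num.max (g x) 0) by exact: measurable_maxr.
have g0 x : 0 <= Num.max (g x) 0 by rewrite le_max lexx orbT.
apply: (@le_trans _ _ (\int[leb]_x ((`|u x| `^ q)%:E * (Num.max (g x) 0)%:E))%E).
  apply: ge0_ae_le_integral_measurabler => //.
  - by move=> x _; rewrite -EFinM lee_fin mulr_ge0// powR_ge0.
  - by move=> x _; rewrite -EFinM lee_fin mulr_ge0// powR_ge0.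
  - apply: emeasurable_funM; apply/measurable_EFinP => //.
    apply: (measurableT_comp (measurable_powR q)); exact: measurableT_comp.
  apply: (@filterS _ _ (ae_filter_ringOfSetsType _)) wg => x /(_ I) gw _.
  by rewrite -gw max_l.
apply: (@le_trans _ _ (\int[leb]_x (limn (F ^~ x)))%E).
  apply: ge0_le_integral_ptw => x _.
    by rewrite -EFinM lee_fin mulr_ge0// powR_ge0.
  rewrite (cvg_lim _ (ereal_nondecreasing_cvgn (ndF x)))//.
  have [ux|ux] := eqVneq (u x) 0.
    rewrite ux normr0 powR0 ?gt_eqF// mul0e.
    by apply: le_trans (F0 0 x) _; apply: ereal_sup_ubound; exists 0%N.
  have [j hj] := layer_fun_ge q0 S0 (uS x) ux.
  (* Large enough for the layer of [u x] to be counted and for the cut of the weight at [x] to be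
     inactive. *)
  pose N := maxn j.+1 (Num.bound (Num.max (g x) 0)).
  apply: (@le_trans _ _ (F N x)); last by apply: ereal_sup_ubound; exists N.
  rewrite -EFinM lee_fin; apply: ler_pM => //.
    by apply: hj; rewrite /N leq_max ltnSn.
  rewrite /wN le_min lexx/=; apply: (le_trans (ltW (archi_boundP (g0 x)))).
  by rewrite ler_nat /N leq_max leqnn orbT.
rewrite monotone_convergence//.
apply: lime_le.
  apply: ereal_nondecreasing_is_cvgn => N M NM; apply: ge0_le_integral => // x _.
  exact: ndF.
by near=> N; exact: FX.
Unshelve. all: by end_near. Qed.

Lemma sobolev_weighted (p q eps : R) : (0 < n)%N -> 1 < p -> p <= q -> 0 < eps ->
  exists C : R, forall w : T -> R, weight w -> forall u : T -> R, Lip_c u ->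
    sobolev_inequality p q (n%:R - q / p * (n%:R - p))
      (LlogL (q / conjugate_exponent p + eps)) C w u.
Proof.
move=> n0 p1 pq eps0; have p0 : 0 < p by exact: lt_trans p1.
have q0 : 0 < q by exact: lt_le_trans pq.
exists ((4 `^ q * weak_cst n p q eps) `^ q^-1 * n%:R) => w ww u uL.
have := strong_type n0 p1 pq eps0 uL ww; rewrite /sobolev_inequality /weighted_Lnorm.
set J := (\int[leb]_x (_ * orlicz_maximal _ _ _ _ `^ _))%E => h.
have J0 : (0 <= J)%E.
  by apply: integral_ge0 => x _; rewrite mule_ge0 ?poweR_ge0// lee_fin powR_ge0.
have W0 : 0 <= 4 `^ q * weak_cst n p q eps.
  by rewrite mulr_ge0 ?powR_ge0// ltW// weak_cst_gt0.
have I0 : (0 <= \int[leb]_x ((`|u x| `^ q)%:E * (EFin \o w) x))%E.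
  by apply: integral_ge0 => x _; case: ww => w0 _ _; rewrite -EFinM lee_fin mulr_ge0// powR_ge0.
have qi : 0 <= q^-1 by rewrite invr_ge0 ltW.
apply: le_trans (le_poweR qi I0 h) _.
rewrite poweRM ?poweR_ge0// ?lee_fin//.
rewrite -poweRrM (_ : q / p * q^-1 = p^-1); last by field; rewrite !gt_eqF.
rewrite poweRM ?lee_fin ?powR_ge0// !poweR_EFin -powRrM divff ?gt_eqF// powRr1//.
by rewrite EFinM -muleA.
Qed.

End strong_type.

(** * Failure for eps = 0 *)

Section unit_cube_maximal.
Context {R : realType} (n : nat).
Local Notation T := 'rV[R]_n.
Local Notation leb := (lebesgue_rV n).
Variables (kap gam : R).
Hypothesis n_gt0 : (0 < n)%N.
Hypothesis kap_gt0 : 0 < kap.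
Hypothesis gam_gt0 : 0 < gam.

Definition unit_cube_weight : T -> R := \1_(cube (0 : T) 1).
Local Notation w := unit_cube_weight.

Lemma weight_unit_cube : weight w.
Proof.
have mw : measurable_fun setT w.
  by apply: measurable_indic; exact: measurable_cube.
split=> [x| |Z _]; first by rewrite /w indicE ler0n.
- by exists w => //; exact: ae_eq_refl.
- apply: (@le_lt_trans _ _ (\int[leb]_x (w x)%:E)%E).
    rewrite integral_mkcond; apply: ge0_le_integral_ptw => x _.
      by apply: erestrict_ge0 => y _; rewrite lee_fin /w indicE ler0n.
    by rewrite patchE; case: ifP => _; rewrite ?lexx// lee_fin /w indicE ler0n.
  rewrite integral_indic// ?setIT; last exact: measurable_cube.
  by rewrite -[X in (X < _)%E]/(leb (cube (0 : T) 1)) lebesgue_rV_cube// ltry.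
Qed.

(** The bound is an admissible [lam]: its logarithmic factor is at least 1, so [1 / lam <= l^n] and
    that factor also absorbs the logarithm of [1 / lam], whence the Young function at [1 / lam] is
    at most [l^n]. *)
Lemma orlicz_average_unit_cube (a : T) l : 0 < l ->
  (orlicz_average (LlogL gam) w (cube a l) <=
   ((l ^+ n)^-1 * ln (expR 1 + l ^+ n) `^ gam)%:E)%E.
Proof.
move=> l0; have ln0 : 0 < l ^+ n by exact: exprn_gt0.
have L1 := ln_e_ge1 (ltW ln0).
set Lg := ln _ `^ gam.
have Lg1 : 1 <= Lg.
  by rewrite /Lg -[leLHS](powRr0 (ln (expR 1 + l ^+ n))) ler_powR// ltW.
have Lg0 : 0 < Lg by exact: lt_le_trans Lg1.
apply: ereal_inf_lbound; exists ((l ^+ n)^-1 * Lg) => //; split.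
  by rewrite mulr_gt0// invr_gt0.
set lam := _ * _; have lam0 : 0 < lam by rewrite mulr_gt0// invr_gt0.
have cE := lebesgue_rV_cube a l0; rewrite cE [fine _]/=.
have Th : LlogL gam lam^-1 <= l ^+ n.
  have lamE : lam^-1 = l ^+ n / Lg by rewrite /lam invfM invrK.
  rewrite /LlogL {1}lamE -mulrA ler_piMr ?(ltW ln0)// mulrC ler_pdivrMr// mul1r.
  have e0 (z : R) : 0 <= z -> 0 <= ln (expR 1 + z) by move=> z0; exact: le_trans ler01 (ln_e_ge1 z0).
  have li0 : 0 <= lam^-1 by rewrite invr_ge0 ltW.
  apply: ge0_ler_powR; [exact: ltW|by rewrite nnegrE e0|by rewrite nnegrE e0// ltW|].
  rewrite ler_ln ?posrE ?ltr_wpDr ?expR_gt0 ?li0 ?(ltW ln0)//.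
  by rewrite lerD2l lamE ler_pdivrMr// ler_peMr// ltW.
have T0 : 0 <= LlogL gam lam^-1 by rewrite LlogL_ge0// invr_ge0 ltW.
apply: (@le_trans _ _ (((l ^+ n)^-1)%:E * ((LlogL gam lam^-1)%:E * leb (cube (0 : T) 1)))%E).
  apply: lee_wpmul2l; first by rewrite lee_fin invr_ge0 ltW.
  rewrite -integral_cst; last exact: measurable_cube.
  rewrite [leLHS]integral_mkcond [leRHS]integral_mkcond; apply: ge0_le_integral_ptw => x _.
    by apply: erestrict_ge0 => y _; rewrite lee_fin LlogL_ge0// divr_ge0// ltW.
  rewrite !patchE /w indicE; case: (x \in cube a l); case: (boolP (x \in cube 0 1)) => hx /=.
  - by rewrite normr1 div1r.
  - by rewrite normr0 mul0r /LlogL mul0r.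
  - by rewrite lee_fin.
  - by [].
have -> : leb (cube (0 : T) 1) = 1%E by rewrite lebesgue_rV_cube// expr1n.
by rewrite mule1 -EFinM lee_fin mulrC ler_pdivrMr// mul1r.
Qed.

Lemma orlicz_average_disjoint (a : T) l : cube a l `&` cube 0 1 = set0 ->
  (orlicz_average (LlogL gam) w (cube a l) <= 0)%E.
Proof.
move=> d; apply/lee_addgt0Pr => e e0; rewrite add0e.
apply: ereal_inf_lbound; exists e => //; split=> //.
rewrite integral0_eq ?mule0// => x hx; rewrite /w indicE memNset ?normr0 ?mul0r /LlogL ?mul0r//.
by move=> h1; have : (cube a l `&` cube 0 1) x by []; rewrite d.
Qed.

Definition unit_cube_cst : R :=
  2 `^ kap * (2 `^ gam * (n.+1%:R `^ gam + (n%:R * gam / kap) `^ gam)).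

Lemma powR_log_le m l : (0 < m)%N -> 2 ^+ m / 2 <= l ->
  l `^ (- kap) * ln (expR 1 + l ^+ n) `^ gam <=
  unit_cube_cst * (2 ^+ m) `^ (- kap) * m%:R `^ gam.
Proof.
move=> m0; set L := 2 ^+ m / 2 => Ll.
have L1 : 1 <= L.
  by rewrite /L ler_pdivlMr// mul1r; case: m m0 @L Ll => // m _ _ _; rewrite exprS ler_peMr// exprn_ege1// ler1n.
have L0 : 0 < L by exact: lt_le_trans L1.
have l0 : 0 < l by exact: lt_le_trans Ll.
pose r := l / L; have r1 : 1 <= r by rewrite ler_pdivlMr// mul1r.
have r0 : 0 < r by exact: lt_le_trans r1.
have lE : l = L * r by rewrite /r mulrC divfK// gt_eqF.
have m1 : 1 <= m%:R :> R by rewrite ler1n.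
have mg1 : 1 <= m%:R `^ gam :> R.
  by rewrite -[leLHS](powRr0 m%:R) ler_powR// ltW.
have lnr0 : 0 <= ln r by exact: ln_ge0.
have A1 : ln (expR 1 + L ^+ n) <= n.+1%:R * m%:R.
  apply: (@le_trans _ _ (ln (expR 1 * 2 ^+ (m * n)))).
    rewrite ler_ln ?posrE ?mulr_gt0 ?expR_gt0 ?exprn_gt0 ?ltr_wpDr ?expR_gt0 ?exprn_ge0 ?(ltW L0)//.
    have e1 : 1 <= expR 1 :> R by rewrite -[leLHS]expR0 ler_expR.
    have Ln1 : 1 <= L ^+ n by rewrite exprn_ege1.
    have Lmn : 2 * L ^+ n <= 2 ^+ (m * n).
      rewrite /L expr_div_n -exprM mulrA ler_pdivrMr ?exprn_gt0// mulrC ler_wpM2l ?exprn_ge0//.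
      by rewrite -{1}(expr1 2) ler_weXn2l ?ler1n.
    apply: (@le_trans _ _ (expR 1 * (2 * L ^+ n))); last by rewrite ler_wpM2l// expR_ge0.
    nra.
  rewrite lnM ?posrE ?expR_gt0 ?exprn_gt0// expRK lnXn//.
  have ln2 : ln (2 : R) <= 1.
    by have := @le_ln1Dx R 1; rewrite -(natrD _ 1 1); apply; rewrite (@lt_trans _ _ 0)// ltrN10.
  rewrite -[ln 2 *+ _]mulr_natl natrM; have n0 : 0 <= n%:R :> R by [].
  have : m%:R * n%:R * ln 2 <= m%:R * n%:R :> R by rewrite ler_piMr// mulr_ge0.
  rewrite -natr1; lra.
have B1 : ln (expR 1 + l ^+ n) <= ln (expR 1 + L ^+ n) + n%:R * ln r.
  rewrite mulr_natl -lnXn// -lnM ?posrE ?exprn_gt0 ?ltr_wpDr ?expR_gt0 ?exprn_ge0 ?(ltW L0)//.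
  rewrite ler_ln ?posrE ?mulr_gt0 ?exprn_gt0 ?ltr_wpDr ?expR_gt0 ?exprn_ge0 ?(ltW L0) ?(ltW l0)//.
  rewrite lE exprMn mulrDl lerD2r ler_peMr ?expR_ge0// exprn_ege1//.
have B2 : (n%:R * ln r) `^ gam <= (n%:R * gam / kap) `^ gam * r `^ kap.
  have rk1 : 1 <= r `^ kap by rewrite -[leLHS](powRr0 r) ler_powR// ltW.
  have := ln_powR_le gam_gt0 rk1; rewrite ln_powR.
  have -> : n%:R * ln r = n%:R / kap * (kap * ln r).
    by field; rewrite gt_eqF.
  have nk : 0 <= n%:R / kap by rewrite divr_ge0// ltW.
  have kl : 0 <= kap * ln r by rewrite mulr_ge0// ltW.
  move=> h; rewrite (powRM _ nk kl) (_ : n%:R * gam / kap = n%:R / kap * gam); last by ring.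
  by rewrite (powRM _ nk (ltW gam_gt0)) -mulrA ler_wpM2l ?powR_ge0.
have e0 (z : R) : 0 <= z -> 0 <= ln (expR 1 + z) by move=> z0; exact: le_trans ler01 (ln_e_ge1 z0).
have Bt : ln (expR 1 + l ^+ n) `^ gam <=
    2 `^ gam * ((n.+1%:R * m%:R) `^ gam + (n%:R * gam / kap) `^ gam * r `^ kap).
  apply: (@le_trans _ _ ((n.+1%:R * m%:R + n%:R * ln r) `^ gam)).
    apply: ge0_ler_powR; rewrite ?nnegrE ?(ltW gam_gt0) ?e0 ?exprn_ge0 ?(ltW l0)//.
      by rewrite addr_ge0// mulr_ge0.
    by apply: le_trans B1 _; rewrite lerD2r.
  apply: le_trans (powRD_le _ _ _) _; rewrite ?(ltW gam_gt0) ?mulr_ge0//.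
  by rewrite ler_wpM2l ?powR_ge0// lerD2l.
apply: (@le_trans _ _ (l `^ (- kap) * (2 `^ gam * (m%:R `^ gam * r `^ kap *
    (n.+1%:R `^ gam + (n%:R * gam / kap) `^ gam))))).
  rewrite ler_wpM2l ?powR_ge0//; apply: (le_trans Bt); rewrite ler_wpM2l ?powR_ge0//.
  rewrite powRM// mulrDr; apply: lerD.
    rewrite [leRHS]mulrAC [_ * n.+1%:R `^ gam]mulrC ler_peMr ?mulr_ge0 ?powR_ge0//.
    by rewrite -[leLHS](powRr0 r) ler_powR// ltW.
  rewrite [leRHS]mulrC; apply: ler_wpM2l; first exact: powR_ge0.
  by rewrite ler_peMl// powR_ge0.
have -> : l `^ (- kap) = (2 `^ kap * (2 ^+ m) `^ (- kap)) * (r `^ kap)^-1.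
  rewrite lE powRM ?(ltW L0) ?(ltW r0)// [r `^ _]powRN; congr (_ * _).
  rewrite /L powRM ?exprn_ge0// mulrC; congr (_ * _).
  by rewrite powRN -powRN -powR_inv1// -powRrM mulN1r opprK.
have rk : r `^ kap != 0 by rewrite gt_eqF// powR_gt0.
apply: ler_eq; rewrite /unit_cube_cst; by field.
Qed.

(** A cube through [x] that misses the unit cube has zero average. One that meets it has side at
    least [|x| - 1], hence at least [2 ^+ m / 2]. *)
Lemma orlicz_maximal_unit_cube m (x : T) : (0 < m)%N -> 2 ^+ m <= `|x| ->
  (orlicz_maximal (n%:R - kap) (LlogL gam) w x <=
   (unit_cube_cst * (2 ^+ m) `^ (- kap) * m%:R `^ gam)%:E)%E.
Proof.
move=> m0 xm; have C0 : 0 <= unit_cube_cst.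
  by rewrite !mulr_ge0 ?addr_ge0 ?powR_ge0.
apply: ge_ereal_sup => _ [a [l [l0 xQ ->]]].
have [d|/set0P[y [yQ y1]]] := eqVneq (cube a l `&` cube 0 1) set0.
  have -> : orlicz_average (LlogL gam) w (cube a l) = 0%E.
    by apply/eqP; rewrite eq_le orlicz_average_disjoint// orlicz_average_ge0.
  by rewrite mule0 lee_fin mulr_ge0 ?powR_ge0// mulr_ge0 ?powR_ge0.
have lm : 2 ^+ m / 2 <= l.
  have : `|x| <= l + 1.
    rewrite /Num.Def.normr/= mx_normrE; apply: bigmax_le => [|[i c] _ /=].
      by rewrite addr_ge0// ltW.
    rewrite (ord1 i); have := xQ c; have := yQ c; have := y1 c; rewrite !mxE.
    move=> /andP[h1 h2] /andP[h3 h4] /andP[h5 h6]; rewrite ler_norml; apply/andP; split; lra.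
  have : 2 <= 2 ^+ m :> R by rewrite -{1}(expr1 2) ler_weXn2l ?ler1n.
  lra.
apply: (@le_trans _ _ ((l `^ (n%:R - kap))%:E * ((l ^+ n)^-1 * ln (expR 1 + l ^+ n) `^ gam)%:E)%E).
  apply: lee_wpmul2l; first by rewrite lee_fin powR_ge0.
  exact: orlicz_average_unit_cube.
rewrite -EFinM lee_fin; apply: le_trans (powR_log_le m0 lm); apply: ler_eq.
rewrite mulrA; congr (_ * _); rewrite powRD ?(gt_eqF l0) ?implybT// powR_mulrn ?(ltW l0)//.
by rewrite mulrAC divff ?mul1r// gt_eqF// exprn_gt0.
Qed.

End unit_cube_maximal.

(** * The test functions *)

Section log_bump.
Context {R : realType} (n : nat).
Local Notation T := 'rV[R]_n.
Local Notation leb := (lebesgue_rV n).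
Implicit Types (x y : T) (k m N j : nat).

(* This is [2 - `|x| / 2 ^+ k] clamped to the interval [0, 1]. *)
Definition bump k x : R := 1 - trunc (fun z : T => `|z|) (2 ^+ k) x / 2 ^+ k.

Let e2 k : 0 < 2 ^+ k :> R. Proof. exact: exprn_gt0. Qed.

Lemma bump_eq1 k x : `|x| <= 2 ^+ k -> bump k x = 1.
Proof. by move=> h; rewrite /bump trunc_eq0 ?normr_id ?(ltW (e2 k))// mul0r subr0. Qed.

Lemma bump_eq0 k x : 2 ^+ k.+1 <= `|x| -> bump k x = 0.
Proof.
move=> h; rewrite /bump (_ : trunc _ _ _ = 2 ^+ k); first by rewrite divff ?gt_eqF// subrr.
by apply/eqP; rewrite eq_le trunc_le trunc_geE// normr_id -exprS.
Qed.

Lemma bump_lip k x y : `|bump k x - bump k y| <= (2 ^+ k)^-1 * `|x - y|.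
Proof.
rewrite /bump opprB addrC addrA subrK -mulrBl normrM normfV (gtr0_norm (e2 k)) mulrC.
rewrite ler_pM2l ?invr_gt0// distrC -[leRHS]mul1r.
by apply: (@trunc_lip _ _ (fun z : T => `|z|) 1) => a b; rewrite mul1r ler_dist_dist.
Qed.

Definition log_bump N x : R := \sum_(j < N) j.+1%:R^-1 * bump j.+1 x.

Definition harmonic_sum N : R := \sum_(j < N) j.+1%:R^-1.

Lemma log_bump_inner N x : `|x| <= 2 -> log_bump N x = harmonic_sum N.
Proof.
move=> h; apply: eq_bigr => j _; rewrite bump_eq1 ?mulr1//; apply: (le_trans h).
by rewrite -[leLHS]expr1 ler_weXn2l ?ler1n.
Qed.

Lemma log_bump_outer N x : 2 ^+ N.+1 <= `|x| -> log_bump N x = 0.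
Proof.
move=> h; rewrite /log_bump big1// => j _; rewrite bump_eq0 ?mulr0//; apply: le_trans h.
by rewrite ler_weXn2l ?ler1n// !ltnS.
Qed.

Lemma log_bump_dist N x y :
  `|log_bump N x - log_bump N y| <= \sum_(j < N) j.+1%:R^-1 * `|bump j.+1 x - bump j.+1 y|.
Proof.
rewrite /log_bump -sumrB; apply: le_trans (ler_norm_sum _ _ _) _; apply: ler_sum => j _.
by rewrite -mulrBr normrM ger0_norm// invr_ge0.
Qed.

Lemma log_bump_lip N x y : `|log_bump N x - log_bump N y| <= N.+1%:R * `|x - y|.
Proof.
apply: le_trans (log_bump_dist _ _ _) _.
apply: (@le_trans _ _ (\sum_(j < N) `|x - y|)); last first.
  by rewrite sumr_const card_ord -[leLHS]mulr_natl ler_wpM2r// ler_nat.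
apply: ler_sum => j _; rewrite -[leRHS]mul1r; apply: ler_pM => //.
- by rewrite invf_le1// ler1n.
- apply: le_trans (bump_lip _ _ _) _; rewrite -[leRHS]mul1r ler_wpM2r// invf_le1//.
  by rewrite exprn_ege1// ler1n.
Qed.

Lemma Lip_c_log_bump N : Lip_c (log_bump N).
Proof.
split.
  exists N.+1%:R; split; first exact: num_real.
  move=> M NM [x y] _ /=; apply: le_trans (log_bump_lip N x y) _.
  by rewrite ler_wpM2r// ltW.
pose r : R := 2 ^+ N.+1.
have sub : closure [set x | log_bump N x != 0] `<=` [set x : T | `|x| <= r].
  rewrite [X in _ `<=` X](closure_id _).1.
    apply: closureS => x /= /negP h; rewrite leNgt; apply/negP => h'; apply: h.
    by rewrite log_bump_outer// ltW.
  apply: (@closed_comp _ _ (fun x : T => `|x|) [set t | t <= r]); last exact: closed_le.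
  by move=> x _; exact: norm_continuous.
apply: bounded_closed_compact; last exact: closed_closure.
exists r; split; first exact: num_real.
by move=> M rM x /sub /= h; apply: le_trans h (ltW rM).
Qed.

Lemma sum_nat_eq_le1 N k : \sum_(j < N) ((j : nat) == k)%:R <= 1 :> R.
Proof.
have -> : \sum_(j < N) ((j : nat) == k)%:R = (k < N)%:R :> R.
  elim: N => [|N IH]; first by rewrite big_ord0.
  by rewrite big_ord_recr/= IH ltnS; case: (ltngtP k N) => _; rewrite ?add0r ?addr0.
by case: (k < N)%N.
Qed.

(** In the annulus of index [m] at most two bumps matter, each with slope at most [4 / (m * 2^m)];
    beyond index [N + 1] all bumps vanish. *)
Definition bump_slope N m : R := if (m <= N.+1)%N then 8 / (m%:R * 2 ^+ m) else 0.

Lemma bump_slope_ge0 N m : 0 <= bump_slope N m.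
Proof. by rewrite /bump_slope; case: ifP => // _; rewrite divr_ge0// mulr_ge0// ltW. Qed.

(** The point [y] may lie below the annulus of [x], because at the inner boundary the derivative
    needs a full neighbourhood. On this range only the bumps of index [m] and [m - 1] fail to be
    constant. *)
Lemma log_bump_annulus N m x y : (0 < m)%N -> 2 ^+ m <= `|x| < 2 ^+ m.+1 ->
  2 ^+ m <= 2 * `|y| -> `|y| <= 2 ^+ m.+1 ->
  `|log_bump N y - log_bump N x| <= bump_slope N m * `|y - x|.
Proof.
move=> m0 /andP[x1 x2] y1 y2; apply: le_trans (log_bump_dist _ _ _) _.
pose A : R := 4 / (m%:R * 2 ^+ m).
have mR : 1 <= m%:R :> R by rewrite ler1n.
have A0 : 0 <= A by rewrite divr_ge0// mulr_ge0// ltW.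
(* The factor [(1 < m)] discards the second index when [m = 1], where [m.-2] would wrongly repeat
   [m.-1]. *)
have term j : j.+1%:R^-1 * `|bump j.+1 y - bump j.+1 x| <=
    A * `|y - x| * ((j == m.-1)%:R + (j == m.-2)%:R * (1 < m)%N%:R).
  have R0 (b : bool) (c : R) : 0 <= c -> 0 <= A * `|y - x| * (b%:R + c).
    by move=> c0; rewrite mulr_ge0 ?mulr_ge0// addr_ge0.
  have [h|h] := leqP m.+1 j.+1.
    rewrite !bump_eq1 ?subrr ?normr0 ?mulr0 ?R0 ?mulr_ge0//.
      by apply: le_trans (ltW x2) _; rewrite ler_weXn2l ?ler1n.
    by apply: le_trans y2 _; rewrite ler_weXn2l ?ler1n.
  have [h'|h'] := ltnP j.+2 m.
    rewrite !bump_eq0 ?subrr ?normr0 ?mulr0 ?R0 ?mulr_ge0//.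
      by apply: le_trans x1; rewrite ler_weXn2l ?ler1n// ltnW.
    rewrite -(ler_pM2l (_ : 0 < 2))// -exprS; apply: le_trans y1.
    by rewrite ler_weXn2l ?ler1n.
  have b := bump_lip j.+1 y x.
  have jle : j.+1%:R^-1 * (2 ^+ j.+1)^-1 <= A.
    have : j.+1 = m \/ j.+2 = m by move: h h'; clear; case: ltngtP; lia.
    case=> e; rewrite /A -e.
      rewrite -invfM ler_peMl ?ler1n// invr_ge0 mulr_ge0// ltW//.
    rewrite (_ : 4 / _ = 2 / j.+2%:R * (2 ^+ j.+1)^-1); last first.
      by rewrite [2 ^+ j.+2]exprS; field; rewrite ?gt_eqF// ltr_wpDl.
    rewrite ler_pM2r ?invr_gt0//.
    rewrite ler_pdivlMr// mulrC ler_pdivrMr//.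
    by rewrite -natrM ler_nat; lia.
  apply: (@le_trans _ _ (A * `|y - x|)).
    apply: (@le_trans _ _ (j.+1%:R^-1 * ((2 ^+ j.+1)^-1 * `|y - x|))).
      by rewrite ler_wpM2l.
    by rewrite mulrA ler_wpM2r.
  rewrite ler_peMr ?mulr_ge0//.
  have : (j == m.-1) || ((j == m.-2) && (1 < m)%N) by move: h h'; clear; lia.
  by case: (j == m.-1) => /=; [rewrite lerDl ?mulr_ge0|move=> /andP[-> ->]; rewrite mulr1 add0r].
apply: (@le_trans _ _ (\sum_(j < N) A * `|y - x| *
    (((j : nat) == m.-1)%:R + ((j : nat) == m.-2)%:R * (1 < m)%N%:R))).
  by apply: ler_sum => j _; exact: term.
rewrite -mulr_sumr /bump_slope; case: (leqP m N.+1) => [mN|Nm].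
  rewrite [leRHS](_ : _ = A * `|y - x| * 2); last first.
    rewrite /A; move: (_^-1) `|_| => a b; ring.
  rewrite ler_wpM2l ?mulr_ge0// big_split/= -mulr_suml (_ : 2 = 1 + 1)//.
  apply: lerD; first exact: sum_nat_eq_le1.
  by rewrite -[leRHS]mulr1; apply: ler_pM; rewrite ?sumr_ge0 ?sum_nat_eq_le1//; case: (1 < m)%N.
rewrite mul0r big1 ?mulr0// => j _; have := ltn_ord j.
have [/eqP e|_] := boolP (_ == _); first by move: e; clear -Nm m0; lia.
have [/eqP e|_] := boolP (_ == _); first by move: e; clear -Nm m0; lia.
by rewrite mul0r addr0.
Qed.

Lemma euclidean_norm_gradient_le (u : T -> R) x L : 0 <= L ->
  (forall c, `|pderive u c x| <= L) -> euclidean_norm (gradient u x) <= n%:R * L.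
Proof.
move=> L0 h; rewrite /euclidean_norm -[leRHS]ger0_norm ?mulr_ge0// -sqrtr_sqr ler_wsqrtr//.
apply: (@le_trans _ _ (\sum_(c < n) L ^+ 2)).
  apply: ler_sum => c _; rewrite mxE -real_normK ?num_real// lerXn2r ?nnegrE//.
  exact: h.
rewrite sumr_const card_ord -[leLHS]mulr_natl exprMn ler_wpM2r ?sqr_ge0//.
by rewrite -natrX ler_nat; case: (n) => // k; rewrite expnS leq_pmulr// expn1.
Qed.

Lemma gradient_log_bump N m x : (0 < m)%N -> 2 ^+ m <= `|x| < 2 ^+ m.+1 ->
  euclidean_norm (gradient (log_bump N) x) <= n%:R * bump_slope N m.
Proof.
move=> m0 hx; apply: euclidean_norm_gradient_le; first exact: bump_slope_ge0.
move=> c; apply: pderive_local_lip; first exact: bump_slope_ge0.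
have /andP[x1 x2] := hx.
have nc := @norm_continuous _ _ x.
have a1 : \forall y \near x, 2 ^+ m < 2 * `|y|.
  have h : 2 ^+ m / 2 < `|x| by apply: lt_le_trans x1; rewrite ltr_pdivrMr// ltr_pMr// ltr1n.
  have h2 : \forall y \near x, 2 ^+ m / 2 < `|y| by apply: (cvgr_gt _ nc).
  apply: filterS h2 => y hy.
  by rewrite mulrC -ltr_pdivrMr.
have a2 : \forall y \near x, `|y| < 2 ^+ m.+1 by apply: (cvgr_lt _ nc).
near=> y; apply: log_bump_annulus => //; apply: ltW; near: y; [exact: a1|exact: a2].
Unshelve. all: by end_near. Qed.

Lemma gradient_log_bump_inner N x : `|x| < 2 ->
  euclidean_norm (gradient (log_bump N) x) = 0.
Proof.
move=> x2; apply/eqP; rewrite eq_le sqrtr_ge0 andbT -(mulr0 n%:R).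
apply: euclidean_norm_gradient_le => // c; apply: pderive_local_lip => //.
have nc := @norm_continuous _ _ x.
have a2 : \forall y \near x, `|y| < 2 by apply: (cvgr_lt _ nc).
apply: filterS a2 => y hy; rewrite !log_bump_inner ?subrr ?normr0 ?mul0r// ltW//.
Qed.

End log_bump.

(** * The test functions against the indicator weight *)

Section failure.
Context {R : realType} (n : nat).
Local Notation T := 'rV[R]_n.
Local Notation leb := (lebesgue_rV n).
Variables p q : R.
Hypothesis p_gt1 : 1 < p.
Hypothesis p_lt_n : p < n%:R.
Hypothesis p_le_q : p <= q.
Let gam := q / (p / (p - 1)).
Let kap := q / p * (n%:R - p).
Let p0 : 0 < p. Proof. exact: lt_trans p_gt1. Qed.
Let q0 : 0 < q. Proof. exact: lt_le_trans p_le_q. Qed.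
Let n0 : (0 < n)%N. Proof. by rewrite -(ltr0n R); exact: lt_trans p_lt_n. Qed.
Let gam0 : 0 < gam. Proof. by rewrite !divr_gt0// subr_gt0. Qed.
Let kap0 : 0 < kap. Proof. by rewrite mulr_gt0 ?divr_gt0// subr_gt0. Qed.
Let w : T -> R := @unit_cube_weight R n.
Let V := orlicz_maximal (n%:R - kap) (LlogL gam) w.
Let D := unit_cube_cst n kap gam `^ (p / q).

(** The power [p / q] turns the decay exponent [kap] into [n - p] and the logarithmic exponent [gam]
    into [p - 1]. *)
Lemma unit_cube_weight_powR m (x : T) : (0 < m)%N -> 2 ^+ m <= `|x| ->
  (V x `^ (p / q) <= (D * (2 ^+ m) `^ (- (n%:R - p)) * m%:R `^ (p - 1))%:E)%E.
Proof.
move=> m0 xm; have C0 : 0 <= unit_cube_cst n kap gam by rewrite !mulr_ge0 ?addr_ge0 ?powR_ge0.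
have pq0 : 0 <= p / q by rewrite divr_ge0 ?ltW.
have V0 : (0 <= V x)%E.
  apply: (@le_trans _ _ ((1 `^ (n%:R - kap))%:E * orlicz_average (LlogL gam) w (cube x 1))%E).
    by rewrite mule_ge0 ?orlicz_average_ge0// lee_fin powR_ge0.
  apply: ereal_sup_ubound; exists x, 1; split=> // c.
  by rewrite lexx/= lerDl.
apply: le_trans (le_poweR pq0 V0 (orlicz_maximal_unit_cube n0 kap0 gam0 m0 xm)) _.
have C1 : 0 <= unit_cube_cst n kap gam * (2 ^+ m) `^ (- kap) by rewrite mulr_ge0 ?powR_ge0.
rewrite poweR_EFin lee_fin (powRM _ C1 (powR_ge0 _ _)) (powRM _ C0 (powR_ge0 _ _)) -!powRrM.
apply: ler_eq; congr (_ * _ `^ _ * _ `^ _).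
  by rewrite /kap; field; rewrite !gt_eqF.
by rewrite /gam; field; rewrite !gt_eqF// subr_gt0.
Qed.

Definition energy_cst : R := 4 ^+ n * (n%:R * 8) `^ p * D.

(** The exact balance at [eps = 0]: the exponents of [2^m] are [-p], [-(n-p)] and [n], which cancel,
    and those of [m] are [-p] and [p-1], which leave [1/m]. *)
Lemma annulus_energy m : (0 < m)%N ->
  (n%:R * (8 / (m%:R * 2 ^+ m))) `^ p * (D * (2 ^+ m) `^ (- (n%:R - p)) * m%:R `^ (p - 1)) *
  (4 * 2 ^+ m) ^+ n = energy_cst * m%:R^-1.
Proof.
move=> m0; have mR : 0 < m%:R :> R by rewrite ltr0n.
have : 0 < 2 ^+ m :> R by exact: exprn_gt0.
move: (2 ^+ m) => a a0.
have -> : n%:R * (8 / (m%:R * a)) = n%:R * 8 * (m%:R^-1 * a^-1) by rewrite invfM mulrA.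
rewrite powRM ?mulr_ge0 ?invr_ge0 ?(ltW a0)// [(m%:R^-1 * _) `^ p]powRM ?invr_ge0 ?(ltW a0)//.
have -> : m%:R^-1 `^ p = (m%:R `^ (p - 1))^-1 * m%:R^-1 :> R.
  rewrite -!powR_inv1 ?powR_ge0// -!powRrM -powRD; last by rewrite (gt_eqF mR) implybT.
  by congr (_ `^ _); ring.
have -> : a^-1 `^ p = a `^ (n%:R - p) / a ^+ n.
  rewrite -powR_mulrn ?(ltW a0)// -!powR_inv1 ?powR_ge0 ?(ltW a0)// -!powRrM -powRD; last first.
    by rewrite (gt_eqF a0) implybT.
  by congr (_ `^ _); ring.
rewrite powRN exprMn /energy_cst.
have h1 : m%:R `^ (p - 1) != 0 :> R by rewrite gt_eqF// powR_gt0.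
have h2 : a `^ (n%:R - p) != 0 by rewrite gt_eqF// powR_gt0.
have h3 : a ^+ n != 0 by rewrite gt_eqF// exprn_gt0.
move: (m%:R `^ (p - 1)) (a `^ (n%:R - p)) (a ^+ n) (4 ^+ n) ((n%:R * 8) `^ p) h1 h2 h3 => b c d e f h1 h2 h3.
by field; rewrite h1 h2 h3 gt_eqF.
Qed.

Lemma log_bump_energy N :
  (\int[leb]_x ((`|euclidean_norm (gradient (log_bump N) x)| `^ p)%:E * V x `^ (p / q)) <=
   (energy_cst * harmonic_sum N.+1)%:E)%E.
Proof.
(* The centred cube containing the annulus of index [i + 1]. These cubes overlap, which is harmless
   in an upper bound, and their volume is explicit. *)
pose Q (i : nat) : set T := cube (\row__ (- 2 ^+ i.+2)) (4 * 2 ^+ i.+1).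
pose c (i : nat) : R := (n%:R * (8 / (i.+1%:R * 2 ^+ i.+1))) `^ p *
  (D * (2 ^+ i.+1) `^ (- (n%:R - p)) * i.+1%:R `^ (p - 1)).
have c0 i : 0 <= c i by rewrite !mulr_ge0 ?powR_ge0.
have mQ i : measurable (Q i) by exact: measurable_cube.
apply: (@le_trans _ _ (\int[leb]_x (\sum_(i < N.+1) (c i * \1_(Q i) x)%:E))%E); last first.
  rewrite ge0_integral_sum//; last 2 first.
  - move=> i; apply/measurable_EFinP; apply: measurable_funM => //; exact: measurable_indic.
  - by move=> i x _; rewrite lee_fin mulr_ge0.
  rewrite (eq_bigr (fun i : 'I_N.+1 => (energy_cst * i.+1%:R^-1)%:E)); last first.
    move=> i _; rewrite -annulus_energy// -/(c i).
    rewrite (eq_integral (fun x => (c i)%:E * (\1_(Q i) x)%:E)%E); last by move=> x _; rewrite EFinM.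
    rewrite ge0_integralZl//; last 2 first.
    - by apply/measurable_EFinP; exact: measurable_indic.
    - by rewrite lee_fin.
    rewrite integral_indic// setIT -[X in (_ * X)%E]/(leb (Q i)) lebesgue_rV_cube.
      by rewrite -EFinM.
    by rewrite mulr_gt0// exprn_gt0.
  by rewrite sumEFin -mulr_sumr.
apply: ge0_le_integral_ptw => x _.
  by rewrite mule_ge0 ?poweR_ge0// lee_fin powR_ge0.
have S0 : (0 <= \sum_(i < N.+1) (c i * \1_(Q i) x)%:E)%E.
  by apply: sume_ge0 => i _; rewrite lee_fin mulr_ge0.
have [x2|x2] := ltP `|x| 2.
  by rewrite gradient_log_bump_inner// normr0 powR0 ?gt_eqF// mul0e.
have exP : exists k, `|x| < 2 ^+ k.
  exists (Num.bound `|x|); apply: lt_le_trans (archi_boundP _) _ => //.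
  by rewrite -natrX ler_nat ltnW// ltn_expl.
case: (ex_minnP exP) => -[|[|i]] xk mink.
- by exfalso; move: xk; rewrite expr0; lra.
- by exfalso; move: xk; rewrite expr1; lra.
have xi : 2 ^+ i.+1 <= `|x| < 2 ^+ i.+2.
  rewrite xk andbT leNgt; apply/negP => /mink; rewrite ltnn.
  by [].
have /andP[xi1 _] := xi.
have g := gradient_log_bump N (ltn0Sn i) xi.
have [iN|iN] := leqP i.+1 N.+1; last first.
  have -> : euclidean_norm (gradient (log_bump N) x) = 0.
    apply/eqP; rewrite eq_le sqrtr_ge0 andbT; apply: (le_trans g).
    by rewrite /bump_slope leqNgt iN mulr0.
  by rewrite normr0 powR0 ?gt_eqF// mul0e.
rewrite (bigD1 (Ordinal iN))//=; apply: (@le_trans _ _ (c i * \1_(Q i) x)%:E); last first.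
  by rewrite leeDl// sume_ge0// => j _; rewrite lee_fin mulr_ge0.
rewrite indicE mem_set ?mulr1 => [|d]; last first.
  rewrite mxE; have : `|x ord0 d| <= 2 ^+ i.+2.
    apply: le_trans (ltW xk); rewrite /Num.Def.normr/= mx_normrE.
    exact: (le_bigmax _ (fun i : 'I_1 * 'I_n => `|x i.1 i.2|) (ord0, d)).
  rewrite ler_norml [2 ^+ i.+2]exprS => /andP[h1 h2]; apply/andP; split=> //.
  by apply: (le_trans h2); lra.
rewrite /c EFinM; apply: lee_pmul; rewrite ?poweR_ge0 ?lee_fin ?powR_ge0//; last first.
  exact: unit_cube_weight_powR.
rewrite ger0_norm ?sqrtr_ge0//; apply: ge0_ler_powR; rewrite ?nnegrE ?sqrtr_ge0 ?(ltW p0)//.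
by apply: (le_trans g); rewrite /bump_slope iN.
Qed.

Lemma log_bump_Lnorm N :
  ((harmonic_sum N)%:E <= weighted_Lnorm q (EFin \o w) (log_bump N : T -> R))%E.
Proof.
have H0 : 0 <= harmonic_sum N :> R by rewrite sumr_ge0// => j _; rewrite invr_ge0.
rewrite /weighted_Lnorm.
have -> : (harmonic_sum N)%:E = ((harmonic_sum N `^ q)%:E `^ q^-1)%E :> \bar R.
  by rewrite poweR_EFin -powRrM divff ?gt_eqF// powRr1.
apply: le_poweR; rewrite ?lee_fin ?powR_ge0 ?invr_ge0 ?(ltW q0)//.
have -> : ((harmonic_sum N `^ q)%:E = \int[leb]_(x in cube 0%R 1) cst (harmonic_sum N `^ q)%:E x :> \bar R)%E.
  rewrite integral_cst; last exact: measurable_cube.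
  by rewrite -[X in (_ * X)%E]/(leb (cube 0%R 1)) lebesgue_rV_cube// expr1n mule1.
rewrite integral_mkcond; apply: ge0_le_integral_ptw => x _.
  by apply: erestrict_ge0 => y _; rewrite lee_fin powR_ge0.
rewrite patchE /w /= /unit_cube_weight indicE; case: ifPn => hx; last first.
  by rewrite mule0.
rewrite mule1 lee_fin log_bump_inner ?ger0_norm//.
rewrite /Num.Def.normr/= mx_normrE; apply: bigmax_le => // -[i d] _ /=.
move: hx; rewrite inE (ord1 i) => /(_ d); rewrite !mxE => /andP[h1 h2].
by rewrite ger0_norm//; lra.
Qed.

Lemma harmonic_sum_unbounded (A : R) : exists N, A < harmonic_sum N.
Proof.
apply: contrapT => h; apply: (@dvg_harmonic R).
have E : series (@harmonic R) = @harmonic_sum R.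
  by apply/funext => N; rewrite /series/= big_mkord.
rewrite E; apply: nondecreasing_is_cvgn.
  apply/nondecreasing_seqP => N; rewrite /harmonic_sum big_ord_recr/= lerDl invr_ge0.
  by [].
by exists A => _ [N _ <-]; rewrite leNgt; apply/negP => hN; apply: h; exists N.
Qed.

Lemma sobolev_weighted_fails : ~ exists C : R, forall w : T -> R, weight w ->
  forall u : T -> R, Lip_c u -> sobolev_inequality p q (n%:R - kap) (LlogL gam) C w u.
Proof.
move=> [C hC]; have E0 : 0 <= energy_cst.
  by rewrite !mulr_ge0 ?exprn_ge0 ?powR_ge0.
(* [M] is the bound that [H <= c * H^(1/p)] would force on the harmonic sums. The absolute value
   admits a constant of any sign, and the maximum with 1 below gives [H_(N+1) <= 2 * H_N]. *)
pose M := (`|C| * (energy_cst * 2) `^ p^-1) `^ (p / (p - 1)).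
have [N hN] := harmonic_sum_unbounded (Num.max 1 M).
move: hN; rewrite gt_max => /andP[H1 HM].
have H0 : 0 < harmonic_sum N :> R by exact: lt_trans H1.
have h := hC w (@weight_unit_cube R n) (log_bump N) (Lip_c_log_bump _ N).
have {}h := le_trans (log_bump_Lnorm N) h.
have pi0 : 0 <= p^-1 by rewrite invr_ge0 ltW.
have G0 : (0 <= \int[leb]_x ((`|euclidean_norm (gradient (log_bump N) x)| `^ p)%:E * V x `^ (p / q)))%E.
  by apply: integral_ge0 => x _; rewrite mule_ge0 ?poweR_ge0// lee_fin powR_ge0.
have {}h : ((harmonic_sum N)%:E <= (`|C| * (energy_cst * harmonic_sum N.+1) `^ p^-1)%:E)%E.
  apply: (le_trans h); rewrite EFinM -poweR_EFin /weighted_Lnorm.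
  apply: (@le_trans _ _ (`|C|%:E * (\int[leb]_x ((`|euclidean_norm (gradient (log_bump N) x)| `^ p)%:E * V x `^ (p / q))) `^ p^-1)%E).
    by apply: lee_wpmul2r; rewrite ?poweR_ge0// lee_fin ler_norm.
  by apply: lee_wpmul2l; rewrite ?lee_fin//; apply: le_poweR => //; exact: log_bump_energy.
have HN : harmonic_sum N.+1 <= 2 * harmonic_sum N :> R.
  rewrite /harmonic_sum big_ord_recr/= -/(harmonic_sum N) mulr_natl mulr2n lerD2l.
  by apply: le_trans (ltW H1); rewrite invf_le1// ler1n.
move: h; rewrite lee_fin => h.
set H := harmonic_sum N in H1 HM H0 h HN.
have {}h : H <= `|C| * (energy_cst * 2) `^ p^-1 * H `^ p^-1.
  have HN1 : 0 <= harmonic_sum N.+1 :> R by rewrite sumr_ge0// => j _; rewrite invr_ge0.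
  have EH : 0 <= energy_cst * harmonic_sum N.+1 by exact: mulr_ge0.
  have E2 : 0 <= energy_cst * 2 by exact: mulr_ge0.
  apply: (le_trans h); rewrite -mulrA ler_wpM2l// -(powRM _ E2 (ltW H0)).
  apply: ge0_ler_powR => //; first by rewrite nnegrE (mulr_ge0 E2 (ltW H0)).
  by rewrite -mulrA ler_wpM2l.
have p10 : 0 < p - 1 by rewrite subr_gt0.
have HE : H = H `^ ((p - 1) / p) * H `^ p^-1.
  rewrite -powRD; last by rewrite (gt_eqF H0) implybT.
  have -> : (p - 1) / p + p^-1 = 1 by field; rewrite gt_eqF.
  by rewrite powRr1 ?ltW.
move: h; rewrite {1}HE ler_pM2r ?powR_gt0// => h.
have r0 : 0 <= p / (p - 1) by rewrite divr_ge0 ?ltW.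
have := @ge0_ler_powR R (p / (p - 1)) r0 _ _ _ _ h.
rewrite !nnegrE powR_ge0 mulr_ge0 ?powR_ge0// => /(_ isT isT).
rewrite -powRrM (_ : (p - 1) / p * (p / (p - 1)) = 1); last by field; rewrite !gt_eqF.
by rewrite powRr1 ?(ltW H0)// -/M leNgt HM.
Qed.

End failure.

Theorem theorem2p16 (R : realType) (n : nat) (p q : R)
    (hp1 : 1 < p) (hpn : p < n%:R)
    (hpq : p <= q) (hqs : q <= sobolev_exponent n p) :
  let alpha := n%:R - q / p * (n%:R - p) in
  (forall eps : R, 0 < eps ->
     let Theta := LlogL (q / conjugate_exponent p + eps) in
     exists C : R, forall w : 'rV[R]_n -> R, weight w ->
       forall u : 'rV[R]_n -> R, Lip_c u ->
         sobolev_inequality p q alpha Theta C w u) /\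
  (let Theta := LlogL (q / conjugate_exponent p) in
   ~ exists C : R, forall w : 'rV[R]_n -> R, weight w ->
       forall u : 'rV[R]_n -> R, Lip_c u ->
         sobolev_inequality p q alpha Theta C w u).
Proof.
have n0 : (0 < n)%N by rewrite -(ltr0n R); exact: lt_trans (lt_trans ltr01 hp1) hpn.
split; last exact: sobolev_weighted_fails.
by move=> eps eps0; exact: sobolev_weighted.
Qed.
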